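(* Let $0\le\lambda\le1$ and let $(\boldsymbol\theta^k)$ be generated by projected AdaTD($\lambda$) (defined in the context) under Markovian observation, with parameters $\eta>0$, $\delta>0$, $0\le\beta<1$ and projection radius $$\hat R\ge \frac{2B}{\sqrt\omega\,(1-\gamma)\sqrt{1-\frac{\gamma(1-\lambda)}{1-\gamma\lambda}}}.$$ Then, to achieve $\epsilon$-accuracy, i.e. $\min_{1\le k\le K}\mathbb E(\|\boldsymbol\theta^*-\boldsymbol\theta^k\|^2)\le\epsilon$, the number $K$ of iterations needed is $$\tilde O\left(\frac{\ln^4\frac1\epsilon}{\epsilon^2\ln^4\frac1\rho}\right).$$ If, further, $v^k\le c\,k^\nu$ for all $k\ge1$, where $c>0$ is a universal constant and $0<\nu\le1$, then the complexity can be improved to $$\tilde O\left(\frac{(\ln\frac1\epsilon)^{\frac{2}{1-\nu/2}}}{\epsilon^{\frac1{1-\nu/2}}\,(\ln\frac1\rho)^{\frac{2}{1-\nu/2}}}\right).$$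
   Context: Setting. A policy $\mu$ is fixed, giving a time-homogeneous Markov chain on a finite state space $\mathcal S$ with transition probabilities $\mathcal P(s'|s)$, transition rewards $\mathcal R(s,s')$, and discount factor $0<\gamma<1$. Put $\mathcal R(s):=\sum_{s'}\mathcal P(s'|s)\mathcal R(s,s')$ and define the $\lambda$-averaged Bellman operator $$(\mathcal T_\mu^\lambda V)(s):=(1-\lambda)\sum_{m=0}^\infty\lambda^m\,\mathbb E\Big[\sum_{t=0}^m\gamma^t\mathcal R(s_t)+\gamma^{m+1}V(s_{m+1})\,\Big|\,s_0=s\Big]$$ (for $\lambda=1$ understood as the limit $\lambda\to1$, i.e. $\mathbb E[\sum_{t\ge0}\gamma^t\mathcal R(s_t)\mid s_0=s]$). Standing assumptions. (i) $|\mathcal R(s,s')|\le B$ for all $s,s'$. (ii) For all $s,s'\in\mathcal S$, $\pi(s')=\lim_{t\to\infty}\mathcal P(s_t=s'|s_0=s)>0$ and there are $\bar\kappa>0$ and $\rho\in(0,1)$ with $\sup_{s\in\mathcal S}\sum_{s'\in\mathcal S}|\mathcal P(s_t=s'|s_0=s)-\pi(s')|\le\bar\kappa\rho^t$ for all $t$. (iii) Each state has a feature vector $\phi(s)\in\mathbb R^d$, $d<|\mathcal S|$, with $\|\phi(s)\|\le1$ ($\|\cdot\|$ is the $\ell_2$ norm), and the matrix $\Phi\in\mathbb R^{|\mathcal S|\times d}$ with rows $\phi(s)^\top$ has full column rank. Notation. $\omega:=\lambda_{\min}(\Phi^\top\mathrm{Diag}(\pi)\Phi)>0$. $\mathbf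 g^\lambda(\boldsymbol\theta):=\Phi^\top\mathrm{Diag}(\pi)(\mathcal T_\mu^\lambda\Phi\boldsymbol\theta-\Phi\boldsymbol\theta)$, and $\boldsymbol\theta^*\in\mathbb R^d$ is its unique zero. $\mathrm{Proj}_{\hat R}$ is the Euclidean projection onto $\{x\in\mathbb R^d:\|x\|\le\hat R\}$. Projected AdaTD($\lambda$). Let $s_1,s_2,\dots$ be a trajectory of the chain (Markovian observation: not assumed stationary), $\mathbf z^0=0$, $\mathbf m^0=0$, $v^0=0$, and let the initial parameter be deterministic of norm at most $\hat R$. For $k=1,2,\dots$: $\mathbf z^k=\gamma\lambda\,\mathbf z^{k-1}+\phi(s_k)$; $$\mathbf g^k:=\big(\mathcal R(s_k,s_{k+1})+\gamma\phi(s_{k+1})^\top\boldsymbol\theta^k-\phi(s_k)^\top\boldsymbol\theta^k\big)\mathbf z^k;$$ $\mathbf m^k=\beta\mathbf m^{k-1}+(1-\beta)\mathbf g^k$, $v^k=v^{k-1}+\|\mathbf g^k\|^2$, $\boldsymbol\theta^{k+1}=\mathrm{Proj}_{\hat R}\big(\boldsymbol\theta^k+\eta\,\mathbf m^k/\sqrt{v^k+\delta}\big)$. $\mathbb E$ is expectation over the trajectory. $\tilde O(b)$ denotes $O(b)$ up to factors logarithmic in $b$, as $\epsilon\to0$; constants may depend on the other fixed parameters. *)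

(* Defs.v *)
From HB Require Import structures.
From mathcomp Require Import all_boot all_order all_algebra.
From mathcomp Require Import all_classical all_reals all_analysis.

Set Implicit Arguments.
Unset Strict Implicit.
Unset Printing Implicit Defensive.

Import Order.TTheory GRing.Theory Num.Theory.
Import numFieldNormedType.Exports.

Local Open Scope classical_set_scope.
Local Open Scope ring_scope.

(* States are the elements of 'I_n and feature vectors live in 'cV[R]_d.  The
   library norm on 'cV[R]_d is the sup norm, so the l2 norm is [norm2]. *)

Section Euclidean.
Variables (R : realType) (d : nat).

Definition norm2 (x : 'cV[R]_d) : R := Num.sqrt (\sum_(i < d) x i ord0 ^+ 2).

Definition dot (x y : 'cV[R]_d) : R := \sum_(i < d) x i ord0 * y i ord0.

(* A nearest point of A to x; the default x is never used when A is nonempty,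
   closed and convex, in which case the nearest point is unique. *)
Definition eproj (A : set 'cV[R]_d) (x : 'cV[R]_d) : 'cV[R]_d :=
  xget x [set y | A y /\ forall z, A z -> norm2 (x - y) <= norm2 (x - z)].

Definition proj_ball (r : R) : 'cV[R]_d -> 'cV[R]_d :=
  eproj [set x | norm2 x <= r].

(* The smallest eigenvalue of A.  The set is finite, and it is nonempty for
   symmetric A and 0 < d, so that the infimum is a minimum. *)
Definition lambda_min (A : 'M[R]_d) : R := inf [set a | eigenvalue A a].

End Euclidean.

Section Chain.
Variables (R : realType) (n : nat).
Variable P : 'M[R]_n.  (* P s s' is the probability of moving from s to s' *)

Definition stochastic : Prop :=
  (forall s s', 0 <= P s s') /\ (forall s, \sum_(s' < n) P s s' = 1).

(* E[ F (s_0, s_1, ...) | s_0 = s ] for F depending on s_0, ..., s_m only, as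
   the finite sum over all paths of length m issued from s. *)
Definition path_expectation (m : nat) (s : 'I_n) (F : (nat -> 'I_n) -> R) : R :=
  \sum_(x : {ffun 'I_m.+1 -> 'I_n} | x ord0 == s)
    let y := fun t : nat => x (inord t) in
    (\prod_(t < m) P (y t) (y t.+1)) * F y.

(* The trajectory is indexed from 1: s 0 is left unconstrained.  The initial
   distribution is arbitrary.  The identity is the Markov property with
   transition matrix P, multiplied by the probability of the past. *)
Definition markov_trajectory {disp} {Omega : measurableType disp}
    (Pr : probability Omega R) (s : nat -> Omega -> 'I_n) : Prop :=
  (forall k x, (1 <= k)%N -> measurable [set w | s k w = x]) /\
  (forall k (x : nat -> 'I_n), (1 <= k)%N ->
     Pr [set w | forall j, (1 <= j <= k.+1)%N -> s j w = x j] =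
     (Pr [set w | forall j, (1 <= j <= k)%N -> s j w = x j]
        * (P (x k) (x k.+1))%:E)%E).

Variables (rew : 'I_n -> 'I_n -> R) (gamma : R).

Definition mean_reward (s : 'I_n) : R := \sum_(s' < n) P s s' * rew s s'.

Definition bellman_lt1 (lambda : R) (V : 'cV[R]_n) (s : 'I_n) : R :=
  (1 - lambda) *
  limn (series (fun m : nat => lambda ^+ m *
    path_expectation m.+1 s (fun x =>
      \sum_(t < m.+1) gamma ^+ t * mean_reward (x t)
      + gamma ^+ m.+1 * V (x m.+1) ord0))).

Definition bellman (lambda : R) (V : 'cV[R]_n) : 'cV[R]_n :=
  \col_s (if lambda == 1 then lim (bellman_lt1 l V s @[l --> 1^'-])
          else bellman_lt1 lambda V s).

Variables (d : nat) (Phi : 'M[R]_(n, d)) (pi_ : 'rV[R]_n).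

Definition feature (s : 'I_n) : 'cV[R]_d := (row s Phi)^T.

Definition feature_gram : 'M[R]_d := Phi^T *m diag_mx pi_ *m Phi.

Definition mean_update (lambda : R) (theta : 'cV[R]_d) : 'cV[R]_d :=
  Phi^T *m diag_mx pi_ *m (bellman lambda (Phi *m theta) - Phi *m theta).

End Chain.

Section AdaTD.
Variables (R : realType) (n d : nat).
Variables (rew : 'I_n -> 'I_n -> R) (gamma : R) (Phi : 'M[R]_(n, d)).
Variables (lambda eta delta beta Rhat : R) (theta1 : 'cV[R]_d).

Record adatd_state := AdaTDState {
  trace : 'cV[R]_d;      (* z^k *)
  momentum : 'cV[R]_d;   (* m^k *)
  accum : R;             (* v^k *)
  next_iter : 'cV[R]_d   (* theta^(k+1) *)
}.

(* s and s' are s_k and s_(k+1). *)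
Definition adatd_step (s s' : 'I_n) (S : adatd_state) : adatd_state :=
  let theta := next_iter S in
  let z := (gamma * lambda) *: trace S + feature Phi s in
  let g := (rew s s' + gamma * dot (feature Phi s') theta
            - dot (feature Phi s) theta) *: z in
  let m := beta *: momentum S + (1 - beta) *: g in
  let v := accum S + norm2 g ^+ 2 in
  AdaTDState z m v
    (proj_ball Rhat (theta + (eta / Num.sqrt (v + delta)) *: m)).

(* The state after iterations 1, ..., k along the trajectory x 1, x 2, ... *)
Fixpoint adatd (x : nat -> 'I_n) (k : nat) : adatd_state :=
  if k is k'.+1 then adatd_step (x k) (x k.+1) (adatd x k')
  else AdaTDState 0 0 0 theta1.

(* theta^k, for 1 <= k *)
Definition adatd_theta (x : nat -> 'I_n) (k : nat) : 'cV[R]_d :=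
  next_iter (adatd x k.-1).

Definition adatd_v (x : nat -> 'I_n) (k : nat) : R := accum (adatd x k).

End AdaTD.

Section Complexity.
Variable R : realType.

(* The minimum is +oo, hence no accuracy is achieved, when K = 0. *)
Definition accurate (err : nat -> \bar R) (eps : R) (K : nat) : Prop :=
  (\big[Order.min/+oo]_(1 <= k < K.+1) err k <= eps%:E)%E.

(* Since [accurate err eps] is monotone in K, the inner statement says that the
   least sufficient K is at most C * b eps * (ln (b eps))^p. *)
Definition complexity_le (err : nat -> \bar R) (C : R) (p : nat)
    (b : R -> R) : Prop :=
  \forall eps \near 0^'+,
    exists2 K : nat, accurate err eps K & K%:R <= C * b eps * ln (b eps) ^+ p.

End Complexity.

(* Main.v *)
Require Import Defs.
From HB Require Import structures.
From mathcomp Require Import all_boot all_order all_algebra.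
From mathcomp Require Import all_classical all_reals all_analysis.
From mathcomp Require Import measurable_realfun.
From mathcomp Require Import ring lra zify.

(* The Bellman operator is T V = V + u, where u = (I - gamma lambda P)^-1 td V
   and td V = r + gamma P V - V.  In the norm of L^2(pi) it contracts with
   modulus gamma (1 - lambda) / (1 - gamma lambda) <= gamma, so that theta* lies
   in the ball of projection and <theta* - theta, g(theta)> dominates a multiple
   of |theta* - theta|^2.
   Along each path let A_k = 1 / sqrt (v^k + delta) and e_k = |theta* - theta^(k+1)|.
   Since sum_k A_(k+1)^2 |g^(k+1)|^2 <= ln (1 + v^N / delta), the regret
   sum_k A_k <theta* - theta^(k+1), g^(k+1)> is O(ln N).  In each term the
   Markovian noise is compared with its value at the iterate 2T steps earlier; by
   the Young inequality the error is absorbed by sum_k A_k e_k^2 up to O(T^2 ln N).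
   Given the past, the frozen noise has expectation O(gamma^T + rho^T): T steps
   are used to truncate the eligibility trace and T to mix.  With T ~ ln N,
   sum_(k < N) E[A_k e_k^2] = O(ln^3 N), and v^k <= c k^nu turns this into
   min_k E[e_k^2] = O(ln^3 N / N^(1 - nu/2)).  The first bound is the case nu = 1,
   as the g^k are bounded.  The powers of ln rho^-1 are absorbed by the
   logarithmic factor, because the threshold on eps may depend on rho. *)

Set Implicit Arguments.
Unset Strict Implicit.
Unset Printing Implicit Defensive.

Import Order.TTheory GRing.Theory Num.Theory.
Import numFieldNormedType.Exports.

Local Open Scope classical_set_scope.
Local Open Scope ring_scope.

(** * Euclidean and weighted norms *)

(** The step size of an iteration contains the gradient of that same iteration, so the two are
    correlated. The pathwise estimates therefore exchange it for a step size known before the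
    gradient; since step sizes decrease, these exchanges telescope and cost a multiple of A_0.
    Momentum is removed by a recursion for its correlation with the distance to the limit point, and
    its normalized energy is dominated by that of the gradients. Expectations are finite sums over
    the coordinates of a path. Measure theory enters only where an integral over the trajectory is
    identified with such a sum, and where an almost sure bound on v^k is used. The constant of the
    rate depends on rho, whereas C and p are chosen before rho. The numerator ln^2 (1/eps) of the
    target supplies a factor that tends to infinity and eventually exceeds this constant. *)

Section WeightedNorm.
Variables (R : realType) (I : finType) (w : I -> R).
Hypothesis w_ge0 : forall i, 0 <= w i.

(** Three weights occur: 1 for the Euclidean norm, [pi_] for the norm of L^2(pi), and a row of [P]
    for Jensen's inequality. *)
Definition wdot (f g : I -> R) : R := \sum_i w i * (f i * g i).
Definition wnorm (f : I -> R) : R := Num.sqrt (wdot f f).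

Lemma wdot_ge0 f : 0 <= wdot f f.
Proof. by apply: sumr_ge0 => i _; rewrite mulr_ge0 // -expr2 sqr_ge0. Qed.

Lemma wdot_lin a b f g : wdot (fun i => a * f i + b * g i) (fun i => a * f i + b * g i)
  = a ^+ 2 * wdot f f + 2 * (a * b) * wdot f g + b ^+ 2 * wdot g g.
Proof.
rewrite /wdot !mulr_sumr -!big_split /=; apply: eq_bigr => i _; ring.
Qed.

(** Weights may vanish, so this is a semi-inner product and the case <g, g> = 0 with g nonzero has
    to be treated apart. *)
Lemma wdot_sqr_le f g : wdot f g ^+ 2 <= wdot f f * wdot g g.
Proof.
have := wdot_ge0 f; have := wdot_ge0 g.
have E a b : 0 <= a ^+ 2 * wdot f f + 2 * (a * b) * wdot f g + b ^+ 2 * wdot g g.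
  by rewrite -wdot_lin wdot_ge0.
rewrite le_eqVlt => /orP[/eqP b0|b_gt0] a_ge0.
  have -> : wdot f g = 0; last by rewrite expr0n -b0 mulr0.
  (* The form is affine in its second coefficient when <g, g> = 0; this coefficient makes it equal
     to -1. *)
  apply/eqP/negP => /negP c0; have := E 1 (- (wdot f f + 1) / (2 * wdot f g)).
  have -> : 2 * (1 * (- (wdot f f + 1) / (2 * wdot f g))) * wdot f g = - (wdot f f + 1).
    by field.
  rewrite -b0; lra.
have := E (wdot g g) (- wdot f g) => H.
rewrite -(ler_pM2l b_gt0); nra.
Qed.

Lemma wnorm_ge0 f : 0 <= wnorm f. Proof. exact: sqrtr_ge0. Qed.

Lemma sqr_wnorm f : wnorm f ^+ 2 = wdot f f.
Proof. by rewrite sqr_sqrtr // wdot_ge0. Qed.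

Lemma ler_norm_wdot f g : `|wdot f g| <= wnorm f * wnorm g.
Proof.
rewrite -(@ler_pXn2r _ 2) ?nnegrE ?mulr_ge0 ?wnorm_ge0 //.
by rewrite real_normK ?num_real // exprMn !sqr_wnorm wdot_sqr_le.
Qed.

Lemma wnormZ a f : wnorm (fun i => a * f i) = `|a| * wnorm f.
Proof.
rewrite /wnorm -sqrtr_sqr -sqrtrM ?sqr_ge0 //; congr Num.sqrt.
by rewrite /wdot mulr_sumr; apply: eq_bigr => i _; ring.
Qed.

Lemma wnormD f g : wnorm (fun i => f i + g i) <= wnorm f + wnorm g.
Proof.
rewrite -(@ler_pXn2r _ 2) ?nnegrE ?addr_ge0 ?wnorm_ge0 // sqr_wnorm.
have -> : wdot (fun i => f i + g i) (fun i => f i + g i) =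
   wdot f f + 2 * wdot f g + wdot g g.
  rewrite /wdot mulr_sumr -!big_split /=; apply: eq_bigr => i _; ring.
rewrite sqrrD !sqr_wnorm; have := ler_norm_wdot f g; have := ler_norm (wdot f g).
rewrite -mulr_natl; lra.
Qed.

End WeightedNorm.

Section Norm2.
Variables (R : realType) (d : nat).
Implicit Types x y z : 'cV[R]_d.

Lemma dotC x y : dot x y = dot y x.
Proof. by apply: eq_bigr => i _; rewrite mulrC. Qed.

Lemma dotDl x y z : dot (x + y) z = dot x z + dot y z.
Proof. by rewrite -big_split; apply: eq_bigr => i _; rewrite mxE mulrDl. Qed.

Lemma dotDr x y z : dot z (x + y) = dot z x + dot z y.
Proof. by rewrite dotC dotDl !(dotC z). Qed.

Lemma dotZl a x y : dot (a *: x) y = a * dot x y.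
Proof. by rewrite mulr_sumr; apply: eq_bigr => i _; rewrite mxE mulrA. Qed.

Lemma dotZr a x y : dot x (a *: y) = a * dot x y.
Proof. by rewrite dotC dotZl dotC. Qed.

Lemma dotNl x y : dot (- x) y = - dot x y.
Proof. by rewrite -scaleN1r dotZl mulN1r. Qed.

Lemma dotNr x y : dot x (- y) = - dot x y.
Proof. by rewrite dotC dotNl dotC. Qed.

Lemma dot0l x : dot 0 x = 0.
Proof. by rewrite -(scale0r x) dotZl mul0r. Qed.

Lemma dot0r x : dot x 0 = 0.
Proof. by rewrite dotC dot0l. Qed.

Lemma dot_wdot x y : dot x y = wdot (fun=> 1) (x ^~ ord0) (y ^~ ord0).
Proof. by apply: eq_bigr => i _; rewrite mul1r. Qed.

Lemma norm2_wnorm x : norm2 x = wnorm (fun=> 1) (x ^~ ord0).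
Proof. by congr Num.sqrt; apply: eq_bigr => i _; rewrite mul1r expr2. Qed.

Lemma norm2_ge0 x : 0 <= norm2 x. Proof. exact: sqrtr_ge0. Qed.

Lemma sqr_norm2 x : norm2 x ^+ 2 = dot x x.
Proof. by rewrite norm2_wnorm sqr_wnorm // dot_wdot. Qed.

Lemma ler_norm_dot x y : `|dot x y| <= norm2 x * norm2 y.
Proof. by rewrite dot_wdot !norm2_wnorm ler_norm_wdot. Qed.

Lemma ler_dot x y : dot x y <= norm2 x * norm2 y.
Proof. by rewrite (le_trans (ler_norm _)) ?ler_norm_dot. Qed.

Lemma norm2Z a x : norm2 (a *: x) = `|a| * norm2 x.
Proof.
rewrite !norm2_wnorm -wnormZ; congr wnorm.
by apply/funext => i; rewrite mxE.
Qed.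

Lemma norm2N x : norm2 (- x) = norm2 x.
Proof. by rewrite -scaleN1r norm2Z normrN1 mul1r. Qed.

Lemma norm2BC x y : norm2 (x - y) = norm2 (y - x).
Proof. by rewrite -norm2N opprB. Qed.

Lemma norm2D x y : norm2 (x + y) <= norm2 x + norm2 y.
Proof.
rewrite !norm2_wnorm (le_trans _ (wnormD _ _ _)) //.
by rewrite le_eqVlt; apply/orP; left; apply/eqP; congr wnorm;
  apply/funext => i; rewrite mxE.
Qed.

Lemma norm2B x y : norm2 (x - y) <= norm2 x + norm2 y.
Proof. by rewrite -(norm2N y) norm2D. Qed.

Lemma norm20 : norm2 (0 : 'cV[R]_d) = 0.
Proof. by rewrite -(scale0r 0) norm2Z normr0 mul0r. Qed.

Lemma ler_norm2_sqr x y : (norm2 x <= norm2 y) = (norm2 x ^+ 2 <= norm2 y ^+ 2).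
Proof. by rewrite ler_pXn2r // nnegrE norm2_ge0. Qed.

Lemma norm2_eq0 x : norm2 x = 0 -> x = 0.
Proof.
move=> x0; have := sqr_norm2 x; rewrite x0 expr0n /= => /esym/eqP.
rewrite /dot psumr_eq0 => [/allP H|i _]; last by rewrite -expr2 sqr_ge0.
apply/matrixP => i j; rewrite ord1 mxE; have := H i (mem_index_enum _).
by rewrite mulf_eq0 orbb => /eqP.
Qed.

Lemma sqr_norm2D x y : norm2 (x + y) ^+ 2 = norm2 x ^+ 2 + 2 * dot x y + norm2 y ^+ 2.
Proof. by rewrite !sqr_norm2 dotDl !dotDr (dotC y x); ring. Qed.

End Norm2.

(** * Projection onto a Euclidean ball *)

Section Projection.
Variables (R : realType) (d : nat) (r : R).
Hypothesis r_ge0 : 0 <= r.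
Implicit Types x z : 'cV[R]_d.

(** [eproj] chooses by [xget], so a nearest point must be exhibited: x itself inside the ball, and
    outside it the radial point, which |x| <= |x - z| + |z| shows to be nearest. *)
Lemma proj_ballP x : norm2 (proj_ball r x) <= r /\
  forall z, norm2 z <= r -> norm2 (x - proj_ball r x) <= norm2 (x - z).
Proof.
rewrite /proj_ball /eproj; case: xgetP => [y _ []//|/= none].
exfalso; have [xr|rx] := leP (norm2 x) r.
  by apply: (none x); split=> // z _; rewrite subrr norm20 norm2_ge0.
have x0 : norm2 x > 0 by exact: le_lt_trans rx.
have nx : norm2 ((r / norm2 x) *: x) = r.
  by rewrite norm2Z ger0_norm ?divr_ge0 ?norm2_ge0 // divfK ?gt_eqF.
apply: (none ((r / norm2 x) *: x)); split; first by rewrite /= nx.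
move=> z zr; have -> : x - (r / norm2 x) *: x = (1 - r / norm2 x) *: x.
  by rewrite scalerBl scale1r.
rewrite norm2Z ger0_norm; last by rewrite subr_ge0 ler_pdivrMr // mul1r ltW.
rewrite mulrBl divfK ?gt_eqF // mul1r lerBlDr.
by rewrite -{1}(subrK z x) (le_trans (norm2D _ _)) // lerD2l.
Qed.

Lemma norm2_proj_ball x : norm2 (proj_ball r x) <= r.
Proof. by case: (proj_ballP x). Qed.

(** Comparing the projection y with the points of the segment from y to z gives the variational
    inequality <x - y, z - y> <= 0; expanding |x - z|^2 around y concludes. *)
Lemma proj_ball_nonexpansive x z : norm2 z <= r ->
  norm2 (proj_ball r x - z) <= norm2 (x - z).
Proof.
have [] := proj_ballP x; set y := proj_ball r x => yr ymin zr.
have H (t : R) : 0 <= t <= 1 -> 2 * t * dot (x - y) (z - y) <= t ^+ 2 * norm2 (z - y) ^+ 2.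
  move=> /andP[t0 t1].
  have := ymin (y + t *: (z - y)); have -> : y + t *: (z - y) = (1 - t) *: y + t *: z.
    by apply/matrixP => i j; rewrite !mxE; ring.
  have -> : norm2 ((1 - t) *: y + t *: z) <= r.
    rewrite (le_trans (norm2D _ _)) // !norm2Z !ger0_norm ?subr_ge0 //.
    have := norm2_ge0 y; have := norm2_ge0 z; nra.
  move=> /(_ isT).
  have -> : x - ((1 - t) *: y + t *: z) = (x - y) + (- t) *: (z - y).
    apply/matrixP => i j; rewrite !mxE; ring.
  rewrite ler_norm2_sqr (sqr_norm2D (x - y)) dotZr norm2Z exprMn.
  by rewrite real_normK ?num_real // sqrrN; lra.
have dot_le0 : dot (x - y) (z - y) <= 0.
  rewrite leNgt; apply/negP => d_gt0.
  set D := dot _ _ in H d_gt0; set Z := norm2 _ ^+ 2 in H.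
  have Z0 : 0 <= Z by rewrite sqr_ge0.
  have s_gt0 : 0 < D + Z by lra.
  have := H (D / (D + Z)).
  rewrite ler_pdivrMr // mul1r divr_ge0 ?(ltW d_gt0) ?(ltW s_gt0) //= lerDl Z0 => /(_ isT).
  (* For this t the inequality [H] would give 2 D <= t Z = D - t D < D. *)
  set t := D / (D + Z); have t0 : 0 < t by rewrite divr_gt0.
  have : t * (D + Z) = D by rewrite /t divfK ?gt_eqF.
  nra.
rewrite ler_norm2_sqr -(subrKA y x (- z)) (sqr_norm2D (x - y)).
have -> : dot (x - y) (y - z) = - dot (x - y) (z - y) by rewrite -dotNr opprB.
have := sqr_ge0 (norm2 (x - y)); lra.
Qed.

End Projection.

(** * The Rayleigh quotient *)

Lemma dot_mulmxr (R : realType) (m n : nat) (A : 'M[R]_(m, n)) x y :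
  dot x (A *m y) = dot (A^T *m x) y.
Proof.
transitivity (\sum_i \sum_j x i ord0 * A i j * y j ord0).
  apply: eq_bigr => i _; rewrite mxE mulr_sumr.
  by apply: eq_bigr => j _; rewrite mulrA.
rewrite exchange_big; apply: eq_bigr => j _; rewrite mxE mulr_suml.
by apply: eq_bigr => i _; rewrite mxE (mulrC (A i j)).
Qed.

Lemma continuous_sumr (R : realType) (T : topologicalType) (I : Type)
    (r : seq I) (f : I -> T -> R) :
  (forall i, continuous (f i)) -> continuous (fun x => \sum_(i <- r) f i x).
Proof. by move=> fc; apply: continuous_big => //; exact: add_continuous. Qed.

Lemma continuous_mulr (R : realType) (T : topologicalType) (f g : T -> R) :
  continuous f -> continuous g -> continuous (fun x => f x * g x).
Proof. by move=> cf cg x; apply: cvgM; [exact: cf|exact: cg]. Qed.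

Section Rayleigh.
Variables (R : realType) (d : nat) (G : 'M[R]_d).
Hypothesis G_sym : G^T = G.

(** The argument is a row vector because compactness of boxes comes from [rV_compact]. *)
Let q (v : 'rV[R]_d) : R := dot v^T (G *m v^T).

Lemma quadratic_continuous : continuous q.
Proof.
have -> : q = (fun v => \sum_i v ord0 i * (\sum_j G i j * v ord0 j)).
  apply/funext => u; apply: eq_bigr => i _; rewrite !mxE; congr (_ * _).
  by apply: eq_bigr => j _; rewrite mxE.
apply: continuous_sumr => i; apply: continuous_mulr.
  exact: coord_continuous.
apply: continuous_sumr => j; apply: continuous_mulr.
  exact: cst_continuous.
exact: coord_continuous.
Qed.

Lemma rayleigh_min_attained : (0 < d)%N ->
  exists2 v : 'cV[R]_d, norm2 v = 1 &
    forall x, dot v (G *m v) * norm2 x ^+ 2 <= dot x (G *m x).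
Proof.
move=> d_gt0; pose S := [set v : 'rV[R]_d | dot v^T v^T = 1].
have S0 : S !=set0.
  exists (delta_mx ord0 (Ordinal d_gt0)); rewrite /S /= /dot.
  rewrite (bigD1 (Ordinal d_gt0)) //= big1 => [|i /negPf i0]; rewrite !mxE ?eqxx ?i0 //=.
    by rewrite mulr1 addr0.
  by rewrite mul0r.
have cbox : compact [set v : 'rV[R]_d | forall i, v ord0 i \in `[(-1), 1]].
  have := @rV_compact R d (fun=> `[(-1), 1]%classic); apply=> _.
  exact: segment_compact.
have cS : compact S.
  apply: (@subclosed_compact _ S [set v : 'rV[R]_d | forall i, v ord0 i \in `[(-1), 1]]).
  - apply: (@preimage_closed _ _ (fun v : 'rV[R]_d => dot v^T v^T) [set 1]).
      have -> : (fun v : 'rV[R]_d => \sum_i v^T i ord0 * v^T i ord0) =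
          (fun v => \sum_i v ord0 i * v ord0 i).
        by apply/funext => u; apply: eq_bigr => i _; rewrite !mxE.
      move=> v _; move: v.
      by apply: continuous_sumr => i; apply: continuous_mulr; exact: coord_continuous.
    exact: closed_eq.
  - exact: cbox.
  - move=> v /= vS i; rewrite in_itv /= -ler_norml.
    rewrite -(@ler_pXn2r _ 2) ?nnegrE // real_normK ?num_real // expr1n -vS /dot.
    rewrite (bigD1 i) //= !mxE -expr2 lerDl sumr_ge0 // => j _.
    by rewrite -expr2 sqr_ge0.
have [v vS vmin] := compact_EVT_min S0 cS
  (continuous_subspaceT quadratic_continuous).
exists v^T => [|x]; first by rewrite /norm2; move: vS; rewrite inE /S /= => vS;
  under eq_bigr do rewrite expr2; rewrite -/(dot _ _) vS sqrtr1.
have [/norm2_eq0 ->|x0] := eqVneq (norm2 x) 0.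
  by rewrite mulmx0 dot0l norm20 expr0n mulr0.
have := vmin ((norm2 x)^-1 *: x)^T; rewrite inE /S /q /= !trmxK.
have x_gt0 : 0 < norm2 x by rewrite lt_neqAle eq_sym x0 norm2_ge0.
rewrite dotZl dotZr -sqr_norm2 -scalemxAr dotZl dotZr => H.
have : (norm2 x)^-1 * ((norm2 x)^-1 * norm2 x ^+ 2) = 1 by field.
move=> /H; rewrite mulrA -invfM -expr2 mulrC ler_pdivlMr // exprn_gt0 //.
Qed.

(** A minimizer v of the Rayleigh quotient on the sphere is an eigenvector, by the first variation;
    conversely every eigenvalue is a value of the quotient, hence at least the minimum. *)
Lemma lambda_min_rayleigh : (0 < d)%N ->
  exists2 v : 'cV[R]_d, norm2 v = 1 & lambda_min G = dot v (G *m v) /\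
    forall x, lambda_min G * norm2 x ^+ 2 <= dot x (G *m x).
Proof.
move=> /rayleigh_min_attained[v v1 vmin]; exists v => //.
set mu := dot v _ in vmin *.
suff -> : lambda_min G = mu by [].
have ev : eigenvalue G mu.
  apply/eigenvalueP; exists v^T; last first.
    apply/eqP => /(congr1 trmx); rewrite trmxK trmx0 => v0.
    by move: v1; rewrite v0 norm20 => /esym/eqP; rewrite oner_eq0.
  apply: trmx_inj; rewrite trmx_mul trmxK G_sym linearZ /= trmxK.
  apply/eqP; rewrite -subr_eq0; apply/eqP/norm2_eq0.
  set y := _ - _.
  have yv : dot y v = 0.
    rewrite /y dotDl dotNl dotZl -[dot v v]sqr_norm2 v1 expr1n mulr1.
    by rewrite dotC subrr.
  (* The first variation of the Rayleigh quotient in the direction y. *)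
  have H (t : R) : 0 <= 2 * t * norm2 y ^+ 2 + t ^+ 2 * (dot y (G *m y) - mu * norm2 y ^+ 2).
    have e1 : dot v (G *m y) = norm2 y ^+ 2.
      rewrite dot_mulmxr G_sym -(subrK (mu *: v) (G *m v)) -/y dotDl dotZl (dotC v).
      by rewrite yv mulr0 addr0 sqr_norm2.
    have e2 : dot y (G *m v) = norm2 y ^+ 2.
      rewrite -(subrK (mu *: v) (G *m v)) -/y dotDr dotZr.
      by rewrite yv mulr0 addr0 sqr_norm2.
    clearbody y; have := vmin (v + t *: y).
    rewrite sqr_norm2D dotZr (dotC v y) yv v1 norm2Z exprMn real_normK ?num_real //.
    rewrite mulmxDr -scalemxAr !dotDl !dotDr !dotZl !dotZr e1 e2 -/mu; lra.
  have y0 := norm2_ge0 y; set b := dot y (G *m y) - _ in H.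
  apply/eqP; rewrite -sqrf_eq0; apply/eqP.
  set Y := norm2 y ^+ 2 in H *; have Y0 : 0 <= Y by rewrite sqr_ge0.
  have c0 : 0 < `|b| + 1 by rewrite ltr_wpDl.
  (* With c = 1 / (|b| + 1) this direction gives 2 c Y^2 <= c^2 b Y^2 <= c Y^2, so that Y = 0. *)
  have := H (- (`|b| + 1)^-1 * Y); have := ler_norm b.
  set c := _^-1; have cc : c * (`|b| + 1) = 1 by rewrite mulVf ?gt_eqF.
  have c_gt0 : 0 < c by rewrite invr_gt0.
  move=> bb HH; have cb : c * b <= 1.
    rewrite -cc ler_pM2l //; lra.
  have : c * Y ^+ 2 * (1 - c * b) >= 0.
    by rewrite mulr_ge0 ?subr_ge0 // mulr_ge0 ?sqr_ge0 // ltW.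
  move=> h; have : c * Y ^+ 2 <= 0 by nra.
  rewrite pmulr_rle0 // => Y2; apply/eqP; rewrite -sqrf_eq0.
  by rewrite eq_le Y2 sqr_ge0.
have lbd : lbound [set a | eigenvalue G a] mu.
  move=> a /eigenvalueP[u ua u0].
  have := vmin u^T; have -> : G *m u^T = a *: u^T.
    by rewrite -{1}G_sym -trmx_mul ua linearZ.
  rewrite dotZr -sqr_norm2 ler_pM2r // exprn_gt0 // lt_neqAle norm2_ge0 andbT.
  apply: contra u0 => /eqP/esym/norm2_eq0/(congr1 trmx).
  by rewrite trmxK trmx0 => ->.
apply/eqP; rewrite eq_le; apply/andP; split.
  by apply: ge_inf => //; exists mu.
by apply: lb_le_inf => //; exists mu.
Qed.

End Rayleigh.

(** * Path expectations and the resolvent *)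

Section PathExpectation.
Variables (R : realType) (n : nat) (P : 'M[R]_n).
Hypothesis P_sum1 : forall s, \sum_(s' < n) P s s' = 1.

Definition ffun_rcons (T : finType) m (x : {ffun 'I_m -> T}) (y : T) :
    {ffun 'I_m.+1 -> T} :=
  [ffun i => if unlift ord_max i is Some j then x j else y].

Lemma sum_ffun_rcons (T : finType) m (G : {ffun 'I_m.+1 -> T} -> R) :
  \sum_x G x = \sum_(x : {ffun 'I_m -> T}) \sum_(y : T) G (ffun_rcons x y).
Proof.
rewrite pair_bigA /= (reindex (fun p => ffun_rcons p.1 p.2)) //=.
exists (fun x => ([ffun i => x (lift ord_max i)], x ord_max)).
  move=> [x y] _ /=; congr pair; last by rewrite ffunE unlift_none.
  by apply/ffunP => i; rewrite !ffunE liftK.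
move=> x _ /=; apply/ffunP => i; rewrite !ffunE.
by case: unliftP => [j ->|->] //; rewrite ffunE.
Qed.

Lemma ffun_rcons_inord m (x : {ffun 'I_m.+1 -> 'I_n}) y t : (t <= m.+1)%N ->
  ffun_rcons x y (inord t) = if t == m.+1 then y else x (inord t).
Proof.
move=> tm; rewrite ffunE; case: unliftP => [j /(congr1 val)|/(congr1 val)] /=.
  rewrite inordK // => tj; have {tj} -> : t = j.
    by rewrite tj /bump leqNgt ltn_ord.
  by rewrite ltn_eqF ?ltn_ord // inord_val.
by rewrite inordK // => ->; rewrite eqxx.
Qed.

(** The marginal of the chain at time t is row s of P^t. Induction on the length integrates out the
    last coordinate. *)
Lemma path_expectation_coord m s (f : nat -> 'I_n -> R) :
  path_expectation P m s (fun x => \sum_(t < m.+1) f t (x t)) =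
  \sum_(t < m.+1) \sum_y (P ^+ t) s y * f t y.
Proof.
elim: m f => [|m IHm] f; rewrite /path_expectation.
  rewrite big_ord_recl big_ord0 addr0 expr0.
  rewrite (big_pred1 [ffun=> s]) => [|x]; last first.
    apply/eqP/eqP => [xs|->]; last by rewrite ffunE.
    by apply/ffunP => i; rewrite ffunE ord1.
  rewrite big_ord0 mul1r big_ord_recl big_ord0 addr0 ffunE.
  rewrite (bigD1 s) //= big1 => [|y /negPf ys]; first by rewrite mxE eqxx mul1r addr0.
  by rewrite mxE eq_sym ys mul0r.
(* The conditional mean of the last summand given the state at time m is moved into the summand of
   time m. *)
pose g t y := if t == m then f t y + \sum_z P y z * f m.+1 z else f t y.
transitivity (path_expectation P m s (fun x => \sum_(t < m.+1) g t (x t))).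
  rewrite /path_expectation big_mkcond sum_ffun_rcons [RHS]big_mkcond /=.
  apply: eq_bigr => x _; have x0 y : ffun_rcons x y ord0 = x ord0.
    have i0 k : ord0 = inord 0 :> 'I_k.+1 by apply/val_inj; rewrite /= inordK.
    by rewrite [in LHS]i0 ffun_rcons_inord // [in RHS]i0.
  under eq_bigr do rewrite x0.
  case: ifP => _; last by rewrite big1.
  have e t y : (t <= m)%N -> ffun_rcons x y (inord t) = x (inord t).
    by move=> tm; rewrite ffun_rcons_inord ?leqW // ltn_eqF.
  have e1 y : ffun_rcons x y (inord m.+1) = y by rewrite ffun_rcons_inord // eqxx.
  pose p := \prod_(t < m) P (x (inord t)) (x (inord t.+1)).
  pose S := \sum_(t < m.+1) f t (x (inord t)).
  transitivity (\sum_y p * (P (x (inord m)) y * S + P (x (inord m)) y * f m.+1 y)).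
    apply: eq_bigr => y _; rewrite big_ord_recr [X in _ * X]big_ord_recr /= e1 e //.
    rewrite -mulrDr mulrA; congr (_ * _ * (_ + _)).
      by apply: eq_bigr => t _; rewrite !e // ltnW.
    by apply: eq_bigr => t _; rewrite e // -ltnS.
  rewrite -mulr_sumr big_split /= -mulr_suml P_sum1 mul1r; congr (_ * _).
  rewrite /S !big_ord_recr /= {2}/g eqxx -addrA; congr (_ + _).
  by apply: eq_bigr => t _; rewrite /g ltn_eqF.
rewrite IHm big_ord_recr [RHS]big_ord_recr [in RHS]big_ord_recr /= -addrA.
congr (_ + _).
  by apply: eq_bigr => t _; apply: eq_bigr => y _; rewrite /g ltn_eqF.
rewrite /g eqxx; under eq_bigr do rewrite mulrDr.
rewrite big_split /=; congr (_ + _); under eq_bigr do rewrite mulr_sumr.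
rewrite exchange_big /=; apply: eq_bigr => y _; rewrite exprSr mxE mulr_suml.
by apply: eq_bigr => z _; rewrite mulrA.
Qed.

End PathExpectation.

(** * Stochastic matrices and their resolvent *)

Section Stochastic.
Variables (R : realType) (n : nat) (P : 'M[R]_n).
Hypothesis P_stoch : stochastic P.

Lemma stochastic_exp t : stochastic (P ^+ t).
Proof.
have [P0 P1] := P_stoch; elim: t => [|t [IH0 IH1]].
  rewrite expr0; split=> s => [s'|]; first by rewrite mxE; case: eqP.
  rewrite (bigD1 s) //= big1 => [|y /negPf ys]; first by rewrite mxE eqxx addr0.
  by rewrite mxE eq_sym ys.
rewrite exprS; split=> s => [s'|].
  by rewrite mxE sumr_ge0 // => i _; rewrite mulr_ge0.
under eq_bigr do rewrite mxE.
rewrite exchange_big /= -[RHS](P1 s); apply: eq_bigr => i _.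
by rewrite -mulr_sumr IH1 mulr1.
Qed.

Lemma stochastic_mul_bound (u : 'cV[R]_n) M s :
  (forall i, `|u i ord0| <= M) -> `|(P *m u) s ord0| <= M.
Proof.
have [P0 P1] := P_stoch => uM; rewrite mxE (le_trans (ler_norm_sum _ _ _)) //.
rewrite -[M]mul1r -(P1 s) mulr_suml ler_sum // => i _.
by rewrite normrM ger0_norm // ler_wpM2l.
Qed.

Variable a : R.
Hypothesis a_itv : 0 <= a < 1.

(** A row vector with v = a v P satisfies |v|_1 <= a |v|_1, because P does not increase the l1 norm
    of rows; as a < 1, it is zero. *)
Lemma resolvent_unitmx : 1%:M - a *: P \in unitmx.
Proof.
have [P0 P1] := P_stoch; case/andP: a_itv => a0 a1.
rewrite -row_free_unit; apply: inj_row_free => v.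
rewrite mulmxBr mulmx1 -scalemxAr => /eqP; rewrite subr_eq0 => /eqP va.
have nv : \sum_j `|v ord0 j| <= a * \sum_j `|v ord0 j|.
  rewrite mulr_sumr {1}va; apply: (@le_trans _ _ (\sum_j a * \sum_i `|v ord0 i| * P i j)).
    apply: ler_sum => j _; rewrite mxE normrM ger0_norm // ler_wpM2l // mxE.
    rewrite (le_trans (ler_norm_sum _ _ _)) // ler_sum // => i _.
    by rewrite normrM (ger0_norm (P0 _ _)).
  rewrite -!mulr_sumr ler_wpM2l // exchange_big /= ler_sum // => i _.
  by rewrite -mulr_sumr P1 mulr1.
have v0 : \sum_j `|v ord0 j| = 0.
  apply/eqP; rewrite eq_le sumr_ge0 // andbT; nra.
apply/matrixP => i j; rewrite ord1 mxE; apply/eqP; rewrite -normr_eq0.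
have /eqP := v0; rewrite psumr_eq0 // => /allP /(_ j); apply.
exact: mem_index_enum.
Qed.

Definition resolvent : 'M[R]_n := invmx (1%:M - a *: P).

Lemma resolventE (h : 'cV[R]_n) :
  resolvent *m h = h + a *: (P *m (resolvent *m h)).
Proof.
apply/eqP; rewrite -subr_eq -[X in X - _]mul1mx scalemxAl -mulmxBl mulmxA.
by rewrite mulmxV ?resolvent_unitmx // mul1mx.
Qed.

(** Maximum principle: at an index where |u| is largest, the equation reads |u| <= H + a |u|. *)
Lemma resolvent_bound (u h : 'cV[R]_n) H s :
  u = h + a *: (P *m u) -> (forall i, `|h i ord0| <= H) ->
  `|u s ord0| <= H / (1 - a).
Proof.
move=> uE hH; case/andP: a_itv => a0 a1.
have [i _ imax] := @arg_maxP _ R _ s predT (fun i => `|u i ord0|) isT.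
apply: le_trans (imax s isT) _; rewrite /= ler_pdivlMr ?subr_gt0 // mulrBr mulr1.
rewrite lerBlDr {1}uE mxE (le_trans (ler_normD _ _)) // lerD // mxE normrM.
rewrite (ger0_norm a0) mulrC ler_wpM2r // stochastic_mul_bound // => j.
exact: imax.
Qed.

(** The Neumann series with its exact remainder: inserting h = u - a P u makes the sum telescope. *)
Lemma resolvent_partial_sum (u h : 'cV[R]_n) N : u = h + a *: (P *m u) ->
  \sum_(j < N) a ^+ j *: (P ^+ j *m h) = u - a ^+ N *: (P ^+ N *m u).
Proof.
move=> uE; elim: N => [|N IH].
  by rewrite big_ord0 !expr0 mul1mx scale1r subrr.
rewrite big_ord_recr IH /=.
have -> : h = u - a *: (P *m u) by rewrite {1}uE addrK.
rewrite mulmxBr scalerBr addrA subrK -scalemxAr scalerA -exprSr.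
by rewrite mulmxA (exprSr P).
Qed.

End Stochastic.

(** * The Bellman operator *)

Section Bellman.
Variables (R : realType) (n : nat) (P : 'M[R]_n).
Hypothesis P_stoch : stochastic P.
Variables (rew : 'I_n -> 'I_n -> R) (gamma : R).
Hypothesis gamma_itv : 0 < gamma < 1.

Definition reward_vec : 'cV[R]_n := \col_s mean_reward P rew s.

Definition td (V : 'cV[R]_n) : 'cV[R]_n := reward_vec + gamma *: (P *m V) - V.

(** An (m+1)-step return exceeds V by the discounted sum of the expected temporal differences met on
    the way. *)
Lemma path_expectation_td m s (V : 'cV[R]_n) :
  path_expectation P m.+1 s (fun x =>
    \sum_(t < m.+1) gamma ^+ t * mean_reward P rew (x t)
    + gamma ^+ m.+1 * V (x m.+1) ord0) =
  V s ord0 + \sum_(t < m.+1) gamma ^+ t * (P ^+ t *m td V) s ord0.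
Proof.
pose f t y := gamma ^+ t * if t == m.+1 then V y ord0 else mean_reward P rew y.
transitivity (path_expectation P m.+1 s (fun x => \sum_(t < m.+2) f t (x t))).
  congr path_expectation; apply/funext => x; rewrite [RHS]big_ord_recr /= /f eqxx.
  by congr (_ + _); apply: eq_bigr => t _; rewrite ltn_eqF.
rewrite path_expectation_coord; last by case: P_stoch.
have g0 : 0 <= gamma < 1 by case/andP: gamma_itv => /ltW -> ->.
(* The vector -V solves the resolvent equation with source gamma P V - V, so the telescoping of
   values is an instance of [resolvent_partial_sum]. *)
have VE : - V = (gamma *: (P *m V) - V) + gamma *: (P *m - V).
  by rewrite mulmxN scalerN addrAC subrr add0r.
have := resolvent_partial_sum m.+1 VE.
rewrite mulmxN scalerN opprK => /matrixP /(_ s ord0).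
rewrite summxE [RHS]mxE [(- V) _ _]mxE [X in _ = _ + X]mxE => H.
have pE t (y : 'cV[R]_n) : \sum_z (P ^+ t) s z * (gamma ^+ t * y z ord0) =
    gamma ^+ t * (P ^+ t *m y) s ord0 :> R.
  by rewrite mxE mulr_sumr; apply: eq_bigr => z _; ring.
rewrite big_ord_recr /= /f eqxx pE.
have -> : gamma ^+ m.+1 * (P ^+ m.+1 *m V) s ord0 = V s ord0 +
   \sum_(t < m.+1) (gamma ^+ t *: (P ^+ t *m (gamma *: (P *m V) - V))) s ord0.
  by rewrite H; ring.
rewrite addrCA -big_split /=; congr (_ + _); apply: eq_bigr => t _.
rewrite ltn_eqF //.
have -> : td V = reward_vec + (gamma *: (P *m V) - V) by rewrite /td addrA.
set W := _ - V; rewrite [X in _ + X = _]mxE -!pE -big_split /=.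
by apply: eq_bigr => z _; rewrite [(reward_vec + W) _ _]mxE [reward_vec _ _]mxE; ring.
Qed.

Section LambdaReturn.
Variable lambda : R.
Hypothesis lambda_itv : 0 <= lambda <= 1.

Lemma gamma_lambda_itv : 0 <= gamma * lambda < 1.
Proof.
case/andP: gamma_itv lambda_itv => g0 g1 /andP[l0 l1].
by rewrite mulr_ge0 ?(ltW g0) //=; nra.
Qed.

(* The solution u of u = td V + gamma lambda P u, that is the expected sum of
   the temporal differences of V discounted by gamma lambda. *)
Definition lambda_td (V : 'cV[R]_n) : 'cV[R]_n :=
  resolvent P (gamma * lambda) *m td V.

Lemma lambda_tdE V : lambda_td V = td V + (gamma * lambda) *: (P *m lambda_td V).
Proof. by rewrite {1}/lambda_td resolventE // gamma_lambda_itv. Qed.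

End LambdaReturn.

(** Summation by parts for a geometric average of partial sums. *)
Lemma partial_lambda_average (l v : R) (c : nat -> R) N :
  (1 - l) * \sum_(m < N) l ^+ m * (v + \sum_(t < m.+1) c t) =
  (1 - l ^+ N) * v + \sum_(t < N) l ^+ t * c t - l ^+ N * \sum_(t < N) c t.
Proof.
elim: N => [|N IH]; first by rewrite !big_ord0 expr0; ring.
rewrite big_ord_recr mulrDr IH /= ![in RHS]big_ord_recr /= exprS big_ord_recr /=; ring.
Qed.

Lemma cvg_expr_bounded (l M : R) (b : nat -> R) : 0 <= l < 1 ->
  (forall N, `|b N| <= M) -> l ^+ N * b N @[N --> \oo] --> 0.
Proof.
move=> /andP[l0 l1] bM; apply/norm_cvg0P.
apply: (@squeeze_cvgr _ _ _ _ (cst 0) (fun N => l ^+ N * M)).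
- near=> N => /=; rewrite normr_ge0 normrM ger0_norm ?exprn_ge0 //=.
  by rewrite ler_wpM2l ?exprn_ge0.
- exact: cvg_cst.
- rewrite -[X in _ --> X](mul0r M); apply: cvgM; last exact: cvg_cst.
  by apply: cvg_expr; rewrite ger0_norm.
Unshelve. all: by end_near. Qed.

Lemma abs_entry_bound (u : 'cV[R]_n) : exists M, forall i, `|u i ord0| <= M.
Proof.
exists (\sum_i `|u i ord0|) => i.
by rewrite (bigD1 i) //= lerDl sumr_ge0.
Qed.

(** After summation by parts the truncated average contains the sum of (gamma l)^t P^t td V, a
    Neumann series for [lambda_td]. All that remains carries the factor l^N with the coefficient
    [b N], which is bounded because both Neumann remainders are. *)
Lemma bellman_lt1E l V s : 0 <= l < 1 ->
  bellman_lt1 P rew gamma l V s = V s ord0 + lambda_td l V s ord0.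
Proof.
move=> l_itv; have /andP[l0 l1] := l_itv.
have gl_itv := @gamma_lambda_itv l _; have {}gl_itv := gl_itv (introT andP (conj l0 (ltW l1))).
have g_itv : 0 <= gamma < 1 by case/andP: gamma_itv => /ltW -> ->.
have /andP[g0 g1] := g_itv.
pose c t := gamma ^+ t * (P ^+ t *m td V) s ord0.
pose u := lambda_td l V; pose u1 := resolvent P gamma *m td V.
have uE : u = td V + (gamma * l) *: (P *m u) by rewrite /u -lambda_tdE // l0 ltW.
have u1E : u1 = td V + gamma *: (P *m u1) by rewrite /u1 -resolventE.
have [M uM] := abs_entry_bound u; have [M1 u1M] := abs_entry_bound u1.
have PtM t i : `|(P ^+ t *m u) i ord0| <= M.
  exact: (stochastic_mul_bound (stochastic_exp P_stoch t)).
have PtM1 t i : `|(P ^+ t *m u1) i ord0| <= M1.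
  exact: (stochastic_mul_bound (stochastic_exp P_stoch t)).
have sumc N : \sum_(t < N) c t = u1 s ord0 - gamma ^+ N * (P ^+ N *m u1) s ord0.
  have /matrixP /(_ s ord0) := resolvent_partial_sum N u1E.
  rewrite summxE !mxE => <-; apply: eq_bigr => t _.
  by rewrite [RHS]mxE.
have suml N : \sum_(t < N) l ^+ t * c t =
    u s ord0 - l ^+ N * (gamma ^+ N * (P ^+ N *m u) s ord0).
  have /matrixP /(_ s ord0) := resolvent_partial_sum N uE.
  rewrite summxE !mxE mulrA -exprMn (mulrC l) => <-; apply: eq_bigr => t _.
  by rewrite [RHS]mxE exprMn /c; ring.
pose b N := - V s ord0 - gamma ^+ N * (P ^+ N *m u) s ord0 - \sum_(t < N) c t.
have gN N x K : `|x| <= K -> `|gamma ^+ N * x| <= K.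
  move=> xK; rewrite normrM ger0_norm ?exprn_ge0 // (le_trans _ xK) //.
  by rewrite ler_piMl // exprn_ile1 // ltW.
have bM N : `|b N| <= `|V s ord0| + M + (M1 + M1).
  rewrite /b sumc (le_trans (ler_normB _ _)) // lerD //.
    by rewrite (le_trans (ler_normB _ _)) // normrN lerD // gN.
  by rewrite (le_trans (ler_normB _ _)) // lerD // gN.
have l1' : 1 - l != 0 by rewrite subr_eq0 eq_sym lt_eqF.
have seriesE N : series (fun m : nat => l ^+ m *
    path_expectation P m.+1 s (fun x =>
      \sum_(t < m.+1) gamma ^+ t * mean_reward P rew (x t)
      + gamma ^+ m.+1 * V (x m.+1) ord0)) N
   = (V s ord0 + u s ord0) / (1 - l) + (l ^+ N * b N) / (1 - l).
  rewrite seriesEnat /= big_mkord -mulrDl; apply: (mulfI l1').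
  rewrite [RHS]mulrC divfK //.
  under eq_bigr do rewrite path_expectation_td.
  by rewrite (partial_lambda_average l (V s ord0) c N) suml /b; ring.
rewrite /bellman_lt1.
have := cvg_expr_bounded l_itv bM => b0.
rewrite (_ : limn _ = (V s ord0 + u s ord0) / (1 - l)); first by rewrite mulrC divfK.
apply/cvg_lim => //.
rewrite (_ : series _ = fun N => (V s ord0 + u s ord0) / (1 - l) + (l ^+ N * b N) / (1 - l)); last first.
  by apply/funext => N; rewrite seriesE.
rewrite -[X in _ --> X]addr0 -[X in _ --> _ + X](mul0r (1 - l)^-1).
apply: cvgD; first exact: cvg_cst.
by apply: cvgM => //; exact: cvg_cst.
Qed.

(** The difference solves the resolvent equation for gamma l with source gamma (l - 1) P u1, of size
    O(1 - l). This yields the limit that defines the operator at lambda = 1. *)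
Lemma lambda_td_lip V : exists C, forall l s, 0 <= l < 1 ->
  `|lambda_td l V s ord0 - lambda_td 1 V s ord0| <= C * (1 - l).
Proof.
have /andP[g0 g1] := gamma_itv.
pose u1 := lambda_td 1 V; have [M uM] := abs_entry_bound u1.
have u1E : u1 = td V + gamma *: (P *m u1).
  by rewrite /u1 {1}lambda_tdE ?ler01 ?lexx // mulr1.
exists (M / (1 - gamma)) => l s /andP[l0 l1].
have gl := gamma_lambda_itv (introT andP (conj l0 (ltW l1))).
have gl0 := andP gl.
have uE := lambda_tdE (introT andP (conj l0 (ltW l1))) V.
have dE : lambda_td l V - u1 = (gamma * (l - 1)) *: (P *m u1)
    + (gamma * l) *: (P *m (lambda_td l V - u1)).
  rewrite {1}uE {1}u1E mulmxBr !scalerBr mulrBr mulr1 scalerBl.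
  by apply/matrixP => i j; rewrite !mxE; ring.
have := @resolvent_bound _ _ _ P_stoch _ gl _ _ (M * (1 - l)) s dE.
have -> : lambda_td l V s ord0 - lambda_td 1 V s ord0 = (lambda_td l V - u1) s ord0.
  by rewrite [RHS]mxE; congr (_ + _); rewrite [RHS]mxE.
move=> H.
have M0 : 0 <= M by rewrite (le_trans _ (uM s)).
apply: (le_trans (H _)) => [i|].
  rewrite mxE normrM mulrC ler_pM ?stochastic_mul_bound //.
  rewrite normrM distrC !ger0_norm ?subr_ge0 ?(ltW l1) ?(ltW g0) //.
  by rewrite ler_piMl ?subr_ge0 ?(ltW l1) ?(ltW g1).
rewrite mulrAC ler_wpM2r ?subr_ge0 ?(ltW l1) // ler_wpM2l // lef_pV2 ?posrE; nra.
Qed.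

Lemma bellmanE lambda V : 0 <= lambda <= 1 ->
  bellman P rew gamma lambda V = V + lambda_td lambda V.
Proof.
move=> /andP[l0 l1]; apply/matrixP => s j; rewrite ord1 [LHS]mxE [RHS]mxE.
case: eqVneq => [->|l_neq1]; last by rewrite bellman_lt1E // l0 lt_neqAle l_neq1.
have [C HC] := lambda_td_lip V.
have e0 : forall e : R, e * (1 - l) @[l --> (1 : R)^'-] --> (0 : R).
  move=> e; apply: cvg_at_left_filter.
  have -> : 0 = e * (1 - 1) :> R by rewrite subrr mulr0.
  by apply: cvgM; [exact: cvg_cst|apply: cvgB; [exact: cvg_cst|exact: cvg_id]].
apply/cvg_lim => //.
apply: (@squeeze_cvgr _ _ _ _
  (fun l => V s ord0 + lambda_td 1 V s ord0 + (- C) * (1 - l))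
  (fun l => V s ord0 + lambda_td 1 V s ord0 + C * (1 - l))).
- near=> l.
  have l01 : 0 <= l < 1.
    by apply/andP; split; near: l; [exact: nbhs_left_ge|exact: nbhs_left_lt].
  by rewrite bellman_lt1E //; have := HC l s l01; rewrite ler_norml; lra.
- by rewrite -[X in _ --> X]addr0; apply: cvgD => //; exact: cvg_cst.
- by rewrite -[X in _ --> X]addr0; apply: cvgD => //; exact: cvg_cst.
Unshelve. all: by end_near. Qed.

End Bellman.

(** * Contraction in the stationary norm *)

Section Stationary.
Variables (R : realType) (n : nat) (P : 'M[R]_n) (pi_ : 'rV[R]_n).
Hypothesis P_stoch : stochastic P.
Hypothesis pi_limit : forall x y, (P ^+ t) x y @[t --> \oo] --> pi_ ord0 y.

Lemma cvg_seq_sum (I : finType) (f : I -> nat -> R) (l : I -> R) :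
  (forall i, f i t @[t --> \oo] --> l i) ->
  \sum_i f i t @[t --> \oo] --> \sum_i l i.
Proof. by move=> fl; apply: cvg_big => //; exact: add_continuous. Qed.

Lemma stationary_sum1 (x : 'I_n) : \sum_y pi_ ord0 y = 1.
Proof.
have h : \sum_y (P ^+ t) x y @[t --> \oo] --> \sum_y pi_ ord0 y.
  exact: cvg_seq_sum.
apply: (cvg_unique _ h) => //.
have -> : (fun t => \sum_y (P ^+ t) x y) = cst 1.
  by apply/funext => t; case: (stochastic_exp P_stoch t).
exact: cvg_cst.
Qed.

Lemma stationaryE : pi_ *m P = pi_.
Proof.
apply/matrixP => x y; rewrite ord1 mxE; case: n P pi_ P_stoch pi_limit y => [|m] Q p _ Ql y.
  by case: y.
have h1 : (Q ^+ t.+1) ord0 y @[t --> \oo] --> p ord0 y.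
  by have := Ql ord0 y; rewrite -(cvg_shiftS (fun t => (Q ^+ t) ord0 y)).
apply: (cvg_unique _ _ h1) => //.
have -> : (fun t => (Q ^+ t.+1) ord0 y) = (fun t => \sum_z (Q ^+ t) ord0 z * Q z y).
  by apply/funext => t; rewrite exprSr mxE.
by apply: cvg_seq_sum => z; apply: cvgM; [exact: Ql|exact: cvg_cst].
Qed.

End Stationary.

Section PiNorm.
Variables (R : realType) (n : nat) (P : 'M[R]_n) (pi_ : 'rV[R]_n).
Hypothesis P_stoch : stochastic P.
Hypothesis pi_ge0 : forall y, 0 <= pi_ ord0 y.
Hypothesis pi_stat : pi_ *m P = pi_.
Hypothesis pi_sum1 : \sum_y pi_ ord0 y = 1.

Definition pdot (x y : 'cV[R]_n) : R := \sum_i pi_ ord0 i * (x i ord0 * y i ord0).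
Definition pnorm (x : 'cV[R]_n) : R := wnorm (pi_ ord0) (x ^~ ord0).

Lemma pnorm_ge0 x : 0 <= pnorm x. Proof. exact: wnorm_ge0. Qed.

Lemma sqr_pnorm x : pnorm x ^+ 2 = pdot x x.
Proof. exact: sqr_wnorm. Qed.

Lemma ler_pdot x y : pdot x y <= pnorm x * pnorm y.
Proof. by rewrite (le_trans (ler_norm _)) // ler_norm_wdot. Qed.

Lemma pnormD x y : pnorm (x + y) <= pnorm x + pnorm y.
Proof.
rewrite (le_trans _ (wnormD _ _ _)) // le_eqVlt; apply/orP; left; apply/eqP.
by congr wnorm; apply/funext => i; rewrite mxE.
Qed.

Lemma pnormZ a x : pnorm (a *: x) = `|a| * pnorm x.
Proof. by rewrite -wnormZ; congr wnorm; apply/funext => i; rewrite mxE. Qed.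

Lemma pdotN x y : pdot x (- y) = - pdot x y.
Proof. by rewrite -sumrN; apply: eq_bigr => i _; rewrite mxE; ring. Qed.

Lemma pdotB x y z : pdot x (y - z) = pdot x y - pdot x z.
Proof. by rewrite -sumrB; apply: eq_bigr => i _; rewrite !mxE; ring. Qed.

Lemma pnorm_bound (x : 'cV[R]_n) (M : R) : (forall i, `|x i ord0| <= M) -> 0 <= M -> pnorm x <= M.
Proof.
move=> xM M0; rewrite -(@ler_pXn2r _ 2) ?nnegrE ?pnorm_ge0 // sqr_pnorm.
rewrite -[leRHS]mul1r -pi_sum1 mulr_suml ler_sum // => i _.
by rewrite ler_wpM2l // -expr2 -(real_normK (num_real (x i ord0))) ler_pXn2r ?nnegrE.
Qed.

(* Jensen's inequality and the stationarity of pi. *)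
Lemma pnorm_mul x : pnorm (P *m x) <= pnorm x.
Proof.
have [P0 P1] := P_stoch.
rewrite -(@ler_pXn2r _ 2) ?nnegrE ?pnorm_ge0 // !sqr_pnorm.
apply: (@le_trans _ _ (\sum_i pi_ ord0 i * \sum_j P i j * x j ord0 ^+ 2)).
  apply: ler_sum => i _; rewrite ler_wpM2l // -expr2 mxE.
  have := wdot_sqr_le (P0 i) (x ^~ ord0) (fun=> 1); rewrite /wdot.
  under eq_bigr do rewrite mulr1.
  under [X in _ <= _ * X -> _]eq_bigr do rewrite !mulr1.
  by rewrite P1 mulr1; under [X in _ <= X -> _]eq_bigr do rewrite -expr2.
rewrite /pdot -[in leRHS]pi_stat.
under eq_bigr do rewrite mulr_sumr; rewrite exchange_big /= ler_sum // => j _.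
rewrite mxE mulr_suml ler_sum // => i _.
by rewrite expr2 mulrA.
Qed.

(** Here w is the image of v under the averaged operator with reward r, described by its implicit
    equation. It is applied with r = 0 to differences and with the mean reward to the fixed
    point. *)
Lemma lambda_contraction (gamma lambda : R) (v w r : 'cV[R]_n) :
  0 <= gamma -> 0 <= lambda <= 1 ->
  w = r + (gamma * (1 - lambda)) *: (P *m v) + (gamma * lambda) *: (P *m w) ->
  (1 - gamma * lambda) * pnorm w <= pnorm r + gamma * (1 - lambda) * pnorm v.
Proof.
move=> g0 /andP[l0 l1] wE.
have h a x : 0 <= a -> pnorm (a *: (P *m x)) <= a * pnorm x.
  by move=> a0; rewrite pnormZ ger0_norm // ler_wpM2l // pnorm_mul.
have := pnormD (r + (gamma * (1 - lambda)) *: (P *m v)) ((gamma * lambda) *: (P *m w)).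
have := pnormD r ((gamma * (1 - lambda)) *: (P *m v)).
rewrite -wE.
have := h (gamma * (1 - lambda)) v; have := h (gamma * lambda) w.
rewrite !mulr_ge0 ?subr_ge0 // => /(_ isT) h1 /(_ isT) h2.
lra.
Qed.

End PiNorm.

(** * Monotonicity, Lipschitz bound and zero of the mean update *)

Section MeanUpdate.
Variables (R : realType) (n d : nat) (P : 'M[R]_n) (rew : 'I_n -> 'I_n -> R).
Variables (gamma B : R) (pi_ : 'rV[R]_n) (Phi : 'M[R]_(n, d)) (lambda : R).
Hypothesis P_stoch : stochastic P.
Hypothesis gamma_itv : 0 < gamma < 1.
Hypothesis rew_bounded : forall x y, `|rew x y| <= B.
Hypothesis pi_gt0 : forall y, 0 < pi_ ord0 y.
Hypothesis pi_stat : pi_ *m P = pi_.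
Hypothesis pi_sum1 : \sum_y pi_ ord0 y = 1.
Hypothesis feature_le1 : forall x, norm2 (feature Phi x) <= 1.
Hypothesis Phi_rank : \rank Phi = d.
Hypothesis lambda_itv : 0 <= lambda <= 1.
Hypothesis B_ge0 : 0 <= B.

Let pi_ge0 y : 0 <= pi_ ord0 y. Proof. exact: ltW. Qed.

Local Notation tdv := (td P rew gamma).
Local Notation ltd := (lambda_td P rew gamma lambda).
Local Notation gbar := (mean_update P rew gamma Phi pi_ lambda).

Lemma dot_feature s (x : 'cV[R]_d) : dot (feature Phi s) x = (Phi *m x) s ord0.
Proof. by rewrite mxE; apply: eq_bigr => j _; rewrite !mxE. Qed.

Lemma feature_mul_bound s (x : 'cV[R]_d) : `|(Phi *m x) s ord0| <= norm2 x.
Proof.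
rewrite -dot_feature (le_trans (ler_norm_dot _ _)) //.
by rewrite ler_piMl ?norm2_ge0.
Qed.

Lemma mean_updateE theta :
  gbar theta = Phi^T *m (diag_mx pi_ *m ltd (Phi *m theta)).
Proof. by rewrite /mean_update bellmanE // addrAC subrr add0r mulmxA. Qed.

Lemma dot_mean_update (x theta : 'cV[R]_d) :
  dot x (gbar theta) = pdot pi_ (Phi *m x) (ltd (Phi *m theta)).
Proof.
rewrite mean_updateE dot_mulmxr trmxK; apply: eq_bigr => i _.
by rewrite mul_diag_mx [(\matrix_(_, _) _) _ _]mxE mulrCA.
Qed.

Lemma feature_gramE (x : 'cV[R]_d) : dot x (feature_gram Phi pi_ *m x) = pnorm pi_ (Phi *m x) ^+ 2.
Proof.
rewrite sqr_pnorm // /feature_gram -!mulmxA dot_mulmxr trmxK; apply: eq_bigr => i _.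
by rewrite mul_diag_mx [(\matrix_(_, _) _) _ _]mxE mulrCA.
Qed.

Lemma feature_gram_sym : (feature_gram Phi pi_)^T = feature_gram Phi pi_.
Proof. by rewrite /feature_gram !trmx_mul trmxK tr_diag_mx mulmxA. Qed.

Lemma Phi_inj (x : 'cV[R]_d) : Phi *m x = 0 -> x = 0.
Proof.
move=> Px; apply: trmx_inj; rewrite trmx0.
have /row_free_injr : row_free Phi^T by rewrite /row_free mxrank_tr Phi_rank.
by apply; rewrite /= mul0mx -trmx_mul Px trmx0.
Qed.

(** The quadratic form of the Gram matrix is the squared L^2(pi) norm of Phi x. It is positive at
    the unit minimizer since pi is positive and Phi injective. *)
Lemma lambda_min_feature_gram : (0 < d)%N -> 0 < lambda_min (feature_gram Phi pi_) /\
  forall x, lambda_min (feature_gram Phi pi_) * norm2 x ^+ 2 <= pnorm pi_ (Phi *m x) ^+ 2.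
Proof.
move=> /(lambda_min_rayleigh feature_gram_sym) [v v1 [-> vmin]].
split=> [|x]; last by rewrite -!feature_gramE.
rewrite feature_gramE exprn_gt0 // lt_neqAle pnorm_ge0 andbT eq_sym.
apply/eqP => Pv; have : pdot pi_ (Phi *m v) (Phi *m v) = 0.
  by rewrite -sqr_pnorm // Pv expr0n.
move=> /eqP; rewrite psumr_eq0 => [/allP H|i _]; last first.
  by rewrite mulr_ge0 // -expr2 sqr_ge0.
have /Phi_inj v0 : Phi *m v = 0.
  apply/matrixP => i j; rewrite ord1 [RHS]mxE.
  have := H i (mem_index_enum _); rewrite mulf_eq0 gt_eqF //= mulf_eq0 orbb.
  by move/eqP.
by move: v1; rewrite v0 norm20 => /esym/eqP; rewrite oner_eq0.
Qed.

Lemma td_sub V V' : tdv V - tdv V' = gamma *: (P *m (V - V')) - (V - V').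
Proof. by rewrite /td mulmxBr scalerBr; apply/matrixP => i j; rewrite !mxE; ring. Qed.

Lemma lambda_td_sub V V' :
  ltd V - ltd V' = (tdv V - tdv V') + (gamma * lambda) *: (P *m (ltd V - ltd V')).
Proof.
have gl := lambda_tdE P_stoch rew gamma_itv lambda_itv.
rewrite {1}(gl V) {1}(gl V') mulmxBr scalerBr.
by apply/matrixP => i j; rewrite !mxE; ring.
Qed.

(** Let v be the difference of the two value functions and w that of their images under the
    operator. The right side equals |v|^2 - <v, w> in L^2(pi), and |w| <= gamma |v|. *)
Lemma mean_update_monotone theta theta' :
  gbar theta' = 0 ->
  (1 - gamma) * pnorm pi_ (Phi *m (theta' - theta)) ^+ 2
    <= dot (theta' - theta) (gbar theta).
Proof.
move=> z; have /andP[g0 g1] := gamma_itv; have /andP[l0 l1] := lambda_itv.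
pose v := Phi *m (theta' - theta).
pose w := v + (ltd (Phi *m theta') - ltd (Phi *m theta)).
have vE : v = Phi *m theta' - Phi *m theta by rewrite /v mulmxBr.
have wE : w = 0 + (gamma * (1 - lambda)) *: (P *m v) + (gamma * lambda) *: (P *m w).
  rewrite {1}/w lambda_td_sub td_sub -vE /w mulmxDr scalerDr.
  by apply/matrixP => i j; rewrite !mxE; ring.
have := lambda_contraction P_stoch pi_ge0 pi_stat (ltW g0) lambda_itv wE.
have -> : pnorm pi_ 0 = 0.
  by rewrite -(scale0r (0 : 'cV[R]_n)) pnormZ // normr0 mul0r.
rewrite add0r => H.
have v0 := @pnorm_ge0 _ _ pi_ v; have w0 := @pnorm_ge0 _ _ pi_ w.
have glt1 : 0 < 1 - gamma * lambda by nra.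
have wv : pnorm pi_ w <= gamma * pnorm pi_ v.
  have e : gamma * (1 - lambda) <= (1 - gamma * lambda) * gamma.
    have : 0 <= gamma * lambda * (1 - gamma) by rewrite !mulr_ge0 ?subr_ge0 ?(ltW g0) ?(ltW g1).
    lra.
  by rewrite -(ler_pM2l glt1) (le_trans H) // [leRHS]mulrA ler_wpM2r.
have -> : dot (theta' - theta) (gbar theta) = pnorm pi_ v ^+ 2 - pdot pi_ v w.
  have -> : gbar theta = - (gbar theta' - gbar theta) by rewrite z sub0r opprK.
  rewrite dotNr dotDr dotNr !dot_mean_update -pdotB sqr_pnorm // -pdotB -/v /w.
  rewrite opprD addNKr.
  by rewrite pdotN.
have := ler_pdot pi_ge0 v w; rewrite -/v; nra.
Qed.

Lemma td_sub_bound theta theta' s :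
  `|(tdv (Phi *m theta) - tdv (Phi *m theta')) s ord0| <= 2 * norm2 (theta - theta').
Proof.
have /andP[g0 g1] := gamma_itv.
rewrite td_sub -mulmxBr [X in `|X|]mxE.
have -> : 2 * norm2 (theta - theta') = norm2 (theta - theta') + norm2 (theta - theta').
  by rewrite mulr_natl.
rewrite (le_trans (ler_normD _ _)) // lerD //; last first.
  by rewrite mxE normrN feature_mul_bound.
rewrite mxE normrM gtr0_norm // (@le_trans _ _ `|(P *m (Phi *m (theta - theta'))) s ord0|) //.
  by rewrite ler_piMl // ltW.
by apply: stochastic_mul_bound => // i; exact: feature_mul_bound.
Qed.

(** By duality: for y the difference on the left, |y|^2 is the product in L^2(pi) of Phi y, of norm
    at most |y|, with a difference of [lambda_td], which [resolvent_bound] estimates. *)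
Lemma mean_update_lip theta theta' :
  norm2 (gbar theta - gbar theta') <= 2 / (1 - gamma) * norm2 (theta - theta').
Proof.
have /andP[g0 g1] := gamma_itv; have /andP[l0 l1] := lambda_itv.
set y := gbar theta - _; have [->|y0] := eqVneq (norm2 y) 0.
  by rewrite mulr_ge0 ?norm2_ge0 // divr_ge0 // subr_ge0 ltW.
have y_gt0 : 0 < norm2 y by rewrite lt_neqAle eq_sym y0 norm2_ge0.
rewrite -(ler_pM2l y_gt0) -expr2 sqr_norm2 {2}/y dotDr dotNr !dot_mean_update -pdotB.
have glt1 : 0 < 1 - gamma * lambda by nra.
rewrite (le_trans (ler_pdot pi_ge0 _ _)) // ler_pM ?pnorm_ge0 //.
  by apply: pnorm_bound; rewrite ?norm2_ge0 // => i; exact: feature_mul_bound.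
apply: pnorm_bound => // [i|]; last by rewrite mulr_ge0 ?norm2_ge0 // divr_ge0 // subr_ge0 ltW.
have := resolvent_bound P_stoch (gamma_lambda_itv gamma_itv lambda_itv) i
  (lambda_td_sub (Phi *m theta) (Phi *m theta')) (td_sub_bound theta theta').
move=> /le_trans; apply; rewrite [leRHS]mulrAC ler_wpM2l ?mulr_ge0 ?norm2_ge0 //.
by rewrite lef_pV2 ?posrE ?subr_gt0 //; nra.
Qed.

Lemma reward_vec_bound s : `|reward_vec P rew s ord0| <= B.
Proof.
have [P0 P1] := P_stoch; rewrite mxE (le_trans (ler_norm_sum _ _ _)) //.
rewrite -[leRHS]mul1r -(P1 s) mulr_suml ler_sum // => j _.
by rewrite normrM ger0_norm // ler_wpM2l.
Qed.

(** At a zero, V is orthogonal in L^2(pi) to W - V, with W the image of V, whence |V| <= |W|. The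
    contraction estimate bounds (1 - gamma lambda) |W| by B + gamma (1 - lambda) |V|. *)
Lemma fixed_point_bound theta : gbar theta = 0 ->
  (1 - gamma) * pnorm pi_ (Phi *m theta) <= B.
Proof.
move=> z; have /andP[g0 g1] := gamma_itv; have /andP[l0 l1] := lambda_itv.
pose V := Phi *m theta; pose W := V + ltd V.
have WE : W = reward_vec P rew + (gamma * (1 - lambda)) *: (P *m V)
    + (gamma * lambda) *: (P *m W).
  rewrite {1}/W lambda_tdE // /td /W mulmxDr scalerDr.
  by apply/matrixP => i j; rewrite !mxE; ring.
have := lambda_contraction P_stoch pi_ge0 pi_stat (ltW g0) lambda_itv WE.
have := pnorm_bound pi_ge0 pi_sum1 reward_vec_bound B_ge0.
have : pnorm pi_ V ^+ 2 <= pnorm pi_ V * pnorm pi_ W.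
  rewrite (le_trans _ (ler_pdot pi_ge0 _ _)) // sqr_pnorm //.
  have : dot theta (gbar theta) = 0 by rewrite z dot0r.
  rewrite dot_mean_update -/V => h.
  have -> : pdot pi_ V W = pdot pi_ V V + pdot pi_ V (ltd V).
    by rewrite /pdot -big_split; apply: eq_bigr => i _; rewrite [W _ _]mxE /=; ring.
  by rewrite h addr0.
have := @pnorm_ge0 _ _ pi_ W; have := @pnorm_ge0 _ _ pi_ V; rewrite -/V.
rewrite le_eqVlt => /orP[/eqP <- _ _ _ _|V0 W0]; first by rewrite mulr0.
rewrite expr2 ler_pM2l // => VW rB H.
have glt1 : 0 < 1 - gamma * lambda by nra.
have : (1 - gamma * lambda) * pnorm pi_ V <= (1 - gamma * lambda) * pnorm pi_ W.
  by rewrite ler_pM2l.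
nra.
Qed.

Lemma fixed_point_in_ball theta Rhat : gbar theta = 0 -> 0 <= Rhat ->
  2 * B / (Num.sqrt (lambda_min (feature_gram Phi pi_)) * (1 - gamma)
     * Num.sqrt (1 - gamma * (1 - lambda) / (1 - gamma * lambda))) <= Rhat ->
  norm2 theta <= Rhat.
Proof.
move=> z R0; have /andP[g0 g1] := gamma_itv; have /andP[l0 l1] := lambda_itv.
(* In dimension 0 there is no eigenvalue, and the only vector is 0. *)
case: (posnP d) => [d0 _|d_gt0].
  have -> : theta = 0 by apply/matrixP => i j; have := ltn_ord i; rewrite {2}d0.
  by rewrite norm20.
have [w_gt0 /(_ theta)] := lambda_min_feature_gram d_gt0.
set om := lambda_min _ in w_gt0 *; move=> omle; apply: le_trans.
have glt1 : 0 < 1 - gamma * lambda by nra.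
(* This k lies in (0, 1], so the radius is at least B / (sqrt omega (1 - gamma)). *)
set k := 1 - _ / _; have kE : k = (1 - gamma) / (1 - gamma * lambda).
  by rewrite /k; field; rewrite gt_eqF.
have k0 : 0 < k by rewrite kE divr_gt0 // subr_gt0.
have k1 : k <= 1 by rewrite kE ler_pdivrMr // mul1r; nra.
have sk1 : Num.sqrt k <= 1 by rewrite -sqrtr1 ler_wsqrtr.
have sk0 : 0 < Num.sqrt k by rewrite sqrtr_gt0.
have so0 : 0 < Num.sqrt om by rewrite sqrtr_gt0.
have fb := fixed_point_bound z.
have so : Num.sqrt om * norm2 theta <= pnorm pi_ (Phi *m theta).
  rewrite -(@ler_pXn2r _ 2) ?nnegrE ?pnorm_ge0 ?mulr_ge0 ?norm2_ge0 ?sqrtr_ge0 //.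
  by rewrite exprMn sqr_sqrtr // ltW.
rewrite ler_pdivlMr; last by rewrite !mulr_gt0 // subr_gt0.
have g1' : 0 < 1 - gamma by rewrite subr_gt0.
have : (1 - gamma) * (Num.sqrt om * norm2 theta) <= B.
  by rewrite (le_trans _ fb) // ler_pM2l.
have : 0 <= (1 - gamma) * (Num.sqrt om * norm2 theta).
  by rewrite !mulr_ge0 ?norm2_ge0 ?(ltW g1') ?(ltW so0).
set X := (1 - gamma) * _; move=> X0 XB.
have -> : norm2 theta * (Num.sqrt om * (1 - gamma) * Num.sqrt k) = X * Num.sqrt k.
  by rewrite /X; ring.
nra.
Qed.

End MeanUpdate.

(** * Pathwise regret *)

Section ShiftedSums.
Variable R : realType.

(** Since 0.-1 = 0, the term f 0 is counted twice. *)
Lemma sum_predn (f : nat -> R) N :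
  \sum_(k < N) f k.-1 = \sum_(k < N) f k + (if N is N'.+1 then f 0 - f N' else 0).
Proof.
case: N => [|N]; first by rewrite !big_ord0 addr0.
by rewrite big_ord_recl [in RHS]big_ord_recr /=; ring.
Qed.

Lemma sum_succ0 (f : nat -> R) N : f 0 = 0 ->
  \sum_(k < N) f k.+1 = \sum_(k < N) f k + f N.
Proof.
move=> f0; elim: N => [|N IH]; first by rewrite !big_ord0 f0 addr0.
by rewrite !big_ord_recr /= IH.
Qed.

Lemma ler_sum_shift (f : nat -> R) tau N : f 0 = 0 -> (forall k, 0 <= f k) ->
  \sum_(k < N) f (k - tau)%N <= \sum_(k < N) f k.
Proof.
move=> f0 f_ge0; elim: tau => [|tau IH].
  by under eq_bigr do rewrite subn0.
apply: le_trans IH.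
have := sum_predn (fun k => f (k - tau)%N) N.
have -> : \sum_(k < N) f (k.-1 - tau)%N = \sum_(k < N) f (k - tau.+1)%N.
  by apply: eq_bigr => k _; congr f; lia.
case: N => [|N] ->; first by rewrite /= !big_ord0 addr0.
by rewrite sub0n f0 sub0r gerDl oppr_le0.
Qed.

(** Each further shift by truncated subtraction repeats f 0 once more, at the cost of one f 0. *)
Lemma ler_sum_shift_decr (f : nat -> R) tau N : (forall k, 0 <= f k) ->
  (forall k, f k <= f 0) ->
  \sum_(k < N) f (k - tau)%N <= \sum_(k < N) f k + tau%:R * f 0.
Proof.
move=> f_ge0 f_decr; elim: tau => [|tau IH].
  by under eq_bigr do rewrite subn0; rewrite mul0r addr0.
have := sum_predn (fun k => f (k - tau)%N) N.
have -> : \sum_(k < N) f (k.-1 - tau)%N = \sum_(k < N) f (k - tau.+1)%N.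
  by apply: eq_bigr => k _; congr f; lia.
case: N IH => [|N] IH ->; first by rewrite /= !big_ord0 !add0r mulr_ge0.
by have := f_ge0 (N - tau)%N; rewrite sub0n -natr1; lra.
Qed.

Lemma sqr_sum_le tau (f : nat -> R) :
  (\sum_(i < tau) f i) ^+ 2 <= tau%:R * \sum_(i < tau) f i ^+ 2.
Proof.
have := @wdot_sqr_le R 'I_tau (fun=> 1) (fun=> ler01) (fun i => f i) (fun=> 1).
rewrite /wdot; under eq_bigr do rewrite mulr1 mul1r.
under [X in _ <= X * _ -> _]eq_bigr do rewrite mul1r -expr2.
by rewrite sumr_const card_ord !mul1r mulrC.
Qed.

End ShiftedSums.

Section AdaptiveStep.
Variables (R : realType) (d : nat) (th G m : nat -> 'cV[R]_d) (V : nat -> R).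
Variables (ts : 'cV[R]_d) (eta beta delta Rhat Gm : R).
Hypothesis eta_gt0 : 0 < eta.
Hypothesis delta_gt0 : 0 < delta.
Hypothesis beta_itv : 0 <= beta < 1.
Hypothesis m0 : m 0 = 0.
Hypothesis mS : forall k, m k.+1 = beta *: m k + (1 - beta) *: G k.
Hypothesis V0 : V 0 = 0.
Hypothesis VS : forall k, V k.+1 = V k + norm2 (G k) ^+ 2.

(** Indices: [th k] is theta^(k+1) and [G k] is g^(k+1), while [V k] is v^k and [m k] is m^k. The
    step from [th k] uses [A k.+1]; [A k] involves only the gradients before [G k]. *)
Definition stepsize k : R := (Num.sqrt (V k + delta))^-1.
Local Notation A := stepsize.

(** The projected update is known only through the nonexpansiveness of the projection relative to
    points of the ball. *)
Hypothesis th_step : forall k u, norm2 u <= Rhat ->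
  norm2 (th k.+1 - u) <= norm2 (th k + (eta * A k.+1) *: m k.+1 - u).
Hypothesis th_ball : forall k, norm2 (th k) <= Rhat.
Hypothesis ts_ball : norm2 ts <= Rhat.
Hypothesis G_bound : forall k, norm2 (G k) <= Gm.

Local Notation D := (2 * Rhat).

Lemma V_ge0 k : 0 <= V k.
Proof. by elim: k => [|k IH]; rewrite ?V0 // VS addr_ge0 // sqr_ge0. Qed.

Lemma Vdelta_gt0 k : 0 < V k + delta.
Proof. by rewrite ltr_wpDl ?V_ge0. Qed.

Lemma stepsize_gt0 k : 0 < A k.
Proof. by rewrite invr_gt0 sqrtr_gt0 Vdelta_gt0. Qed.

Lemma stepsizeS k : A k.+1 <= A k.
Proof.
rewrite lef_pV2 ?posrE ?sqrtr_gt0 ?Vdelta_gt0 // ler_wsqrtr // VS.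
by rewrite lerD2r lerDl sqr_ge0.
Qed.

Lemma stepsize_decr j k : (j <= k)%N -> A k <= A j.
Proof.
move=> /subnK <-; elim: (k - j)%N => [|i IH]; first by rewrite add0n.
by rewrite addSn (le_trans (stepsizeS _)).
Qed.

Lemma sqr_stepsize k : A k ^+ 2 = (V k + delta)^-1.
Proof. by rewrite exprVn sqr_sqrtr // ltW // Vdelta_gt0. Qed.

(** Normalized energies of the gradient and of the momentum, the two quantities of order ln N once
    summed. *)
Let s k := A k.+1 ^+ 2 * norm2 (G k) ^+ 2.
Let q k := A k ^+ 2 * norm2 (m k) ^+ 2.

Let q_ge0 k : 0 <= q k. Proof. by rewrite mulr_ge0 ?sqr_ge0. Qed.
Let q0 : q 0 = 0. Proof. by rewrite /q m0 norm20 expr0n mulr0. Qed.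

(** Each term is 1 - a / b for consecutive values a <= b of V + delta, hence at most ln (b / a), and
    the logarithms telescope. *)
Lemma sum_adagrad_le N : \sum_(k < N) s k <= ln ((V N + delta) / delta).
Proof.
elim: N => [|N IH].
  by rewrite big_ord0 V0 add0r divff ?gt_eqF // ln1.
rewrite big_ord_recr /=.
have a := Vdelta_gt0 N; have b := Vdelta_gt0 N.+1.
have -> : (V N.+1 + delta) / delta =
    (V N + delta) / delta * ((V N.+1 + delta) / (V N + delta)).
  by field; rewrite !gt_eqF.
rewrite lnM ?posrE ?divr_gt0 // lerD // -[leRHS]opprK -lnV ?posrE ?divr_gt0 //.
rewrite invf_div lerNr.
have -> : (V N + delta) / (V N.+1 + delta) = 1 + - s N.
  by rewrite /s sqr_stepsize VS; field; rewrite -VS gt_eqF.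
apply: le_ln1Dx; rewrite ltrN2 /s sqr_stepsize mulrC ltr_pdivrMr // mul1r VS.
by have := V_ge0 N; lra.
Qed.

Lemma momentum_bound k : norm2 (m k) <= Gm.
Proof.
have /andP[b0 b1] := beta_itv.
elim: k => [|k IH]; first by rewrite m0 norm20 (le_trans _ (G_bound 0)) ?norm2_ge0.
rewrite mS (le_trans (norm2D _ _)) // !norm2Z !ger0_norm ?subr_ge0 ?(ltW b1) //.
have : (1 - beta) * norm2 (G k) <= (1 - beta) * Gm by rewrite ler_wpM2l // subr_ge0 ltW.
have : beta * norm2 (m k) <= beta * Gm by rewrite ler_wpM2l.
lra.
Qed.

Lemma momentum_energy_step k : q k.+1 <= beta * q k + (1 - beta) * s k.
Proof.
have /andP[b0 b1] := beta_itv.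
have h : norm2 (m k.+1) ^+ 2 <= beta * norm2 (m k) ^+ 2 + (1 - beta) * norm2 (G k) ^+ 2.
  have := norm2_ge0 (m k.+1); have := norm2_ge0 (m k); have := norm2_ge0 (G k).
  have : norm2 (m k.+1) <= beta * norm2 (m k) + (1 - beta) * norm2 (G k).
    by rewrite mS (le_trans (norm2D _ _)) // !norm2Z !ger0_norm ?subr_ge0 ?(ltW b1).
  set a := norm2 (m k.+1); set b := norm2 (m k); set c := norm2 (G k) => H c0 bb0 a0.
  have : a ^+ 2 <= (beta * b + (1 - beta) * c) ^+ 2.
    by rewrite ler_pXn2r ?nnegrE // addr_ge0 // mulr_ge0 // subr_ge0 ltW.
  have : 0 <= beta * (1 - beta) * (b - c) ^+ 2.
    by rewrite mulr_ge0 ?sqr_ge0 // mulr_ge0 // subr_ge0 ltW.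
  lra.
have hA : A k.+1 ^+ 2 <= A k ^+ 2.
  by rewrite ler_pXn2r ?nnegrE ?(ltW (stepsize_gt0 _)) // stepsizeS.
rewrite /q /s; have := sqr_ge0 (A k.+1).
have := sqr_ge0 (norm2 (m k)).
set a := A k.+1 ^+ 2 in hA *; set b := norm2 (m k) ^+ 2 in h *.
move=> b2 a2; have : a * norm2 (m k.+1) ^+ 2 <= a * (beta * b + (1 - beta) * norm2 (G k) ^+ 2).
  by rewrite ler_wpM2l.
have : beta * (a * b) <= beta * (A k ^+ 2 * b) by rewrite ler_wpM2l // ler_wpM2r.
lra.
Qed.

(** As q vanishes at 0, the unshifted sum of q is at most the shifted one; summing the one-step
    inequality leaves 1 - beta on both sides. *)
Lemma sum_momentum_le N : \sum_(k < N) q k.+1 <= \sum_(k < N) s k.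
Proof.
have /andP[b0 b1] := beta_itv.
have h : \sum_(k < N) q k <= \sum_(k < N) q k.+1.
  by rewrite sum_succ0 // lerDl.
have : \sum_(k < N) q k.+1 <= beta * \sum_(k < N) q k + (1 - beta) * \sum_(k < N) s k.
  rewrite !mulr_sumr -big_split ler_sum // => k _; exact: momentum_energy_step.
have : beta * \sum_(k < N) q k <= beta * \sum_(k < N) q k.+1 by rewrite ler_wpM2l.
move=> h1 h2; have : 0 < 1 - beta by rewrite subr_gt0.
nra.
Qed.

Lemma dist_bound (x y : 'cV[R]_d) : norm2 x <= Rhat -> norm2 y <= Rhat -> norm2 (x - y) <= D.
Proof. by move=> xR yR; rewrite (le_trans (norm2B _ _)) // mulr_natl mulr2n lerD. Qed.

Lemma th_move k : norm2 (th k.+1 - th k) <= eta * (A k.+1 * norm2 (m k.+1)).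
Proof.
rewrite (le_trans (th_step _ (th_ball k))) // addrAC subrr add0r norm2Z.
by rewrite ger0_norm ?mulrA // mulr_ge0 ?(ltW eta_gt0) ?(ltW (stepsize_gt0 _)).
Qed.

(** The iterate [th k.-1] is the one from which the step along [m k] is taken; at k = 0 the value is
    0, since [m 0 = 0]. *)
Let X k := A k * dot (th k.-1 - ts) (m k).

Let th_ts k : norm2 (th k - ts) <= D. Proof. exact: dist_bound. Qed.

Let D_ge0 : 0 <= D. Proof. by rewrite (le_trans _ (th_ts 0)) ?norm2_ge0. Qed.

Let Gm_ge0 : 0 <= Gm. Proof. by rewrite (le_trans _ (G_bound 0)) ?norm2_ge0. Qed.

Let dot_bound (x y : 'cV[R]_d) : norm2 x <= D -> norm2 y <= Gm -> `|dot x y| <= D * Gm.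
Proof. by move=> xD yG; rewrite (le_trans (ler_norm_dot _ _)) // ler_pM ?norm2_ge0. Qed.

(** After m^(k+1) is expanded, two exchanges are paid for: [A k.+1] for [A k], by the last term, and
    [th k] for [th k.-1] against [m k], by the length eta A |m| of one step, which gives eta q. *)
Lemma momentum_correlation_step k : X k.+1 <= beta * X k + beta * eta * q k
  + (1 - beta) * (A k * dot (th k - ts) (G k)) + (A k - A k.+1) * (D * Gm).
Proof.
have /andP[b0 b1] := beta_itv.
have hA := stepsizeS k.
have h1 : A k.+1 * dot (th k - ts) (m k) <= A k * dot (th k - ts) (m k)
    + (A k - A k.+1) * (D * Gm).
  have := dot_bound (th_ts k) (momentum_bound k); rewrite ler_norml => /andP[].
  nra.
have h2 : A k.+1 * dot (th k - ts) (G k) <= A k * dot (th k - ts) (G k)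
    + (A k - A k.+1) * (D * Gm).
  have := dot_bound (th_ts k) (G_bound k); rewrite ler_norml => /andP[].
  nra.
have h3 : A k * dot (th k - ts) (m k) <= X k + eta * q k.
  case: k {hA h1 h2} => [|k]; first by rewrite /X /q m0 norm20 !dot0r; lra.
  have -> : th k.+1 - ts = (th k - ts) + (th k.+1 - th k) by rewrite [RHS]addrC subrKA.
  rewrite /X /= dotDl mulrDr lerD2l.
  have := ler_dot (th k.+1 - th k) (m k.+1).
  have := th_move k; have := stepsize_gt0 k.+1; have := norm2_ge0 (m k.+1).
  rewrite /q; set a := A _; set b := norm2 (m _); set c := norm2 (_ - _) => b2 a2 cb xb.
  apply: (@le_trans _ _ (a * (c * b))); first by rewrite ler_wpM2l // ltW.
  apply: (@le_trans _ _ (a * (eta * (a * b) * b))); last by rewrite le_eqVlt; apply/orP; left; apply/eqP; ring.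
  by rewrite ler_wpM2l ?(ltW a2) // ler_wpM2r.
rewrite {1}/X /= mS dotDr !dotZr.
have : (1 - beta) * (A k.+1 * dot (th k - ts) (G k)) <=
   (1 - beta) * (A k * dot (th k - ts) (G k) + (A k - A k.+1) * (D * Gm)).
  by rewrite ler_wpM2l // subr_ge0 ltW.
have : beta * (A k.+1 * dot (th k - ts) (m k)) <=
   beta * (X k + eta * q k + (A k - A k.+1) * (D * Gm)).
  by rewrite ler_wpM2l //; lra.
lra.
Qed.

Lemma dist_step k : norm2 (th k.+1 - ts) ^+ 2 <=
  norm2 (th k - ts) ^+ 2 + 2 * eta * X k.+1 + eta ^+ 2 * q k.+1.
Proof.
apply: (@le_trans _ _ (norm2 (th k + (eta * A k.+1) *: m k.+1 - ts) ^+ 2)).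
  by rewrite -ler_norm2_sqr th_step.
rewrite addrAC (sqr_norm2D (th k - ts)) dotZr norm2Z exprMn real_normK ?num_real // /X /q /=.
by rewrite le_eqVlt; apply/orP; left; apply/eqP; ring.
Qed.

(** The summed recursion for X bounds the left side by -(1 - beta) sum X k.+1, a boundary term -
    beta X N, and energies. The recursion for |th k - ts|^2 bounds - sum X k.+1 by (D^2 + eta^2 sum
    q) / (2 eta). One A 0 (D Gm) is the telescoped change of step size, the other the boundary
    term. *)
Lemma adaptive_regret N :
  (1 - beta) * \sum_(k < N) A k * dot (ts - th k) (G k) <=
  (1 - beta) * D ^+ 2 / (2 * eta) + 2 * (A 0 * (D * Gm))
  + ((1 - beta) * eta / 2 + eta) * \sum_(k < N) s k.
Proof.
have /andP[b0 b1] := beta_itv; have b1' : 0 < 1 - beta by rewrite subr_gt0.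
have h1 : \sum_(k < N) X k.+1 <= beta * \sum_(k < N) X k + beta * eta * \sum_(k < N) q k
    - (1 - beta) * \sum_(k < N) A k * dot (ts - th k) (G k) + (A 0 - A N) * (D * Gm).
  elim: N => [|N IH]; first by rewrite !big_ord0 subrr; lra.
  rewrite !big_ord_recr /=; have := momentum_correlation_step N.
  by rewrite -[ts - th N]opprB dotNl; lra.
have h2 : \sum_(k < N) X k.+1 = \sum_(k < N) X k + X N.
  by rewrite sum_succ0 // /X m0 dot0r mulr0.
have h3 : norm2 (th N - ts) ^+ 2 <= norm2 (th 0 - ts) ^+ 2
    + 2 * eta * \sum_(k < N) X k.+1 + eta ^+ 2 * \sum_(k < N) q k.+1.
  elim: N {h1 h2} => [|N IH]; first by rewrite !big_ord0; lra.
  by rewrite !big_ord_recr /=; have := dist_step N; lra.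
have h4 : \sum_(k < N) q k <= \sum_(k < N) s k.
  apply: le_trans (sum_momentum_le N).
  by rewrite sum_succ0 // lerDl.
have h5 := sum_momentum_le N.
have h6 : norm2 (th 0 - ts) ^+ 2 <= D ^+ 2 by rewrite ler_pXn2r ?nnegrE ?norm2_ge0.
have h7 : `|X N| <= A 0 * (D * Gm).
  rewrite normrM gtr0_norm ?stepsize_gt0 // ler_pM ?(ltW (stepsize_gt0 _)) //.
    exact: stepsize_decr.
  exact: dot_bound (th_ts _) (momentum_bound N).
have DG : 0 <= D * Gm by rewrite mulr_ge0.
have h8 : 0 <= A N * (D * Gm) by rewrite mulr_ge0 // ltW // stepsize_gt0.
have h9 : - (2 * eta) * \sum_(k < N) X k.+1 <= D ^+ 2 + eta ^+ 2 * \sum_(k < N) s k.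
  have := sqr_ge0 (norm2 (th N - ts)).
  have : eta ^+ 2 * \sum_(k < N) q k.+1 <= eta ^+ 2 * \sum_(k < N) s k.
    by rewrite ler_wpM2l ?sqr_ge0.
  lra.
have h10 : - ((1 - beta) * \sum_(k < N) X k.+1) <=
   (1 - beta) * D ^+ 2 / (2 * eta) + (1 - beta) * eta / 2 * \sum_(k < N) s k.
  have := ler_wpM2l (ltW (divr_gt0 b1' (mulr_gt0 (ltr0Sn R 1) eta_gt0))) h9.
  have -> : (1 - beta) / (2 * eta) * (- (2 * eta) * \sum_(k < N) X k.+1) =
     - ((1 - beta) * \sum_(k < N) X k.+1) by field; rewrite gt_eqF.
  move=> /le_trans; apply; rewrite le_eqVlt; apply/orP; left; apply/eqP.
  by field; rewrite gt_eqF.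
have h11 : beta * eta * \sum_(k < N) q k <= eta * \sum_(k < N) s k.
  rewrite ler_pM ?mulr_ge0 ?sumr_ge0 ?(ltW eta_gt0) //.
  by rewrite ler_piMl ?(ltW b1) ?(ltW eta_gt0).
have h12 : - (beta * X N) <= A 0 * (D * Gm).
  have : beta * `|X N| <= 1 * (A 0 * (D * Gm)) by rewrite ler_pM // ltW.
  have : - (beta * X N) <= beta * `|X N|.
    by rewrite -mulrN ler_wpM2l // -normrN ler_norm.
  lra.
move: h1 h10; rewrite h2; lra.
Qed.

End AdaptiveStep.

(** * Freezing the iterate *)

Section Freezing.
Variables (R : realType) (d : nat) (th m : nat -> 'cV[R]_d) (V : nat -> R).
Variables (g : nat -> 'cV[R]_d -> 'cV[R]_d) (gbar : 'cV[R]_d -> 'cV[R]_d).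
Variables (ts : 'cV[R]_d) (eta beta delta Rhat Gm c L Lbar : R).
Local Notation G := (fun k => g k (th k)).
Local Notation A := (stepsize V delta).
Local Notation D := (2 * Rhat).

Hypothesis eta_gt0 : 0 < eta.
Hypothesis delta_gt0 : 0 < delta.
Hypothesis beta_itv : 0 <= beta < 1.
Hypothesis m0 : m 0 = 0.
Hypothesis mS : forall k, m k.+1 = beta *: m k + (1 - beta) *: G k.
Hypothesis V0 : V 0 = 0.
Hypothesis VS : forall k, V k.+1 = V k + norm2 (G k) ^+ 2.
Hypothesis th_step : forall k u, norm2 u <= Rhat ->
  norm2 (th k.+1 - u) <= norm2 (th k + (eta * A k.+1) *: m k.+1 - u).
Hypothesis th_ball : forall k, norm2 (th k) <= Rhat.
Hypothesis ts_ball : norm2 ts <= Rhat.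
Hypothesis g_bound : forall k x, norm2 x <= Rhat -> norm2 (g k x) <= Gm.
Hypothesis g_lip : forall k x y, norm2 (g k x - g k y) <= L * norm2 (x - y).
Hypothesis gbar_lip : forall x y, norm2 (gbar x - gbar y) <= Lbar * norm2 (x - y).
Hypothesis L_ge0 : 0 <= L.
Hypothesis Lbar_ge0 : 0 <= Lbar.
Hypothesis gbar_ts : gbar ts = 0.
Hypothesis c_gt0 : 0 < c.
Hypothesis gbar_mono : forall x, c * norm2 (ts - x) ^+ 2 <= dot (ts - x) (gbar x).

Let s k := A k.+1 ^+ 2 * norm2 (G k) ^+ 2.
Let q k := A k ^+ 2 * norm2 (m k) ^+ 2.
Let G_bound k : norm2 (G k) <= Gm. Proof. exact: g_bound. Qed.
Let D_ge0 : 0 <= D.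
Proof. by rewrite (le_trans _ (dist_bound ts_ball ts_ball)) ?norm2_ge0. Qed.
Let Gm_ge0 : 0 <= Gm. Proof. by rewrite (le_trans _ (G_bound 0)) ?norm2_ge0. Qed.
Let A_gt0 k : 0 < A k. Proof. by apply: stepsize_gt0 delta_gt0 V0 VS k. Qed.
Let A_decr j k : (j <= k)%N -> A k <= A j.
Proof. by apply: stepsize_decr delta_gt0 V0 VS j k. Qed.

Definition noise k (x : 'cV[R]_d) : R := dot (ts - x) (g k x - gbar x).

Let e k := norm2 (ts - th k).
Let e_ge0 k : 0 <= e k. Proof. exact: norm2_ge0. Qed.

Lemma gbar_bound x : norm2 (gbar x) <= Lbar * norm2 (ts - x).
Proof. by have := gbar_lip x ts; rewrite gbar_ts subr0 (norm2BC x). Qed.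

Lemma th_drift k tau :
  norm2 (th k - th (k - tau)) ^+ 2 <= tau%:R * eta ^+ 2 * \sum_(i < tau) q (k - i).
Proof.
have h : norm2 (th k - th (k - tau)) <= eta * \sum_(i < tau) A (k - i)%N * norm2 (m (k - i)).
  elim: tau => [|tau IH]; first by rewrite subn0 subrr norm20 big_ord0 mulr0.
  rewrite -(subrKA (th (k - tau)) (th k)) (le_trans (norm2D _ _)) // big_ord_recr mulrDr.
  (* Truncated subtraction keeps the backward walk at 0, where the extra increment vanishes. *)
  rewrite lerD //=; case E : (k - tau)%N => [|j].
    have -> : (k - tau.+1)%N = 0 by lia.
    by rewrite subrr norm20 mulr_ge0 ?(ltW eta_gt0) // mulr_ge0 ?norm2_ge0 ?(ltW (A_gt0 _)).
  have -> : (k - tau.+1)%N = j by lia.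
  exact: (th_move eta_gt0 delta_gt0 V0 VS th_step th_ball).
apply: (@le_trans _ _ ((eta * \sum_(i < tau) A (k - i)%N * norm2 (m (k - i))) ^+ 2)).
  rewrite ler_pXn2r ?nnegrE ?norm2_ge0 // mulr_ge0 ?(ltW eta_gt0) // sumr_ge0 // => i _.
  by rewrite mulr_ge0 ?norm2_ge0 ?(ltW (A_gt0 _)).
rewrite exprMn [leRHS]mulrAC [leRHS]mulrC ler_wpM2l ?sqr_ge0 //.
have := sqr_sum_le tau (fun i => A (k - i)%N * norm2 (m (k - i))).
by under [X in _ <= _ * X -> _]eq_bigr do rewrite exprMn.
Qed.

Local Notation Lx := (L + Lbar).
(** The coefficient of the squared drift: the quotient by 2 c comes from absorbing the products of
    drift and error into c/2 e^2, the next term from the Lipschitz bounds, and 1/2 from pairing the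
    drift with the gradient. *)
Definition drift_const : R := A 0 * ((Lx + Lbar) ^+ 2 / (2 * c) + Lx) + 2^-1.
Definition noise_bound : R := D * (Gm + Lbar * D).

(** The two factors of the noise are moved one after the other. The norm of [G k] is kept rather
    than bounded by Gm, so that it can be charged to the logarithmic sum of [s]. *)
Lemma noise_frozen k x : norm2 x <= Rhat ->
  noise k x - noise k (th k) <=
   norm2 (th k - x) * (Lx * (e k + norm2 (th k - x)) + norm2 (G k) + Lbar * e k).
Proof.
move=> xR; set Dl := norm2 (th k - x).
have Dl0 : 0 <= Dl by exact: norm2_ge0.
have -> : noise k x - noise k (th k) =
    dot (ts - x) ((g k x - g k (th k)) - (gbar x - gbar (th k)))
    + dot (th k - x) (G k - gbar (th k)).
  rewrite /noise; have -> : ts - x = (ts - th k) + (th k - x) by rewrite subrKA.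
  by rewrite !(dotDl, dotDr, dotNr); ring.
have h1 : norm2 (ts - x) <= e k + Dl.
  by rewrite -(subrKA (th k) ts) norm2D.
have h2 : norm2 (g k x - g k (th k) - (gbar x - gbar (th k))) <= Lx * Dl.
  rewrite (le_trans (norm2B _ _)) // mulrDl.
  have := g_lip k x (th k); have := gbar_lip x (th k).
  by rewrite (norm2BC x) -/Dl; lra.
have h3 : norm2 (G k - gbar (th k)) <= norm2 (G k) + Lbar * e k.
  by rewrite (le_trans (norm2B _ _)) // lerD2l gbar_bound.
have h4 := ler_dot (ts - x) ((g k x - g k (th k)) - (gbar x - gbar (th k))).
have h5 := ler_dot (th k - x) (G k - gbar (th k)).
have h6 : norm2 (ts - x) * norm2 (g k x - g k (th k) - (gbar x - gbar (th k)))
    <= (e k + Dl) * (Lx * Dl) by rewrite ler_pM ?norm2_ge0.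
have h7 : norm2 (th k - x) * norm2 (G k - gbar (th k)) <= Dl * (norm2 (G k) + Lbar * e k).
  by rewrite ler_wpM2l.
lra.
Qed.

Lemma noise_le k x : norm2 x <= Rhat -> `|noise k x| <= noise_bound.
Proof.
move=> xR; rewrite (le_trans (ler_norm_dot _ _)) // ler_pM ?norm2_ge0 ?dist_bound //.
rewrite (le_trans (norm2B _ _)) // lerD ?g_bound // (le_trans (gbar_bound _)) //.
by rewrite ler_wpM2l // dist_bound.
Qed.

(** The regret term is at least c A e^2 plus noise, by strong monotonicity. Moving weight and
    iterate of the noise back by tau uses up half of c A e^2; the other half stays on the left. *)
Lemma frozen_step k tau :
  c / 2 * (A k * e k ^+ 2) + A (k - tau)%N * noise k (th (k - tau)%N) <=
  A k * dot (ts - th k) (G k) + (A (k - tau)%N - A k) * noise_bound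
  + drift_const * norm2 (th k - th (k - tau)%N) ^+ 2 + s k / 2
  + (A k - A k.+1) * (D * Gm).
Proof.
set x := th (k - tau); set Dl := norm2 (th k - x).
have Dl0 : 0 <= Dl by exact: norm2_ge0.
have DlD : Dl <= D by exact: dist_bound (th_ball _) (th_ball _).
have Ak := A_gt0 k; have Ak1 := A_gt0 k.+1.
have hA1 : A k.+1 <= A k by exact: A_decr.
have hA0 : A k <= A 0 by exact: A_decr.
have hAq : A k <= A (k - tau)%N by apply: A_decr; rewrite leq_subr.
have := noise_frozen k (th_ball (k - tau)); rewrite -/x -/Dl => h1.
have h2 : noise k x <= noise_bound by rewrite (le_trans (ler_norm _)) // noise_le // th_ball.
have h3 : A k * dot (ts - th k) (G k) >= c * (A k * e k ^+ 2) + A k * noise k (th k).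
  rewrite mulrCA -mulrDr ler_wpM2l ?(ltW Ak) // /noise dotDr dotNr.
  by have := gbar_mono (th k); rewrite -/(e k); lra.
have h4 : A (k - tau)%N * noise k x <= A k * noise k x + (A (k - tau)%N - A k) * noise_bound.
  nra.
have h5 : A k * noise k x <= A k * noise k (th k) +
   A k * (Dl * (Lx * (e k + Dl) + norm2 (G k) + Lbar * e k)).
  by rewrite -mulrDr ler_wpM2l ?(ltW Ak) //; lra.
have ek := e_ge0 k; have gk := norm2_ge0 (G k).
have h6 : (Lx + Lbar) * (e k * Dl) <= c / 2 * e k ^+ 2 + (Lx + Lbar) ^+ 2 / (2 * c) * Dl ^+ 2.
  have : 0 <= (2 * c)^-1 * (c * e k - (Lx + Lbar) * Dl) ^+ 2.
    by rewrite mulr_ge0 ?sqr_ge0 // invr_ge0 mulr_ge0 // ltW.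
  have -> : (2 * c)^-1 * (c * e k - (Lx + Lbar) * Dl) ^+ 2 =
    c / 2 * e k ^+ 2 + (Lx + Lbar) ^+ 2 / (2 * c) * Dl ^+ 2 - (Lx + Lbar) * (e k * Dl).
    by field; rewrite gt_eqF.
  by rewrite subr_ge0.
(* The weight has to become [A k.+1] before the square of A |G| can be recognized as [s k]; the
   exchange telescopes. *)
have h7 : A k * (Dl * norm2 (G k)) <= Dl ^+ 2 / 2 + s k / 2 + (A k - A k.+1) * (D * Gm).
  have : (A k - A k.+1) * (Dl * norm2 (G k)) <= (A k - A k.+1) * (D * Gm).
    by rewrite ler_wpM2l ?subr_ge0 // ler_pM // G_bound.
  have : 0 <= (Dl - A k.+1 * norm2 (G k)) ^+ 2 by exact: sqr_ge0.
  rewrite /s; lra.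
have h8 : A k * ((Lx + Lbar) ^+ 2 / (2 * c) + Lx) * Dl ^+ 2 <=
  A 0 * ((Lx + Lbar) ^+ 2 / (2 * c) + Lx) * Dl ^+ 2.
  rewrite ler_wpM2r ?sqr_ge0 // ler_wpM2r // addr_ge0 ?addr_ge0 //.
  by rewrite divr_ge0 ?sqr_ge0 // mulr_ge0 // ltW.
have h9 := ler_wpM2l (ltW Ak) h6.
rewrite /drift_const; lra.
Qed.

(** The drift over tau steps is a window of tau energies, and each energy lies in at most tau
    windows, up to the vanishing q 0: hence tau^2 times the sum of [s]. *)
Lemma pathwise_bound N tau :
  c / 2 * \sum_(k < N) A k * e k ^+ 2
  + \sum_(k < N) (if (tau <= k)%N then A (k - tau)%N * noise k (th (k - tau)%N) else 0)
  <= \sum_(k < N) A k * dot (ts - th k) (G k)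
     + tau%:R * A 0 * noise_bound + A 0 * (D * Gm)
     + tau%:R * (A 0 * noise_bound)
     + (drift_const * (tau%:R ^+ 2 * eta ^+ 2) + 2^-1) * \sum_(k < N) s k.
Proof.
have nb0 : 0 <= noise_bound by rewrite mulr_ge0 // addr_ge0 // mulr_ge0.
have dc0 : 0 <= drift_const.
  rewrite addr_ge0 // mulr_ge0 ?(ltW (A_gt0 _)) // !addr_ge0 //.
  by rewrite divr_ge0 ?sqr_ge0 // mulr_ge0 // ltW.
pose bad k : R := if (tau <= k)%N then 0 else A 0 * noise_bound.
have step k : c / 2 * (A k * e k ^+ 2)
   + (if (tau <= k)%N then A (k - tau)%N * noise k (th (k - tau)%N) else 0) <=
  A k * dot (ts - th k) (G k) + (A (k - tau)%N - A k) * noise_bound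
  + drift_const * (tau%:R * eta ^+ 2 * \sum_(i < tau) q (k - i)) + s k / 2
  + (A k - A k.+1) * (D * Gm) + bad k.
  have := frozen_step k tau.
  have : drift_const * norm2 (th k - th (k - tau)%N) ^+ 2 <=
      drift_const * (tau%:R * eta ^+ 2 * \sum_(i < tau) q (k - i)).
    by rewrite ler_wpM2l // th_drift.
  rewrite /bad; case: ifP => _; first by lra.
  have := noise_le k (th_ball (k - tau)); rewrite ler_norml => /andP[nl _].
  have hA : A (k - tau)%N <= A 0 by exact: A_decr.
  have : - (A 0 * noise_bound) <= A (k - tau)%N * noise k (th (k - tau)%N).
    by have := A_gt0 (k - tau); nra.
  lra.
have badN : \sum_(k < N) bad k <= tau%:R * (A 0 * noise_bound).
  have -> : \sum_(k < N) bad k = (minn N tau)%:R * (A 0 * noise_bound).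
    elim: N => [|N IH]; first by rewrite big_ord0 min0n mul0r.
    rewrite big_ord_recr /= IH /bad; case: leqP => h.
      by rewrite addr0 (minn_idPr (leqW h)).
    by rewrite (minn_idPl h) -natr1 mulrDl mul1r.
  by rewrite ler_wpM2r ?ler_nat ?geq_minr // mulr_ge0 // ltW.
have sA : \sum_(k < N) A (k - tau)%N <= \sum_(k < N) A k + tau%:R * A 0.
  by apply: ler_sum_shift_decr => k; [exact: ltW|exact: A_decr].
have telA : \sum_(k < N) (A k - A k.+1) <= A 0.
  have -> : \sum_(k < N) (A k - A k.+1) = A 0 - A N.
    elim: N {badN sA} => [|N IH]; first by rewrite big_ord0 subrr.
    by rewrite big_ord_recr /= IH addrA subrK.
  by have := A_gt0 N; lra.
have sq : \sum_(k < N) \sum_(i < tau) q (k - i) <= tau%:R * \sum_(k < N) s k.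
  rewrite exchange_big /= mulr_natl -[X in _ *+ X]card_ord -sumr_const ler_sum // => i _.
  apply: (le_trans (ler_sum_shift _ _ _ _)).
  - by rewrite /q m0 norm20 expr0n mulr0.
  - by move=> k; rewrite mulr_ge0 ?sqr_ge0.
  have := sum_momentum_le delta_gt0 beta_itv m0 mS V0 VS N.
  apply: le_trans; rewrite (@sum_succ0 _ q N).
    by rewrite lerDl mulr_ge0 ?sqr_ge0.
  by rewrite /q m0 norm20 expr0n mulr0.
have := ler_sum (index_enum 'I_N) (fun (k : 'I_N) (_ : xpredT k) => step k).
rewrite !big_split /= -!mulr_sumr -!mulr_suml sumrB.
have h1 : (\sum_(k < N) A (k - tau)%N - \sum_(k < N) A k) * noise_bound <=
    tau%:R * A 0 * noise_bound.
  by rewrite ler_wpM2r //; lra.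
have h2 : drift_const * (tau%:R * eta ^+ 2 * \sum_(k < N) \sum_(i < tau) q (k - i)) <=
    drift_const * (tau%:R * eta ^+ 2 * (tau%:R * \sum_(k < N) s k)).
  by rewrite ler_wpM2l // ler_wpM2l // mulr_ge0 ?sqr_ge0.
have h3 : (\sum_(k < N) (A k - A k.+1)) * (D * Gm) <= A 0 * (D * Gm).
  by rewrite ler_wpM2r // mulr_ge0.
lra.
Qed.

End Freezing.

(** * Expectation over the trajectory *)

Section Expectation.
Variables (R : realType) (n : nat).
Local Notation T := 'I_n.

Definition upd (x : nat -> T) (k : nat) (y : T) : nat -> T :=
  fun j => if j == k then y else x j.

(* Coordinate 0 of a trajectory is irrelevant. *)
Definition depends_upto {U : Type} (k : nat) (F : (nat -> T) -> U) : Prop :=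
  forall x y, (forall i, (1 <= i <= k)%N -> x i = y i) -> F x = F y.

Lemma depends_upto_le {U : Type} j k (F : (nat -> T) -> U) : (j <= k)%N ->
  depends_upto j F -> depends_upto k F.
Proof.
by move=> jk dF x y xy; apply: dF => i /andP[i1 ij]; apply: xy; rewrite i1 (leq_trans ij).
Qed.

Lemma upd_depends {U : Type} j k (F : (nat -> T) -> U) x y : depends_upto j F -> (j < k)%N ->
  F (upd x k y) = F x.
Proof.
by move=> dF jk; apply: dF => i /andP[_ ij]; rewrite /upd ltn_eqF // (leq_ltn_trans ij).
Qed.

Variables (mu : T -> R) (P : 'M[R]_n).

(** The law of coordinate k + 1 given the previous ones; as trajectories start at index 1, k = 0
    stands for the initial law. *)
Definition next_weight k (x : nat -> T) (y : T) : R :=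
  if k is 0 then mu y else P (x k) y.

(* The expectation of F over the coordinates k+1, ..., k+m, given the
   coordinates 1, ..., k. *)
Fixpoint cond_exp m k (F : (nat -> T) -> R) (x : nat -> T) : R :=
  if m is m'.+1 then \sum_y next_weight k x y * cond_exp m' k.+1 F (upd x k.+1 y)
  else F x.

(** The recursion of [cond_exp] removes the earliest coordinate; conditioning on the past requires
    removing the latest. *)
Lemma cond_exp_last m k F x : cond_exp m.+1 k F x =
  cond_exp m k (fun x => \sum_y next_weight (k + m) x y * F (upd x (k + m).+1 y)) x.
Proof.
elim: m k x => [|m IH] k x; first by rewrite /= addn0.
rewrite [LHS]/=; apply: eq_bigr => y _; rewrite -/(cond_exp m.+1 k.+1 F _).
by rewrite IH addSnnS.
Qed.

Lemma cond_exp_lin m k a b F G x :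
  cond_exp m k (fun x => a * F x + b * G x) x = a * cond_exp m k F x + b * cond_exp m k G x.
Proof.
elim: m k x => [//|m IH] k x /=; rewrite !mulr_sumr -big_split /=.
by apply: eq_bigr => y _; rewrite IH; ring.
Qed.

Lemma cond_exp0 m k x : cond_exp m k (fun=> 0) x = 0.
Proof.
elim: m k x => [//|m IH] k x /=.
by rewrite big1 // => y _; rewrite IH mulr0.
Qed.

Lemma cond_expD m k F G x :
  cond_exp m k (fun x => F x + G x) x = cond_exp m k F x + cond_exp m k G x.
Proof.
rewrite -[X in X + _]mul1r -[X in _ + X]mul1r -cond_exp_lin.
by congr cond_exp; apply/funext => z; rewrite !mul1r.
Qed.

Lemma cond_expZ m k a F x : cond_exp m k (fun x => a * F x) x = a * cond_exp m k F x.
Proof.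
elim: m k x => [//|m IH] k x /=; rewrite mulr_sumr.
by apply: eq_bigr => y _; rewrite IH mulrCA.
Qed.

Lemma cond_exp_sum (I : Type) (r : seq I) (F : I -> (nat -> T) -> R) m k x :
  cond_exp m k (fun x => \sum_(i <- r) F i x) x = \sum_(i <- r) cond_exp m k (F i) x.
Proof.
elim: r => [|i r IH].
  rewrite big_nil -[RHS](cond_exp0 m k x); congr cond_exp.
  by apply/funext => z; rewrite big_nil.
rewrite big_cons -IH -cond_expD; congr cond_exp.
by apply/funext => z; rewrite big_cons.
Qed.

Hypothesis mu_ge0 : forall y, 0 <= mu y.
Hypothesis mu_sum1 : \sum_y mu y = 1.
Hypothesis P_stoch : stochastic P.

Lemma next_weight_ge0 k x y : 0 <= next_weight k x y.
Proof. by case: k => [|k] //=; case: P_stoch. Qed.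

Lemma next_weight_sum1 k x : \sum_y next_weight k x y = 1.
Proof. by case: k => [|k] //=; case: P_stoch. Qed.

Lemma ler_cond_exp m k F G x : (forall x, F x <= G x) ->
  cond_exp m k F x <= cond_exp m k G x.
Proof.
move=> FG; elim: m k x => [//|m IH] k x /=; apply: ler_sum => y _.
by rewrite ler_wpM2l ?next_weight_ge0.
Qed.

Lemma cond_exp_depends m k j F x : depends_upto j F -> (j <= k)%N ->
  cond_exp m k F x = F x.
Proof.
move=> dF; elim: m k x => [//|m IH] k x jk /=.
under eq_bigr do rewrite IH ?(leqW jk) // (upd_depends _ _ dF) //.
by rewrite -mulr_suml next_weight_sum1 mul1r.
Qed.

Variable x0 : nat -> T.

(** The path [x0] only fills coordinate 0 and those beyond N. *)
Definition mean N (F : (nat -> T) -> R) : R := cond_exp N 0 F x0.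

Lemma mean_depends N j F : depends_upto j F -> (j <= N)%N -> mean N F = mean j F.
Proof.
move=> dF /subnK <-; elim: (N - j)%N => [//|i IH]; rewrite addSn -IH /mean cond_exp_last.
congr cond_exp; apply/funext => x; rewrite add0n.
under eq_bigr do rewrite (upd_depends _ _ dF) ?ltnS ?leq_addl //.
by rewrite -mulr_suml next_weight_sum1 mul1r.
Qed.

Lemma mean_step N j F : depends_upto j.+1 F -> (0 < j)%N -> (j < N)%N ->
  mean N F = mean N (fun x => \sum_y P (x j) y * F (upd x j.+1 y)).
Proof.
move=> dF j0 jN; rewrite (mean_depends dF) // (@mean_depends N j) ?(ltnW jN) //.
  rewrite /mean cond_exp_last add0n; congr cond_exp; apply/funext => x.
  by apply: eq_bigr => y _; case: j j0 {dF jN}.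
move=> x y xy; apply: eq_bigr => z _; rewrite xy ?j0 ?leqnn //; congr (_ * _).
apply: dF => i /andP[i1 ij]; rewrite /upd; case: eqVneq => // nij.
by apply: xy; rewrite i1 -ltnS ltn_neqAle nij.
Qed.

(** The Markov property over m steps, the coordinate q + m being averaged out one transition at a
    time. *)
Lemma mean_markov N q m (W : (nat -> T) -> T -> R) :
  depends_upto q W -> (0 < q)%N -> (q + m <= N)%N ->
  mean N (fun x => W x (x (q + m)%N)) = mean N (fun x => \sum_y (P ^+ m) (x q) y * W x y).
Proof.
move=> dW q0; elim: m W dW => [|m IH] W dW qmN.
  congr cond_exp; apply/funext => x; rewrite addn0 expr0 (bigD1 (x q)) //=.
  by rewrite big1 => [|y /negPf yq]; rewrite mxE ?eqxx ?mul1r ?addr0 // eq_sym yq mul0r.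
rewrite addnS in qmN *.
rewrite (@mean_step N (q + m)) ?addn_gt0 ?q0 //; last first.
  move=> x y xy; rewrite xy ?leqnn // (dW x y) // => i /andP[i1 iq].
  by apply: xy; rewrite i1 (leq_trans iq) // -addnS leq_addr.
pose W' x z := \sum_y P z y * W x y.
transitivity (mean N (fun x => W' x (x (q + m)%N))).
  congr cond_exp; apply/funext => x; apply: eq_bigr => y _.
  by rewrite (upd_depends _ _ dW) ?ltnS ?leq_addr // /upd eqxx.
rewrite IH ?(ltnW qmN) //; last first.
  by move=> x y xy; apply/funext => z; apply: eq_bigr => t _; rewrite (dW _ _ xy).
congr cond_exp; apply/funext => x; rewrite /W'.
under eq_bigr do rewrite mulr_sumr.
rewrite exchange_big /=; apply: eq_bigr => y _; rewrite exprSr mxE mulr_suml.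
by apply: eq_bigr => z _; rewrite mulrA.
Qed.

End Expectation.

(** * Integrals over the trajectory as finite sums *)

Section Trajectory.
Variables (R : realType) (n : nat) (P : 'M[R]_n).
Variables (disp : measure_display) (Omega : measurableType disp).
Variables (Pr : probability Omega R) (s : nat -> Omega -> 'I_n).
Hypothesis s_markov : markov_trajectory P Pr s.

Definition init_law (y : 'I_n) : R := fine (Pr [set w | s 1 w = y]).

Local Notation traj := (fun w k => s k w).

Definition cylinder k (x : nat -> 'I_n) : set Omega :=
  [set w | forall j, (1 <= j <= k)%N -> s j w = x j].

Lemma measurable_cylinder k x : measurable (cylinder k x).
Proof.
have [ms _] := s_markov; elim: k => [|k IH].
  rewrite (_ : cylinder 0 x = setT) //; apply/seteqP; split=> // w _ j.
  by case: j.
rewrite (_ : cylinder k.+1 x = cylinder k x `&` [set w | s k.+1 w = x k.+1]).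
  by apply: measurableI => //; exact: ms.
apply/seteqP; split=> w.
  move=> wx; split=> [j /andP[j1 jk]|]; last by apply: wx; rewrite /= leqnn.
  by apply: wx; rewrite j1 leqW.
move=> [wx wk] j /andP[j1]; rewrite leq_eqVlt => /orP[/eqP ->//|jk].
by apply: wx; rewrite j1.
Qed.

Lemma cylinder0 x : cylinder 0 x = setT.
Proof. by apply/seteqP; split=> // w _ j; case: j. Qed.

Lemma cylinder_next k x y :
  Pr (cylinder k.+1 (upd x k.+1 y)) = (Pr (cylinder k x) * (next_weight init_law P k x y)%:E)%E.
Proof.
case: k => [|k] /=.
  rewrite cylinder0 probability_setT mul1e /init_law fineK ?fin_num_measure //; last first.
    by apply: (s_markov.1 1%N).
  congr (Pr _); apply/seteqP; split=> w /=; first by move=> /(_ 1%N isT); rewrite /upd eqxx.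
  by move=> sy j; case: j => [|[|j]].
have [_ /(_ k.+1 (upd x k.+2 y) isT)] := s_markov.
rewrite /upd eqxx ltn_eqF // => ->; congr (Pr _ * _)%E.
apply/seteqP; split=> w /= H j /andP[j1 jk]; have := H j; rewrite j1 jk => /(_ isT).
  by rewrite ltn_eqF.
by rewrite ltn_eqF.
Qed.

Lemma cylinder_split k x :
  cylinder k x = \big[setU/set0]_(y <- enum 'I_n) cylinder k.+1 (upd x k.+1 y).
Proof.
rewrite -bigcup_seq; apply/seteqP; split=> w.
  move=> wx; exists (s k.+1 w); first by rewrite /= mem_enum.
  move=> j /andP[j1]; rewrite leq_eqVlt /upd => /orP[/eqP ->|jk].
    by rewrite eqxx.
  by rewrite ltn_eqF // wx // j1.
move=> [y _ wy] j /andP[j1 jk]; have := wy j; rewrite j1 leqW // => /(_ isT).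
by rewrite /upd ltn_eqF.
Qed.

Lemma trivIset_cylinder k x (D : set 'I_n) :
  trivIset D (fun y => cylinder k.+1 (upd x k.+1 y)).
Proof.
apply/trivIsetP => y z _ _ /eqP yz; apply/seteqP; split=> // w [/(_ k.+1) wy /(_ k.+1) wz].
by apply: yz; move: wy wz; rewrite leqnn /upd eqxx => <- // <-.
Qed.

(** On a cylinder of full length F is constant; a shorter one is the finite disjoint union of its
    extensions by one coordinate. Measurability is proved in the same induction, because additivity
    of the integral requires it. *)
Lemma integral_cylinder m k x (F : (nat -> 'I_n) -> R) : depends_upto (k + m) F ->
  measurable_fun (cylinder k x) (fun w => F (traj w)) /\
  (\int[Pr]_(w in cylinder k x) (F (traj w))%:E =
     Pr (cylinder k x) * (cond_exp init_law P m k F x)%:E)%E.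
Proof.
elim: m k x => [|m IH] k x dF.
  have FE w : cylinder k x w -> F (traj w) = F x.
    by move=> wx; apply: dF; rewrite addn0 => i; exact: wx.
  split.
    apply: (eq_measurable_fun (cst (F x))); last exact: measurable_cst.
    by move=> w; rewrite inE => /FE.
  rewrite muleC -integral_cst; last exact: measurable_cylinder.
  by apply: eq_integral => w; rewrite inE => /FE ->.
have {}IH y := IH k.+1 (upd x k.+1 y); rewrite addSnnS in IH.
have mF : measurable_fun (cylinder k x) (fun w => F (traj w)).
  rewrite cylinder_split; elim: (enum 'I_n) => [|y r IHr].
    by rewrite big_nil; exact: measurable_fun_set0.
  rewrite big_cons; apply/measurable_funU.
  - exact: measurable_cylinder.
  - by apply: bigsetU_measurable => z _; exact: measurable_cylinder.
  - by split=> //; case: (IH y dF).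
split=> //; rewrite cylinder_split integral_bigsetU_EFin; last first.
- by rewrite -cylinder_split; move: mF => /measurable_EFinP.
- exact: trivIset_cylinder.
- exact: enum_uniq.
- by move=> y; exact: measurable_cylinder.
rewrite -cylinder_split /= -[X in (X * _)%E]fineK ?fin_num_measure //; last exact: measurable_cylinder.
rewrite -EFinM mulr_sumr -sumEFin big_enum /=; apply: eq_bigr => y _.
rewrite (proj2 (IH y dF)) cylinder_next -[X in (X * _ * _)%E]fineK ?fin_num_measure //.
  by rewrite -!EFinM mulrA.
exact: measurable_cylinder.
Qed.

Lemma init_law_ge0 y : 0 <= init_law y.
Proof. exact: fine_ge0. Qed.

Lemma init_law_sum1 (y0 : 'I_n) : \sum_y init_law y = 1.
Proof.
have [_] := @integral_cylinder 1 0 (fun=> y0) (fun=> 1) (fun _ _ _ => erefl).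
rewrite cylinder0 integral_cst // probability_setT !mul1e /=.
move=> /(etrans (esym (probability_setT Pr))) [->].
by apply: eq_bigr => y _; rewrite mulr1.
Qed.

Lemma measurable_depends k (F : (nat -> 'I_n) -> R) (x0 : nat -> 'I_n) :
  depends_upto k F -> measurable_fun setT (fun w => F (traj w)).
Proof. by move=> dF; have [] := @integral_cylinder k 0 x0 F dF; rewrite cylinder0. Qed.

Lemma integral_mean k (F : (nat -> 'I_n) -> R) (x0 : nat -> 'I_n) : depends_upto k F ->
  (\int[Pr]_w (F (traj w))%:E = (mean init_law P x0 k F)%:E)%E.
Proof.
move=> dF; have [_] := @integral_cylinder k 0 x0 F dF.
by rewrite cylinder0 probability_setT mul1e.
Qed.

End Trajectory.

(** * Frozen Markovian noise *)

Section AdaTDPath.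
Variables (R : realType) (n d : nat) (P : 'M[R]_n) (rew : 'I_n -> 'I_n -> R).
Variables (gamma B kappa rho : R) (pi_ : 'rV[R]_n) (Phi : 'M[R]_(n, d)).
Variables (lambda eta delta beta Rhat : R) (theta1 ts : 'cV[R]_d).
Hypothesis P_stoch : stochastic P.
Hypothesis gamma_itv : 0 < gamma < 1.
Hypothesis rew_bounded : forall x y, `|rew x y| <= B.
Hypothesis pi_gt0 : forall y, 0 < pi_ ord0 y.
Hypothesis pi_sum1 : \sum_y pi_ ord0 y = 1.
Hypothesis feature_le1 : forall x, norm2 (feature Phi x) <= 1.
Hypothesis lambda_itv : 0 <= lambda <= 1.
Hypothesis delta_gt0 : 0 < delta.
Hypothesis theta1_le : norm2 theta1 <= Rhat.
Hypothesis ts_le : norm2 ts <= Rhat.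
Hypothesis B_ge0 : 0 <= B.

Local Notation S x k := (adatd rew gamma Phi lambda eta delta beta Rhat theta1 x k).
Local Notation th x k := (next_iter (S x k)).
Local Notation gbar := (mean_update P rew gamma Phi pi_ lambda).
Local Notation H := (B + 2 * Rhat).
Local Notation D := (2 * Rhat).
Local Notation zeta := (1 - gamma)^-1.

Let Rhat_ge0 : 0 <= Rhat. Proof. by rewrite (le_trans _ theta1_le) ?norm2_ge0. Qed.
Let H_ge0 : 0 <= H. Proof. by rewrite addr_ge0 // mulr_ge0. Qed.
Let g0 : 0 < gamma. Proof. by case/andP: gamma_itv. Qed.
Let g1 : gamma < 1. Proof. by case/andP: gamma_itv. Qed.
Let l0 : 0 <= lambda. Proof. by case/andP: lambda_itv. Qed.
Let l1 : lambda <= 1. Proof. by case/andP: lambda_itv. Qed.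
Let zeta_gt0 : 0 < zeta. Proof. by rewrite invr_gt0 subr_gt0. Qed.
Let gl_le : gamma * lambda <= gamma. Proof. by rewrite ler_piMr // ltW. Qed.
Let gl_ge0 : 0 <= gamma * lambda. Proof. by rewrite mulr_ge0 // ltW. Qed.

Definition path_td (x : nat -> 'I_n) (k : nat) (theta : 'cV[R]_d) : R :=
  rew (x k.+1) (x k.+2) + gamma * dot (feature Phi (x k.+2)) theta
  - dot (feature Phi (x k.+1)) theta.

(** This is g^(k+1) as a function of a free parameter; the trace depends on the states alone, so an
    older iterate can be inserted. *)
Definition path_grad (x : nat -> 'I_n) (k : nat) (theta : 'cV[R]_d) : 'cV[R]_d :=
  path_td x k theta *: trace (S x k.+1).

Lemma adatd_depends k : depends_upto k.+1 (fun x => S x k).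
Proof.
elim: k => [//|k IH] x y xy; rewrite [LHS]/= [RHS]/=.
have e i : (0 < i <= k.+2)%N -> x i = y i by exact: xy.
have -> : S x k = S y k by apply: IH => i /andP[i1 ik]; apply: xy; rewrite i1 leqW.
have e1 : x k.+1 = y k.+1 by apply: e; rewrite ltnS leqnSn.
have e2 : x k.+2 = y k.+2 by apply: e; rewrite leqnn.
rewrite e1 e2; exact: erefl.
Qed.

Lemma th_le x k : norm2 (th x k) <= Rhat.
Proof. by case: k => [//|k] /=; exact: norm2_proj_ball. Qed.

Lemma trace_bound x k : norm2 (trace (S x k)) <= zeta.
Proof.
elim: k => [|k IH] /=; first by rewrite norm20 ltW.
rewrite (le_trans (norm2D _ _)) // norm2Z ger0_norm //.
have -> : zeta = gamma * zeta + 1 by field; rewrite subr_eq0 gt_eqF.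
by rewrite lerD // ler_pM ?norm2_ge0.
Qed.

Lemma dot_feature_bound s theta : `|dot (feature Phi s) theta| <= norm2 theta.
Proof. by rewrite (le_trans (ler_norm_dot _ _)) // ler_piMl ?norm2_ge0. Qed.

Lemma td_entry_bound (b z : 'I_n) theta : norm2 theta <= Rhat ->
  `|rew b z + gamma * dot (feature Phi z) theta - dot (feature Phi b) theta| <= H.
Proof.
move=> tR; rewrite (le_trans (ler_normB _ _)) // mulr_natl mulr2n addrA.
rewrite lerD ?(le_trans (dot_feature_bound _ _)) // (le_trans (ler_normD _ _)) //.
rewrite lerD // normrM gtr0_norm // (le_trans (ler_piMl (normr_ge0 _) (ltW g1))) //.
by rewrite (le_trans (dot_feature_bound _ _)).
Qed.

Lemma path_grad_bound x k theta : norm2 theta <= Rhat ->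
  norm2 (path_grad x k theta) <= H * zeta.
Proof.
move=> tR; rewrite norm2Z ler_pM ?norm2_ge0 ?trace_bound //.
exact: td_entry_bound.
Qed.

Lemma path_grad_lip x k t t' :
  norm2 (path_grad x k t - path_grad x k t') <= 2 * zeta * norm2 (t - t').
Proof.
rewrite -scalerBl norm2Z mulrAC ler_pM ?norm2_ge0 ?trace_bound //.
have -> : path_td x k t - path_td x k t' =
   gamma * dot (feature Phi (x k.+2)) (t - t') - dot (feature Phi (x k.+1)) (t - t').
  by rewrite /path_td !dotDr !dotNr; ring.
rewrite (le_trans (ler_normB _ _)) // mulr_natl mulr2n lerD ?dot_feature_bound //.
rewrite normrM gtr0_norm // (le_trans (ler_piMl (normr_ge0 _) (ltW g1))) //.
exact: dot_feature_bound.
Qed.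

Lemma trace_unroll x k T :
  trace (S x (k + T)%N) = \sum_(j < T) (gamma * lambda) ^+ j *: feature Phi (x (k + T - j)%N)
    + (gamma * lambda) ^+ T *: trace (S x k).
Proof.
elim: T => [|T IH]; first by rewrite addn0 big_ord0 add0r expr0 scale1r.
rewrite addnS /= IH big_ord_recl /= subn0 expr0 scale1r scalerDr scalerA -exprS.
rewrite addrC addrA; congr (_ + _ + _); rewrite scaler_sumr; apply: eq_bigr => j _.
by rewrite scalerA -exprS; congr (_ *: feature Phi (x _)); rewrite /bump /=; lia.
Qed.

Local Notation A x k := (stepsize (fun i => accum (S x i)) delta k).

Lemma sum_td_row b theta :
  \sum_z P b z * (rew b z + gamma * dot (feature Phi z) theta - dot (feature Phi b) theta)
  = td P rew gamma (Phi *m theta) b ord0.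
Proof.
have [_ P1] := P_stoch.
transitivity (mean_reward P rew b + gamma * (P *m (Phi *m theta)) b ord0 - (Phi *m theta) b ord0).
  rewrite [(P *m _) _ _]mxE mulr_sumr -[(Phi *m theta) b ord0]mul1r -(P1 b) mulr_suml.
  rewrite -big_split -sumrB /=; apply: eq_bigr => z _.
  by rewrite -!dot_feature; ring.
rewrite /td [RHS]mxE [X in _ = X + _]mxE; congr (_ + _ + _).
- by rewrite mxE.
- by rewrite [RHS]mxE.
- by rewrite [RHS]mxE.
Qed.

Lemma td_vec_bound theta s : norm2 theta <= Rhat ->
  `|td P rew gamma (Phi *m theta) s ord0| <= H.
Proof.
have [P0 P1] := P_stoch; move=> tR.
rewrite -sum_td_row (le_trans (ler_norm_sum _ _ _)) //.
have -> : H = \sum_z P s z * H by rewrite -mulr_suml P1 mul1r.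
by rewrite ler_sum // => z _; rewrite normrM ger0_norm // ler_wpM2l ?td_entry_bound.
Qed.

Section Frozen.
Variables (mu : 'I_n -> R) (x0 : nat -> 'I_n).
Hypothesis mu_ge0 : forall y, 0 <= mu y.
Hypothesis mu_sum1 : \sum_y mu y = 1.
Local Notation E := (mean mu P x0).

Lemma mean_correlation N q j m (a : (nat -> 'I_n) -> R) (t : (nat -> 'I_n) -> 'cV[R]_d) :
  depends_upto q.+1 a -> depends_upto q.+1 t -> (q + m + j + 2 <= N)%N ->
  E N (fun x => a x * (path_td x (q + m + j)%N (t x)
      * (Phi *m (ts - t x)) (x (q + m).+1) ord0)) =
  E N (fun x => a x * \sum_z (P ^+ m) (x q.+1) z *
     ((Phi *m (ts - t x)) z ord0 * (P ^+ j *m td P rew gamma (Phi *m t x)) z ord0)).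
Proof.
move=> da dt kN; set k := (q + m + j)%N in kN *.
have mm := mean_markov mu_sum1 P_stoch x0.
have dl (U : Type) (f : (nat -> 'I_n) -> U) l : depends_upto q.+1 f -> (q < l)%N -> depends_upto l f.
  by move=> df ql; apply: depends_upto_le df.
transitivity (E N (fun x => a x * (td P rew gamma (Phi *m t x) (x k.+1) ord0
      * (Phi *m (ts - t x)) (x (q + m).+1) ord0))).
  have := mm N k.+1 1 (fun x z => a x * ((rew (x k.+1) z + gamma * dot (feature Phi z) (t x)
     - dot (feature Phi (x k.+1)) (t x)) * (Phi *m (ts - t x)) (x (q + m).+1) ord0)).
  rewrite addn1 => -> //; last 2 first.
  - move=> x y xy; apply/funext => z; have qk : (q < k.+1)%N by rewrite ltnS /k -addnA leq_addr.
    have e1 : x k.+1 = y k.+1 by apply: xy; rewrite leqnn.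
    have e2 : x (q + m).+1 = y (q + m).+1 by apply: xy; rewrite !ltnS /k leq_addr.
    by rewrite (dl _ _ _ da qk _ _ xy) (dl _ _ _ dt qk _ _ xy) e1 e2.
  - by rewrite -addn2.
  congr cond_exp; apply/funext => x; rewrite expr1 -sum_td_row mulr_suml mulr_sumr.
  by apply: eq_bigr => z _; ring.
transitivity (E N (fun x => a x * ((P ^+ j *m td P rew gamma (Phi *m t x)) (x (q + m).+1) ord0
      * (Phi *m (ts - t x)) (x (q + m).+1) ord0))).
  have := mm N (q + m).+1 j (fun x z => a x * (td P rew gamma (Phi *m t x) z ord0
    * (Phi *m (ts - t x)) (x (q + m).+1) ord0)).
  rewrite addSn -/k => -> //; last 2 first.
  - move=> x y xy; apply/funext => z; have qm : (q < (q + m).+1)%N by rewrite ltnS leq_addr.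
    have e2 : x (q + m).+1 = y (q + m).+1 by apply: xy; rewrite leqnn.
    by rewrite (dl _ _ _ da qm _ _ xy) (dl _ _ _ dt qm _ _ xy) e2.
  - by rewrite (leq_trans _ kN) // addn2 ltnW.
  congr cond_exp; apply/funext => x; rewrite [(P ^+ j *m _) _ _]mxE mulr_suml mulr_sumr.
  by apply: eq_bigr => z _; ring.
have := mm N q.+1 m (fun x z => a x * ((P ^+ j *m td P rew gamma (Phi *m t x)) z ord0
    * (Phi *m (ts - t x)) z ord0)).
rewrite addSn => -> //; last 2 first.
- by move=> x y xy; apply/funext => z; rewrite (da _ _ xy) (dt _ _ xy).
- by rewrite (leq_trans _ kN) // /k addn2 ltnS leqW // leq_addr.
congr cond_exp; apply/funext => x; rewrite mulr_sumr.
by apply: eq_bigr => z _; ring.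
Qed.

Hypothesis kappa_ge0 : 0 <= kappa.
Hypothesis rho_itv : 0 <= rho <= 1.
Hypothesis mixing : forall t x,
  \sum_(y < n) `|(P ^+ t) x y - pi_ ord0 y| <= kappa * rho ^+ t.

Lemma mixing_sum m x (f : 'I_n -> R) M : (forall z, `|f z| <= M) ->
  `|\sum_z (P ^+ m) x z * f z - \sum_z pi_ ord0 z * f z| <= kappa * rho ^+ m * M.
Proof.
move=> fM; rewrite -sumrB (le_trans (ler_norm_sum _ _ _)) //.
apply: (@le_trans _ _ (\sum_z `|(P ^+ m) x z - pi_ ord0 z| * M)).
  by apply: ler_sum => z _; rewrite -mulrBl normrM ler_wpM2l.
rewrite -mulr_suml ler_wpM2r // (le_trans _ (fM x)) //.
Qed.

Lemma geometric_sum_le T : \sum_(j < T) (gamma * lambda) ^+ j <= zeta.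
Proof.
have h : \sum_(j < T) (gamma * lambda) ^+ j <= \sum_(j < T) gamma ^+ j.
  by apply: ler_sum => j _; rewrite lerXn2r ?nnegrE // ltW.
apply: le_trans h _; rewrite -(ler_pM2l (_ : 0 < 1 - gamma)) ?subr_gt0 //.
rewrite divff ?subr_eq0 ?gt_eqF // -opprB mulNr -subrX1.
by rewrite opprB gerBl exprn_ge0 // ltW.
Qed.

(* The bias left after T steps of mixing and T steps of eligibility trace. *)
Definition frozen_bias T : R := D * H * zeta * (2 * gamma ^+ T + kappa * rho ^+ T).

(** As 2 T - j >= T, replacing P^(2T-j) by pi costs kappa rho^T. Under pi the sum over j is the mean
    update up to a Neumann remainder of order gamma^T. The other gamma^T is reserved for the trace
    older than T steps; hence the 2 in [frozen_bias]. *)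
Lemma frozen_conditional T t b : norm2 t <= Rhat ->
  - frozen_bias T <=
  \sum_(j < T) (gamma * lambda) ^+ j * \sum_z (P ^+ (2 * T - j)) b z *
     ((Phi *m (ts - t)) z ord0 * (P ^+ j *m td P rew gamma (Phi *m t)) z ord0)
  - dot (ts - t) (gbar t) - D * H * zeta * gamma ^+ T.
Proof.
move=> tR; pose y := ts - t; pose h := td P rew gamma (Phi *m t).
pose u := lambda_td P rew gamma lambda (Phi *m t).
have yD : norm2 y <= D by exact: dist_bound.
have D0 : 0 <= D by rewrite mulr_ge0.
have hH i : `|h i ord0| <= H by exact: td_vec_bound.
have PhH j i : `|(P ^+ j *m h) i ord0| <= H.
  exact: (stochastic_mul_bound (stochastic_exp P_stoch j)).
have yPhi z : `|(Phi *m y) z ord0| <= D by rewrite (le_trans (feature_mul_bound _ _ _)).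
pose f j z := (Phi *m y) z ord0 * (P ^+ j *m h) z ord0.
have fM j z : `|f j z| <= D * H by rewrite normrM ler_pM.
have uE : u = h + (gamma * lambda) *: (P *m u) by exact: lambda_tdE.
have gl_itv := gamma_lambda_itv gamma_itv lambda_itv.
have uH i : `|u i ord0| <= H * zeta.
  apply: (le_trans (resolvent_bound P_stoch gl_itv i uE hH)); rewrite ler_wpM2l //.
  by rewrite lef_pV2 ?posrE ?subr_gt0 ?lerB //; case/andP: gl_itv.
have PuH i : `|(P ^+ T *m u) i ord0| <= H * zeta.
  exact: (stochastic_mul_bound (stochastic_exp P_stoch T)).
have e1 : \sum_(j < T) (gamma * lambda) ^+ j * \sum_z pi_ ord0 z * f j z =
   dot y (gbar t) - (gamma * lambda) ^+ T * pdot pi_ (Phi *m y) (P ^+ T *m u).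
  rewrite dot_mean_update // -/u.
  have -> : \sum_(j < T) (gamma * lambda) ^+ j * \sum_z pi_ ord0 z * f j z =
      pdot pi_ (Phi *m y) (\sum_(j < T) (gamma * lambda) ^+ j *: (P ^+ j *m h)).
    under eq_bigr do rewrite mulr_sumr.
    rewrite exchange_big /=; apply: eq_bigr => z _; rewrite summxE mulrA mulr_sumr.
    by apply: eq_bigr => j _; rewrite [((_ *: _)%R : 'cV_n) _ _]mxE /f; ring.
  rewrite (resolvent_partial_sum _ uE) pdotB; congr (_ - _).
  by rewrite /pdot mulr_sumr; apply: eq_bigr => z _; rewrite [((_ *: _)%R : 'cV_n) _ _]mxE; ring.
have e2 : `|pdot pi_ (Phi *m y) (P ^+ T *m u)| <= D * (H * zeta).
  rewrite (le_trans (ler_norm_sum _ _ _)) //.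
  have -> : D * (H * zeta) = \sum_z pi_ ord0 z * (D * (H * zeta)).
    by rewrite -mulr_suml pi_sum1 mul1r.
  by apply: ler_sum => z _; rewrite normrM gtr0_norm // ler_wpM2l ?(ltW (pi_gt0 _)) // normrM ler_pM.
have glT : (gamma * lambda) ^+ T <= gamma ^+ T by rewrite lerXn2r ?nnegrE // ltW.
have gT0 : 0 <= (gamma * lambda) ^+ T by rewrite exprn_ge0.
have e3 : (gamma * lambda) ^+ T * pdot pi_ (Phi *m y) (P ^+ T *m u) <=
   gamma ^+ T * (D * (H * zeta)).
  apply: (@le_trans _ _ ((gamma * lambda) ^+ T * (D * (H * zeta)))).
    by rewrite ler_wpM2l // (le_trans (ler_norm _)).
  by rewrite ler_wpM2r // !mulr_ge0 // ltW.
have r0 : 0 <= rho by case/andP: rho_itv.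
have r1 : rho <= 1 by case/andP: rho_itv.
have e4 : \sum_(j < T) (gamma * lambda) ^+ j * \sum_z pi_ ord0 z * f j z
    - \sum_(j < T) (gamma * lambda) ^+ j * \sum_z (P ^+ (2 * T - j)) b z * f j z
    <= zeta * (kappa * rho ^+ T * (D * H)).
  rewrite -sumrB.
  apply: (@le_trans _ _ (\sum_(j < T) (gamma * lambda) ^+ j * (kappa * rho ^+ T * (D * H)))).
    apply: ler_sum => j _; rewrite -mulrBr ler_wpM2l ?exprn_ge0 //.
    rewrite (le_trans (ler_norm _)) // distrC (le_trans (mixing_sum _ _ (fM j))) //.
    rewrite ler_wpM2r ?mulr_ge0 // ler_wpM2l //.
    by apply: ler_wiXn2l => //; rewrite mul2n -addnn -addnBA ?leq_addr // ltnW.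
  by rewrite -mulr_suml ler_wpM2r ?geometric_sum_le // !mulr_ge0 // exprn_ge0.
rewrite /frozen_bias -/y -/h; rewrite e1 in e4.
move: e3 e4; rewrite /f; lra.
Qed.

Let accum_ge0 x k : 0 <= accum (S x k).
Proof. by elim: k => [//|k IH] /=; rewrite addr_ge0 ?sqr_ge0. Qed.

Lemma stepsize_itv x k : 0 < A x k <= (Num.sqrt delta)^-1.
Proof.
have h : 0 < accum (S x k) + delta by rewrite ltr_wpDl.
rewrite invr_gt0 sqrtr_gt0 h /= lef_pV2 ?posrE ?sqrtr_gt0 // ler_wsqrtr //.
by rewrite lerDr.
Qed.

(** The old part of the trace is bounded on each path. Its last T features produce products [w j],
    which have the means of [w' j]; after this exchange everything depends on the coordinates up to
    q + 1 and the conditional bound holds pointwise. *)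
Lemma mean_noise_ge N q T : (q + 2 * T + 2 <= N)%N ->
  - ((Num.sqrt delta)^-1 * frozen_bias T) <=
  E N (fun x => A x q * noise (path_grad x) gbar ts (q + 2 * T)%N (th x q)).
Proof.
move=> kN; pose m j := (2 * T - j)%N.
have mj (j : 'I_T) : (q + m j + j = q + 2 * T)%N.
  by rewrite -addnA subnK // mul2n -addnn (leq_trans (ltnW (ltn_ord j))) // leq_addr.
have aA : depends_upto q.+1 (fun x => A x q).
  by move=> x y xy; rewrite /stepsize (adatd_depends xy).
have tA : depends_upto q.+1 (fun x => th x q).
  by move=> x y xy; rewrite (adatd_depends xy).
pose w (j : 'I_T) (x : nat -> 'I_n) := A x q * (path_td x (q + m j + j)%N (th x q)
      * (Phi *m (ts - th x q)) (x (q + m j).+1) ord0).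
pose w' (j : 'I_T) (x : nat -> 'I_n) := A x q * \sum_z (P ^+ m j) (x q.+1) z *
     ((Phi *m (ts - th x q)) z ord0 * (P ^+ j *m td P rew gamma (Phi *m th x q)) z ord0).
pose rest (x : nat -> 'I_n) :=
  A x q * (- dot (ts - th x q) (gbar (th x q)) - D * H * zeta * gamma ^+ T).
have ww' j : E N (w j) = E N (w' j) by apply: mean_correlation => //; rewrite mj.
have low x : \sum_(j < T) (gamma * lambda) ^+ j * w j x + rest x <=
    A x q * noise (path_grad x) gbar ts (q + 2 * T)%N (th x q).
  have /andP[A0 _] := stepsize_itv x q.
  have -> : \sum_(j < T) (gamma * lambda) ^+ j * w j x + rest x = A x q *
     (path_td x (q + 2 * T)%N (th x q) *
       (\sum_(j < T) (gamma * lambda) ^+ j * (Phi *m (ts - th x q)) (x (q + m j).+1) ord0)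
      + (- dot (ts - th x q) (gbar (th x q)) - D * H * zeta * gamma ^+ T)).
    rewrite /rest [RHS]mulrDr mulr_sumr mulr_sumr; congr (_ + _).
    by apply: eq_bigr => j _; rewrite /w mj; ring.
  rewrite ler_wpM2l ?(ltW A0) // /noise dotDr dotNr /path_grad dotZr.
  have -> : (q + 2 * T).+1 = ((q + T).+1 + T)%N by rewrite mul2n -addnn addnA addSn.
  rewrite trace_unroll dotDr dotZr mulrDr.
  have -> : dot (ts - th x q) (\sum_(j < T) (gamma * lambda) ^+ j *:
       feature Phi (x ((q + T).+1 + T - j)%N)) =
     \sum_(j < T) (gamma * lambda) ^+ j * (Phi *m (ts - th x q)) (x (q + m j).+1) ord0.
    have -> : dot (ts - th x q) (\sum_(j < T) (gamma * lambda) ^+ j *: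
         feature Phi (x ((q + T).+1 + T - j)%N)) = \sum_(j < T) dot (ts - th x q)
           ((gamma * lambda) ^+ j *: feature Phi (x ((q + T).+1 + T - j)%N)).
      by elim/big_rec2: _ => [|j u v _ <-]; rewrite ?dot0r ?dotDr.
    apply: eq_bigr => j _; rewrite dotZr dotC dot_feature.
    have -> // : ((q + T).+1 + T - j = (q + m j).+1)%N.
    rewrite /m mul2n -addnn !addSn subSn; last first.
      by rewrite (leq_trans (ltnW (ltn_ord j))) // leq_addl.
    rewrite -addnA addnBA // (leq_trans (ltnW (ltn_ord j))) // leq_addl //.
  have : - (D * H * zeta * gamma ^+ T) <= path_td x (q + 2 * T) (th x q) *
     ((gamma * lambda) ^+ T * dot (ts - th x q) (trace (S x (q + T).+1))).
    rewrite lerNl (le_trans (ler_norm _)) // normrN !normrM.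
    have h1 : `|path_td x (q + 2 * T) (th x q)| <= H by apply: td_entry_bound; exact: th_le.
    have h2 : `|(gamma * lambda) ^+ T| <= gamma ^+ T.
      by rewrite ger0_norm ?exprn_ge0 // lerXn2r ?nnegrE // ltW.
    have h3 : `|dot (ts - th x q) (trace (S x (q + T).+1))| <= D * zeta.
      rewrite (le_trans (ler_norm_dot _ _)) // ler_pM ?norm2_ge0 ?trace_bound //.
      by rewrite dist_bound ?th_le.
    have -> : D * H * zeta * gamma ^+ T = H * (gamma ^+ T * (D * zeta)) by ring.
    by rewrite ler_pM ?mulr_ge0 // ler_pM.
  lra.
apply: le_trans (ler_cond_exp mu_ge0 P_stoch N 0 x0 low).
rewrite cond_expD cond_exp_sum.
have -> : \sum_(j < T) cond_exp mu P N 0 (fun x => (gamma * lambda) ^+ j * w j x) x0 =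
   \sum_(j < T) cond_exp mu P N 0 (fun x => (gamma * lambda) ^+ j * w' j x) x0.
  by apply: eq_bigr => j _; rewrite !cond_expZ; congr (_ * _); exact: ww'.
rewrite -cond_exp_sum -cond_expD.
have -> : - ((Num.sqrt delta)^-1 * frozen_bias T) =
   cond_exp mu P N 0 (fun=> - ((Num.sqrt delta)^-1 * frozen_bias T)) x0.
  by rewrite (cond_exp_depends mu_sum1 P_stoch _ _ (j := 0)).
apply: ler_cond_exp => // x.
have -> : \sum_(j < T) (gamma * lambda) ^+ j * w' j x + rest x = A x q *
  (\sum_(j < T) (gamma * lambda) ^+ j * \sum_z (P ^+ (2 * T - j)) (x q.+1) z *
     ((Phi *m (ts - th x q)) z ord0 * (P ^+ j *m td P rew gamma (Phi *m th x q)) z ord0)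
  - dot (ts - th x q) (gbar (th x q)) - D * H * zeta * gamma ^+ T).
  rewrite /rest -addrA [RHS]mulrDr [X in _ = X + _]mulr_sumr; congr (_ + _).
  by apply: eq_bigr => j _; rewrite /w'; ring.
have /andP[A0 A1] := stepsize_itv x q.
have bias0 : 0 <= frozen_bias T.
  have r0 : 0 <= rho by case/andP: rho_itv.
  by rewrite !mulr_ge0 ?addr_ge0 ?mulr_ge0 ?exprn_ge0 // ltW.
apply: (@le_trans _ _ (A x q * - frozen_bias T)); last first.
  by rewrite ler_wpM2l ?(ltW A0) // frozen_conditional // th_le.
by rewrite mulrN lerN2 ler_wpM2r.
Qed.

End Frozen.
End AdaTDPath.

(** * Rate of convergence *)

Section Combine.
Variables (R : realType) (n d : nat) (P : 'M[R]_n) (rew : 'I_n -> 'I_n -> R).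
Variables (gamma B : R) (pi_ : 'rV[R]_n) (Phi : 'M[R]_(n, d)).
Variables (lambda eta delta beta Rhat c Lbar : R) (theta1 ts : 'cV[R]_d).
Hypothesis gamma_itv : 0 < gamma < 1.
Hypothesis rew_bounded : forall x y, `|rew x y| <= B.
Hypothesis feature_le1 : forall x, norm2 (feature Phi x) <= 1.
Hypothesis lambda_itv : 0 <= lambda <= 1.
Hypothesis eta_gt0 : 0 < eta.
Hypothesis delta_gt0 : 0 < delta.
Hypothesis beta_itv : 0 <= beta < 1.
Hypothesis theta1_le : norm2 theta1 <= Rhat.
Hypothesis ts_le : norm2 ts <= Rhat.
Hypothesis B_ge0 : 0 <= B.

Local Notation S x k := (adatd rew gamma Phi lambda eta delta beta Rhat theta1 x k).
Local Notation th x k := (next_iter (S x k)).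
Local Notation gbar := (mean_update P rew gamma Phi pi_ lambda).
Local Notation grad := (path_grad rew gamma Phi lambda eta delta beta Rhat theta1).
Local Notation A x k := (stepsize (fun i => accum (S x i)) delta k).
Local Notation D := (2 * Rhat).
Local Notation Gm := ((B + 2 * Rhat) / (1 - gamma)).

Hypothesis c_gt0 : 0 < c.
Hypothesis Lbar_ge0 : 0 <= Lbar.
Hypothesis gbar_ts : gbar ts = 0.
Hypothesis gbar_mono : forall x, c * norm2 (ts - x) ^+ 2 <= dot (ts - x) (gbar x).
Hypothesis gbar_lip : forall x y, norm2 (gbar x - gbar y) <= Lbar * norm2 (x - y).

Let Rhat_ge0 : 0 <= Rhat. Proof. by rewrite (le_trans _ theta1_le) ?norm2_ge0. Qed.

Let Gm_ge0 : 0 <= Gm.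
Proof.
case/andP: gamma_itv => _ g1; rewrite divr_ge0 ?subr_ge0 ?(ltW g1) //.
by rewrite addr_ge0 // mulr_ge0.
Qed.

Lemma accum_le x k : accum (S x k) <= k%:R * Gm ^+ 2.
Proof.
elim: k => [|k IH]; first by rewrite mul0r.
rewrite -natr1 mulrDl mul1r [leLHS]/= lerD //.
have h : norm2 (grad x k (th x k)) <= Gm by apply: path_grad_bound => //; exact: th_le.
by rewrite ler_pXn2r ?nnegrE ?norm2_ge0.
Qed.

(** The constant is uniform in the path, so the inequality can be averaged, and in tau, which is
    later tied to N. *)
Lemma path_bound : exists2 C, 0 < C & forall x N tau,
  \sum_(k < N) A x k * norm2 (ts - th x k) ^+ 2
  + 2 / c * \sum_(k < N) (if (tau <= k)%N then
        A x (k - tau)%N * noise (grad x) gbar ts k (th x (k - tau)%N) else 0)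
  <= C * (1 + tau%:R) ^+ 2 * (1 + ln (1 + N%:R)).
Proof.
pose A0 := (Num.sqrt delta)^-1.
pose L := 2 * (1 - gamma)^-1.
pose K1 := ((1 - beta) * D ^+ 2 / (2 * eta) + 2 * (A0 * (D * Gm))) / (1 - beta).
pose K2 := ((1 - beta) * eta / 2 + eta) / (1 - beta).
pose nb := noise_bound Rhat Gm Lbar.
pose dc : R := A0 * ((L + Lbar + Lbar) ^+ 2 / (2 * c) + (L + Lbar)) + 2^-1.
(* Chosen so that ln ((1 + Gm^2 / delta) (1 + N)) <= s0 (1 + ln (1 + N)). *)
pose s0 := 1 + ln (1 + Gm ^+ 2 / delta).
(* The coefficients of [pathwise_bound] after [adaptive_regret] is inserted; each multiplies at most
   (1 + tau)^2 (1 + ln (1 + N)). *)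
pose K := K1 + K2 * s0 + 2 * (A0 * nb) + A0 * (D * Gm) + (dc * eta ^+ 2 + 2^-1) * s0.
have /andP[g0 g1] := gamma_itv; have /andP[b0 b1] := beta_itv.
have b1' : 0 < 1 - beta by rewrite subr_gt0.
have A0_gt0 : 0 < A0 by rewrite invr_gt0 sqrtr_gt0.
have L0 : 0 <= L by rewrite mulr_ge0 // invr_ge0 subr_ge0 ltW.
have D0 : 0 <= D by rewrite mulr_ge0.
have ADG : 0 <= A0 * (D * Gm) by rewrite mulr_ge0 ?(ltW A0_gt0) // mulr_ge0.
have K10 : 0 <= K1.
  rewrite divr_ge0 ?(ltW b1') // addr_ge0 //; last by rewrite mulr_ge0.
  by rewrite divr_ge0 ?mulr_ge0 ?sqr_ge0 // ltW.
have K20 : 0 <= K2.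
  by rewrite divr_ge0 ?(ltW b1') // addr_ge0 ?(ltW eta_gt0) // divr_ge0 // mulr_ge0 // ltW.
have nb0 : 0 <= nb by rewrite mulr_ge0 // addr_ge0 // mulr_ge0.
have dc0 : 0 <= dc.
  rewrite addr_ge0 // mulr_ge0 ?(ltW A0_gt0) // !addr_ge0 //.
  by rewrite divr_ge0 ?sqr_ge0 // mulr_ge0 // ltW.
have s01 : 1 <= s0 by rewrite lerDl ln_ge0 // lerDl divr_ge0 ?sqr_ge0 // ltW.
have s00 : 0 <= s0 by rewrite (le_trans _ s01).
have K0 : 0 < K.
  have h1 : 0 <= K2 * s0 by rewrite mulr_ge0.
  have h2 : 0 <= A0 * nb by rewrite mulr_ge0 // ltW.
  have h4 : 0 <= dc * eta ^+ 2 * s0 by rewrite mulr_ge0 // mulr_ge0 ?sqr_ge0.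
  by rewrite /K; lra.
exists (2 / c * K); first by rewrite mulr_gt0 // divr_gt0.
move=> x N tau.
pose V k := accum (S x k); pose m k := momentum (S x k).
pose G k := grad x k (th x k).
have m0 : m 0 = 0 by [].
have mS k : m k.+1 = beta *: m k + (1 - beta) *: G k by [].
have V0 : V 0 = 0 by [].
have VS k : V k.+1 = V k + norm2 (G k) ^+ 2 by [].
have th_ball k : norm2 (th x k) <= Rhat by exact: th_le.
have th_step k u : norm2 u <= Rhat -> norm2 (th x k.+1 - u) <=
    norm2 (th x k + (eta * A x k.+1) *: m k.+1 - u).
  by move=> uR; exact: proj_ball_nonexpansive.
have g_bound k y : norm2 y <= Rhat -> norm2 (grad x k y) <= Gm.
  by move=> yR; exact: path_grad_bound.
have g_lip k y z : norm2 (grad x k y - grad x k z) <= L * norm2 (y - z).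
  exact: path_grad_lip.
have A00 : stepsize V delta 0 = A0 by rewrite /stepsize V0 add0r.
have := pathwise_bound eta_gt0 delta_gt0 beta_itv m0 mS V0 VS th_step th_ball ts_le
  g_bound g_lip gbar_lip L0 Lbar_ge0 gbar_ts c_gt0 gbar_mono N tau.
have := adaptive_regret eta_gt0 delta_gt0 beta_itv m0 mS V0 VS th_step th_ball ts_le
  (fun k => g_bound k _ (th_ball k)) N.
have := sum_adagrad_le delta_gt0 V0 VS N.
rewrite /drift_const A00 -/nb -/dc.
set Sum := \sum_(k < N) stepsize V delta k.+1 ^+ 2 * _.
set X := \sum_(k < N) _ * dot _ _.
set Y := \sum_(k < N) _ * norm2 _ ^+ 2.
set Z := \sum_(k < N) (if _ then _ else _).
set t : R := tau%:R; set l := 1 + ln (1 + N%:R).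
move=> hS hX hY.
have t0 : 0 <= t by exact: ler0n.
have l1 : 1 <= l by rewrite lerDl ln_ge0 // lerDl.
have S0 : 0 <= Sum by apply: sumr_ge0 => k _; rewrite mulr_ge0 ?sqr_ge0.
have Sl : Sum <= s0 * l.
  have N0 : 0 <= N%:R :> R by [].
  have Gd : 0 <= Gm ^+ 2 / delta by rewrite divr_ge0 ?sqr_ge0 // ltW.
  apply: (@le_trans _ _ (ln ((1 + Gm ^+ 2 / delta) * (1 + N%:R)))).
    rewrite (le_trans hS) // ler_ln ?posrE; last 2 first.
    - by rewrite divr_gt0 // (@Vdelta_gt0 _ _ G V).
    - by rewrite mulr_gt0 // ltr_wpDr.
    rewrite mulrDl divff ?gt_eqF //.
    have : V N / delta <= N%:R * Gm ^+ 2 / delta.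
      by rewrite ler_wpM2r ?invr_ge0 ?(ltW delta_gt0) // accum_le.
    have : 0 <= Gm ^+ 2 / delta * 1 by rewrite mulr1.
    lra.
  rewrite lnM ?posrE ?ltr_wpDr // /s0 /l.
  have : 0 <= ln (1 + Gm ^+ 2 / delta) by rewrite ln_ge0 // lerDl.
  have : 0 <= ln (1 + N%:R : R) by rewrite ln_ge0 // lerDl.
  by set u := ln _; set v := ln _ => u0 v0; nra.
have hX' : X <= K1 + K2 * Sum.
  rewrite -(ler_pM2l b1') (le_trans hX) // /K1 /K2 le_eqVlt; apply/orP; left; apply/eqP.
  by field; rewrite !gt_eqF ?subr_gt0.
have -> : Y + 2 / c * Z = 2 / c * (c / 2 * Y + Z) by field; rewrite gt_eqF.
have -> : 2 / c * K * (1 + t) ^+ 2 * l = 2 / c * (K * (1 + t) ^+ 2 * l) by ring.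
rewrite ler_pM2l ?divr_gt0 // (le_trans hY) //.
set W := (1 + t) ^+ 2 * l.
have W1 : 1 <= W by rewrite /W; nra.
have Wt : t <= W by rewrite /W; nra.
have Wl : l <= W by rewrite /W; nra.
have Wtl : t ^+ 2 * l <= W by rewrite /W; nra.
have e1 : K1 <= K1 * W by rewrite ler_peMr.
have e2 : K2 * Sum <= K2 * s0 * W.
  by rewrite -mulrA ler_wpM2l // (le_trans Sl) // ler_wpM2l.
have e3 : t * A0 * nb <= A0 * nb * W.
  by rewrite -mulrA mulrC ler_wpM2l // mulr_ge0 // ltW.
have e4 : A0 * (D * Gm) <= A0 * (D * Gm) * W.
  by rewrite ler_peMr.
have e5 : dc * (t ^+ 2 * eta ^+ 2) * Sum <= dc * eta ^+ 2 * s0 * W.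
  have -> : dc * (t ^+ 2 * eta ^+ 2) * Sum = dc * eta ^+ 2 * (t ^+ 2 * Sum) by ring.
  have de0 : 0 <= dc * eta ^+ 2 by rewrite mulr_ge0 ?sqr_ge0.
  rewrite -[leRHS]mulrA ler_wpM2l //.
  apply: (@le_trans _ _ (t ^+ 2 * (s0 * l))); first by rewrite ler_wpM2l ?sqr_ge0.
  by rewrite mulrCA ler_wpM2l.
have e6 : 2^-1 * Sum <= 2^-1 * s0 * W.
  by rewrite -mulrA ler_wpM2l // (le_trans Sl) // ler_wpM2l.
have -> : K * (1 + t) ^+ 2 * l = K * W by rewrite /W; ring.
rewrite /K; move: hX' e1 e2 e3 e4 e5 e6; lra.
Qed.

End Combine.

(** T is one more than the integer part of ln (1 + N) / ln (1 / r). *)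
Lemma geometric_below (R : realType) (r : R) (N : nat) : 0 < r < 1 ->
  exists2 T : nat, r ^+ T <= (1 + N%:R)^-1 &
    1 + 2 * T%:R <= (3 + 2 / - ln r) * (1 + ln (1 + N%:R)).
Proof.
move=> /andP[r0 r1]; have l0 : 0 < - ln r by rewrite oppr_gt0 ln_lt0 // r0.
pose x := ln (1 + N%:R) / - ln r.
have n0 : 0 <= ln (1 + N%:R : R) by rewrite ln_ge0 // lerDl.
have n1 : 0 < 1 + N%:R :> R by rewrite ltr_wpDr.
have x0 : 0 <= x by rewrite divr_ge0 // ltW.
have /andP[] := truncn_itv x0; set T := Num.truncn x => Tx xT.
exists T.+1.
  rewrite -ler_ln ?posrE ?exprn_gt0 ?invr_gt0 // lnXn // lnV ?posrE // lerNr -mulNrn.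
  by rewrite -[leRHS]mulr_natr mulrC -ler_pdivrMr // ltW.
have {}Tx : T%:R * - ln r <= ln (1 + N%:R) by rewrite -ler_pdivlMr.
rewrite -[T.+1%:R]natr1.
have -> : (3 + 2 / - ln r) * (1 + ln (1 + N%:R)) =
    3 + 3 * ln (1 + N%:R) + 2 / - ln r + 2 * x.
  by rewrite /x; field; rewrite lt_eqF // -oppr_gt0.
have : 0 <= 2 / - ln r by rewrite divr_ge0 // ltW.
have : T%:R <= x by rewrite /x ler_pdivlMr.
lra.
Qed.

Section Rate.
Variables (R : realType) (n d : nat) (P : 'M[R]_n) (rew : 'I_n -> 'I_n -> R).
Variables (gamma B kappa rho : R) (pi_ : 'rV[R]_n) (Phi : 'M[R]_(n, d)).
Variables (lambda eta delta beta Rhat c Lbar : R) (theta1 ts : 'cV[R]_d).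
Hypothesis P_stoch : stochastic P.
Hypothesis gamma_itv : 0 < gamma < 1.
Hypothesis rew_bounded : forall x y, `|rew x y| <= B.
Hypothesis pi_gt0 : forall y, 0 < pi_ ord0 y.
Hypothesis pi_sum1 : \sum_y pi_ ord0 y = 1.
Hypothesis feature_le1 : forall x, norm2 (feature Phi x) <= 1.
Hypothesis lambda_itv : 0 <= lambda <= 1.
Hypothesis eta_gt0 : 0 < eta.
Hypothesis delta_gt0 : 0 < delta.
Hypothesis beta_itv : 0 <= beta < 1.
Hypothesis theta1_le : norm2 theta1 <= Rhat.
Hypothesis ts_le : norm2 ts <= Rhat.
Hypothesis B_ge0 : 0 <= B.
Hypothesis kappa_gt0 : 0 < kappa.
Hypothesis rho_itv : 0 < rho < 1.
Hypothesis mixing : forall t x,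
  \sum_(y < n) `|(P ^+ t) x y - pi_ ord0 y| <= kappa * rho ^+ t.

Local Notation S x k := (adatd rew gamma Phi lambda eta delta beta Rhat theta1 x k).
Local Notation th x k := (next_iter (S x k)).
Local Notation gbar := (mean_update P rew gamma Phi pi_ lambda).
Local Notation grad := (path_grad rew gamma Phi lambda eta delta beta Rhat theta1).
Local Notation A x k := (stepsize (fun i => accum (S x i)) delta k).

Hypothesis c_gt0 : 0 < c.
Hypothesis Lbar_ge0 : 0 <= Lbar.
Hypothesis gbar_ts : gbar ts = 0.
Hypothesis gbar_mono : forall x, c * norm2 (ts - x) ^+ 2 <= dot (ts - x) (gbar x).
Hypothesis gbar_lip : forall x y, norm2 (gbar x - gbar y) <= Lbar * norm2 (x - y).

Variables (mu : 'I_n -> R) (x0 : nat -> 'I_n).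
Hypothesis mu_ge0 : forall y, 0 <= mu y.
Hypothesis mu_sum1 : \sum_y mu y = 1.

Definition weighted_error k (x : nat -> 'I_n) : R := A x k * norm2 (ts - th x k) ^+ 2.

Lemma weighted_error_depends k : depends_upto k.+1 (weighted_error k).
Proof.
by move=> x y xy; rewrite /weighted_error /stepsize (adatd_depends _ _ _ _ _ _ _ _ _ xy).
Qed.

Local Notation bias := (frozen_bias gamma B kappa rho Rhat).

Lemma sum_weighted_error : exists2 C, 0 < C & forall N T,
  \sum_(k < N) mean mu P x0 k.+1 (weighted_error k) <=
  C * ((1 + 2 * T%:R) ^+ 2 * (1 + ln (1 + N%:R)) + N%:R * bias T).
Proof.
have [C1 C1_gt0 HC1] := path_bound gamma_itv rew_bounded feature_le1 lambda_itv
  eta_gt0 delta_gt0 beta_itv theta1_le ts_le B_ge0 c_gt0 Lbar_ge0 gbar_ts gbar_mono gbar_lip.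
pose C2 := 2 / c * (Num.sqrt delta)^-1.
have C2_gt0 : 0 < C2 by rewrite mulr_gt0 ?divr_gt0 // invr_gt0 sqrtr_gt0.
have R0 : 0 <= Rhat by rewrite (le_trans _ theta1_le) ?norm2_ge0.
have /andP[g0 g1] := gamma_itv; have /andP[r0 r1] := rho_itv.
exists (C1 + C2) => [|N T]; first exact: addr_gt0.
have bias0 : 0 <= bias T.
  by rewrite !mulr_ge0 ?invr_ge0 ?subr_ge0 ?addr_ge0 ?mulr_ge0 ?exprn_ge0 // ltW.
(* A common horizon for all k < N: the noise of index k reads coordinate k + 2. *)
pose E := mean mu P x0 (N + 2)%N.
have -> : \sum_(k < N) mean mu P x0 k.+1 (weighted_error k) =
    \sum_(k < N) E (weighted_error k).
  apply: eq_bigr => k _; apply/esym; apply: mean_depends => //.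
    exact: weighted_error_depends.
  by rewrite addn2 leqW // ltnS ltnW.
pose nz (k : nat) (x : nat -> 'I_n) := if (2 * T <= k)%N then
   A x (k - 2 * T)%N * noise (grad x) gbar ts k (th x (k - 2 * T)%N) else 0.
have nzE (k : 'I_N) : - ((Num.sqrt delta)^-1 * bias T) <= E (nz k).
  rewrite /nz; case: leqP => h; last first.
    rewrite /E /mean cond_exp0 lerNl oppr0 mulr_ge0 // invr_ge0 sqrtr_ge0 //.
  pose q := (k - 2 * T)%N; have kE : (q + 2 * T = k)%N by rewrite subnK.
  rewrite -/q -[nat_of_ord k]kE.
  have rho01 : 0 <= rho <= 1 by rewrite !ltW.
  apply: mean_noise_ge => //; first exact: ltW.
  by rewrite kE leq_add2r ltnW.
have := ler_cond_exp mu_ge0 P_stoch (N + 2) 0 x0 (fun x => HC1 x N (2 * T)%N).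
rewrite cond_expD cond_expZ !cond_exp_sum.
rewrite [X in _ <= X](cond_exp_depends mu_sum1 P_stoch _ _ (j := 0)) //.
have : - (N%:R * ((Num.sqrt delta)^-1 * bias T)) <= \sum_(k < N) E (nz k).
  have -> : - (N%:R * ((Num.sqrt delta)^-1 * bias T)) =
      \sum_(k < N) - ((Num.sqrt delta)^-1 * bias T).
    by rewrite sumr_const card_ord -[RHS]mulr_natl mulrN.
  by apply: ler_sum => k _; exact: nzE.
rewrite -/E.
set X := \sum_(k < N) E (weighted_error k); set Y := \sum_(k < N) E (nz k).
move=> hY hX.
have {}hX : X + 2 / c * Y <= C1 * (1 + (2 * T)%N%:R) ^+ 2 * (1 + ln (1 + N%:R)) by exact: hX.
have hY' : - (C2 * (N%:R * bias T)) <= 2 / c * Y.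
  have -> : - (C2 * (N%:R * bias T)) = 2 / c * - (N%:R * ((Num.sqrt delta)^-1 * bias T)).
    by rewrite /C2; ring.
  by rewrite ler_wpM2l // divr_ge0 // ltW.
rewrite natrM in hX.
have h1 : 0 <= N%:R * bias T by rewrite mulr_ge0.
have h2 : 0 <= (1 + 2 * T%:R : R) ^+ 2 * (1 + ln (1 + N%:R)).
  by rewrite mulr_ge0 ?sqr_ge0 // addr_ge0 // ln_ge0 // lerDl.
rewrite -[X in _ <= X]mulrA in hX.
move: hX hY' h1 h2.
set u := _ ^+ 2 * _; set v := N%:R * _ => hX hY' v0 u0.
have : 0 <= C2 * u by rewrite mulr_ge0 // ltW.
have : 0 <= C1 * v by rewrite mulr_ge0 // ltW.
lra.
Qed.

(** With r the larger of gamma and rho, one T of order ln N makes N times the bias bounded, while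
    T^2 ln N gives the cube. The least of the N terms is at most their average. *)
Lemma weighted_error_rate : exists2 C, 0 < C & forall N, (0 < N)%N ->
  exists2 k, (k < N)%N &
    mean mu P x0 k.+1 (weighted_error k) <= C * (1 + ln (1 + N%:R)) ^+ 3 / N%:R.
Proof.
have [C C_gt0 HC] := sum_weighted_error.
have R0 : 0 <= Rhat by rewrite (le_trans _ theta1_le) ?norm2_ge0.
have /andP[g0 g1] := gamma_itv; have /andP[r0 r1] := rho_itv.
pose r := Num.max gamma rho.
have r_itv : 0 < r < 1 by rewrite lt_max g0 gt_max g1.
have /andP[rr0 rr1] := r_itv.
pose b := 2 * Rhat * (B + 2 * Rhat) * (1 - gamma)^-1 * (2 + kappa).
have b0 : 0 <= b.
  by rewrite !mulr_ge0 ?invr_ge0 ?subr_ge0 ?addr_ge0 ?mulr_ge0 // ltW.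
pose k0 := 3 + 2 / - ln r.
have lr : 0 < - ln r by rewrite oppr_gt0 ln_lt0 // rr0.
exists (C * (k0 ^+ 2 + b)) => [|N N0].
  rewrite mulr_gt0 // ltr_wpDr // exprn_gt0 // ltr_wpDr // divr_ge0 // ltW //.
have [T rT hT] := geometric_below N r_itv.
have l1 : 1 <= 1 + ln (1 + N%:R) :> R by rewrite lerDl ln_ge0 // lerDl.
set l := 1 + ln _ in hT l1 *.
have NR : 0 < N%:R :> R by rewrite ltr0n.
have biasT : N%:R * bias T <= b.
  have hb : bias T <= b * r ^+ T.
    rewrite /b -[leRHS]mulrA ler_wpM2l //.
      by rewrite !mulr_ge0 ?invr_ge0 ?subr_ge0 ?addr_ge0 ?mulr_ge0 // ltW.
    rewrite [leRHS]mulrDl lerD // ler_wpM2l ?(ltW kappa_gt0) // lerXn2r ?nnegrE ?(ltW g0) ?(ltW r0) ?(ltW rr0) //.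
    - by rewrite le_max lexx.
    - by rewrite le_max lexx orbT.
  have : N%:R * r ^+ T <= 1.
    by rewrite (le_trans (ler_wpM2l (ltW NR) rT)) // ler_pdivrMr ?mul1r ?lerDr //.
  have : N%:R * bias T <= N%:R * (b * r ^+ T) by rewrite ler_wpM2l // ltW.
  nra.
have total : \sum_(k < N) mean mu P x0 k.+1 (weighted_error k) <= C * (k0 ^+ 2 + b) * l ^+ 3.
  apply: (le_trans (HC N T)); rewrite -mulrA ler_wpM2l ?(ltW C_gt0) //.
  have : (1 + 2 * T%:R) ^+ 2 <= (k0 * l) ^+ 2 :> R.
    have t0 : 0 <= 1 + 2 * T%:R :> R by rewrite addr_ge0 ?mulr_ge0.
    by rewrite lerXn2r ?nnegrE // (le_trans t0 hT).
  have l3 : 1 <= l ^+ 3 by rewrite exprn_ege1.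
  have : b <= b * l ^+ 3 by rewrite ler_peMr.
  move=> h1 h2; have : (1 + 2 * T%:R) ^+ 2 * l <= (k0 * l) ^+ 2 * l.
    by rewrite ler_wpM2r // (le_trans _ l1).
  have -> : (k0 * l) ^+ 2 * l = k0 ^+ 2 * l ^+ 3 by ring.
  rewrite -/l;   lra.
apply: contrapT => none.
have big k : (k < N)%N -> C * (k0 ^+ 2 + b) * l ^+ 3 / N%:R <
    mean mu P x0 k.+1 (weighted_error k).
  by move=> kN; rewrite ltNge; apply/negP => h; apply: none; exists k.
have : C * (k0 ^+ 2 + b) * l ^+ 3 < \sum_(k < N) mean mu P x0 k.+1 (weighted_error k).
  have -> : C * (k0 ^+ 2 + b) * l ^+ 3 = \sum_(k < N) C * (k0 ^+ 2 + b) * l ^+ 3 / N%:R.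
    by rewrite sumr_const card_ord -[RHS]mulr_natr divfK // gt_eqF.
  apply: ltr_sum => [|k _]; last exact: big.
  by apply/hasP; exists (Ordinal N0); rewrite ?mem_index_enum.
by rewrite ltNge total.
Qed.

End Rate.

(** Take K = floor (b ln^6 b). Since b^alpha = L^2 / (eps ell^2) with L = ln (1/eps), and 6 alpha >=
    3, K^alpha beats the cubed logarithm of the rate and leaves a factor L^2, which exceeds every
    constant for small eps. So neither the constant 1 nor the exponent 6 depends on C or ell. *)
Lemma complexity_le_of_rate (R : realType) (err : nat -> \bar R) (b : R -> R)
    (C alpha ell : R) : 0 < C -> 2^-1 <= alpha <= 1 -> 0 < ell ->
  (forall K, (0 < K)%N ->
     accurate err (C * (1 + ln (1 + K%:R)) ^+ 3 / K%:R `^ alpha) K) ->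
  (forall eps, 0 < eps < 1 ->
     b eps = (ln eps^-1 ^+ 2 / (eps * ell ^+ 2)) `^ alpha^-1) ->
  complexity_le err 1 6 b.
Proof.
move=> C0 /andP[a0 a1] ell0 rate bE.
(* L > M ensures L >= 1, then L >= ell, hence y >= 1 / eps, and finally that L^2 absorbs the
   constants below. *)
pose M := 1 + ell + 2 * 9 ^+ 3 * (C * ell ^+ 2).
have ell2 : 0 < ell ^+ 2 by rewrite exprn_gt0.
have M0 : 0 < 2 * 9 ^+ 3 * (C * ell ^+ 2).
  by apply: mulr_gt0; [apply: mulr_gt0; rewrite ?exprn_gt0|exact: mulr_gt0].
rewrite /complexity_le; near=> eps.
have e0 : 0 < eps by near: eps; exact: nbhs_right_gt.
have eM : eps < expR (- M) by near: eps; apply: nbhs_right_lt; exact: expR_gt0.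
pose L := ln eps^-1.
have LM : M < L by rewrite /L lnV // ltrNr -ltr_expR lnK.
have L1 : 1 <= L by rewrite /M in LM; lra.
have Lell : ell <= L by rewrite /M in LM; lra.
have L2 : 2 * 9 ^+ 3 * (C * ell ^+ 2) <= L ^+ 2.
  by have : L <= L ^+ 2 by [rewrite expr2 ler_peMr ?(le_trans _ L1)]; rewrite /M in LM; lra.
have e1 : eps < 1.
  by rewrite (lt_le_trans eM) // -expR0 ler_expR; rewrite /M; lra.
have alpha0 : 0 < alpha by rewrite (lt_le_trans _ a0).
pose y := L ^+ 2 / (eps * ell ^+ 2).
have yL : eps^-1 <= y.
  rewrite /y invfM mulrA mulrAC -[leLHS]mul1r ler_wpM2r ?invr_ge0 ?(ltW e0) //.
  by rewrite ler_pdivlMr // mul1r lerXn2r ?nnegrE ?(ltW ell0) // (le_trans _ L1).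
have y1 : 1 <= y by rewrite (le_trans _ yL) // invf_ge1 // ltW.
have y0 : 0 < y by rewrite (lt_le_trans _ y1).
have be := bE eps _; rewrite e0 e1 in be; have {}be := be isT.
rewrite -/L -/y in be; rewrite be; set bb := y `^ alpha^-1.
have yb : y <= bb by rewrite le1r_powR // invf_ge1.
have b1 : 1 <= bb by rewrite (le_trans y1).
have b0 : 0 < bb by rewrite (lt_le_trans _ b1).
pose lb := ln bb.
have lb1 : 1 <= lb.
  by rewrite (le_trans L1) // ler_ln ?posrE ?invr_gt0 // (le_trans yL).
have lb0 : 0 < lb by rewrite (lt_le_trans _ lb1).
pose X := bb * lb ^+ 6.
have X1 : 1 <= X by rewrite mulr_ege1 // exprn_ege1.
have X0 : 0 < X by rewrite (lt_le_trans _ X1).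
have /andP[] := truncn_itv (ltW X0); set K := Num.truncn X => KX XK.
exists K; last by rewrite mul1r.
have K1 : (0 < K)%N by rewrite truncn_gt_nat.
have KR : 1 <= K%:R :> R by rewrite ler1n.
apply: (le_trans (rate K K1)); rewrite lee_fin.
have K0 : 0 < K%:R :> R by rewrite ltr0n.
rewrite ler_pdivrMr ?powR_gt0 //.
(* From 1 + K <= 2 X: the left side is at most 1 + ln 2 + lb + 6 ln lb <= 2 + 7 lb, and lb >= 1. *)
have h1 : 1 + ln (1 + K%:R) <= 9 * lb.
  have : ln (1 + K%:R) <= ln (2 * X).
    by rewrite ler_ln ?posrE ?mulr_gt0 ?addr_gt0 //; lra.
  rewrite lnM ?posrE // /X lnM ?posrE ?exprn_gt0 // lnXn // -/lb.
  have : ln (2 : R) <= 1 by have := @le_ln1Dx R 1; rewrite (_ : 1 + 1 = 2) //; apply; lra.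
  by have := ln_sublinear lb0; rewrite -mulr_natr; lra.
have h2 : y * lb ^+ 3 / 2 <= K%:R `^ alpha.
  have XK2 : X / 2 <= K%:R by rewrite -natr1 in XK; lra.
  have : (X / 2) `^ alpha <= K%:R `^ alpha.
    by rewrite ge0_ler_powR ?nnegrE ?divr_ge0 // ltW.
  apply: le_trans; rewrite powRM ?(ltW X0) ?invr_ge0 //.
  have ylb0 : 0 <= y * lb ^+ 3 by rewrite mulr_ge0 ?(ltW y0) // exprn_ge0 // ltW.
  rewrite ler_pM ?invr_ge0 //; last first.
    by rewrite ger1_powR // invr_gt0 ltr0n /= invf_le1 // ler1n.
  rewrite /X powRM ?exprn_ge0 ?(ltW b0) ?(ltW lb0) //.
  rewrite /bb -powRrM mulVf ?gt_eqF // powRr1 ?(ltW y0) // ler_wpM2l ?(ltW y0) //.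
  rewrite -(powR_mulrn 3) ?(ltW lb0) // -(powR_mulrn 6) ?(ltW lb0) // -powRrM.
  by rewrite ler_powR //; lra.
have h3 : (1 + ln (1 + K%:R)) ^+ 3 <= (9 * lb) ^+ 3.
  by rewrite lerXn2r ?nnegrE ?mulr_ge0 ?(ltW lb0) // addr_ge0 // ln_ge0 // lerDl.
apply: (le_trans (ler_wpM2l (ltW C0) h3)).
apply: (le_trans _ (ler_wpM2l (ltW e0) h2)).
have -> : eps * (y * lb ^+ 3 / 2) = L ^+ 2 / ell ^+ 2 / 2 * lb ^+ 3.
  by rewrite /y; field; rewrite !gt_eqF.
rewrite exprMn mulrA ler_wpM2r ?exprn_ge0 ?(ltW lb0) //.
rewrite ler_pdivlMr // ler_pdivlMr //; apply: le_trans L2.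
by rewrite le_eqVlt; apply/orP; left; apply/eqP; ring.
Unshelve. all: by end_near. Qed.

(** * Complexity *)

Section Expected.
Variables (R : realType) (n d : nat) (P : 'M[R]_n) (rew : 'I_n -> 'I_n -> R).
Variables (gamma : R) (Phi : 'M[R]_(n, d)).
Variables (lambda eta delta beta Rhat : R) (theta1 ts : 'cV[R]_d).
Variables (disp : measure_display) (Omega : measurableType disp).
Variables (Pr : probability Omega R) (s : nat -> Omega -> 'I_n).
Hypothesis s_markov : markov_trajectory P Pr s.
Hypothesis delta_gt0 : 0 < delta.
Variable x0 : nat -> 'I_n.

Local Notation S x k := (adatd rew gamma Phi lambda eta delta beta Rhat theta1 x k).
Local Notation traj := (fun w k => s k w).
Local Notation werr := (weighted_error rew gamma Phi lambda eta delta beta Rhat theta1 ts).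

(** The growth of v^k bounds 1 / A_k by sqrt (c + delta) K^(nu/2), which removes the random weight
    almost surely; the weighted error then has a finite-sum mean. *)
Lemma expected_error_le (c nu : R) K k : 0 < c -> 0 < nu -> (k < K)%N ->
  {ae Pr, forall w, forall j, (1 <= j)%N -> accum (S (traj w) j) <= c * j%:R `^ nu} ->
  ('E_Pr[fun w => (norm2 (ts - next_iter (S (traj w) k)) ^+ 2)%R] <=
   (Num.sqrt (c + delta) * K%:R `^ (nu / 2)
     * mean (init_law Pr s) P x0 k.+1 (werr k))%R%:E)%E.
Proof.
move=> c0 nu0 kK aeV; rewrite unlock.
have K1 : 1 <= K%:R :> R by rewrite ler1n (leq_ltn_trans _ kK).
have K0 : 0 < K%:R :> R by rewrite (lt_le_trans _ K1).
set W := Num.sqrt (c + delta) * _.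
have W0 : 0 <= W by rewrite mulr_ge0 ?sqrtr_ge0 ?powR_ge0.
have dW : depends_upto k.+1 (fun x => W * werr k x).
  by move=> x y xy; rewrite (weighted_error_depends _ _ _ _ _ _ _ _ _ _ xy).
have dE : depends_upto k.+1 (fun x => norm2 (ts - next_iter (S x k)) ^+ 2).
  by move=> x y xy; rewrite (adatd_depends _ _ _ _ _ _ _ _ _ xy).
have <- : (\int[Pr]_w (W * werr k (traj w))%:E)%E =
    (W * mean (init_law Pr s) P x0 k.+1 (werr k))%:E.
  by rewrite (integral_mean s_markov x0 dW) /mean cond_expZ.
have h j x : accum (S x j) <= c * K%:R `^ nu -> 0 <= accum (S x j) ->
    norm2 (ts - next_iter (S x j)) ^+ 2 <= W * werr j x.
  move=> Vc V0; rewrite /weighted_error /stepsize mulrA ler_peMl ?sqr_ge0 //.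
  have Vd : 0 < accum (S x j) + delta by rewrite ltr_wpDl.
  rewrite ler_pdivlMr ?sqrtr_gt0 // mul1r /W.
  rewrite (_ : K%:R `^ (nu / 2) = Num.sqrt (K%:R `^ nu)); last first.
    by rewrite powRrM powR12_sqrt // powR_ge0.
  rewrite -sqrtrM ?addr_ge0 ?(ltW c0) ?(ltW delta_gt0) // ler_wsqrtr // mulrDl lerD //.
  rewrite ler_peMr ?(ltW delta_gt0) //.
  by have := ler_powR K1 (ltW nu0); rewrite powRr0.
have V0 j x : 0 <= accum (S x j).
  by elim: j => [//|j IH] /=; rewrite addr_ge0 ?sqr_ge0.
apply: ae_ge0_le_integral => //.
- by move=> w _; rewrite lee_fin sqr_ge0.
- by apply/measurable_EFinP; exact: (measurable_depends s_markov x0 dE).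
- move=> w _; rewrite lee_fin mulr_ge0 // mulr_ge0 ?sqr_ge0 //.
  by rewrite invr_ge0 sqrtr_ge0.
- by apply/measurable_EFinP; exact: (measurable_depends s_markov x0 dW).
apply: filterS aeV => w Vw _; rewrite lee_fin; apply: h => //.
(* The assumed bound on v starts at index 1; at index 0 the accumulator is 0. *)
case: k kK {dW dE} => [|k] kK; first by rewrite mulr_ge0 ?powR_ge0 ?(ltW c0).
apply: (le_trans (Vw k.+1 isT)); rewrite ler_wpM2l ?(ltW c0) //.
by rewrite ge0_ler_powR ?nnegrE ?(ltW nu0) // ler_nat ltnW.
Qed.

End Expected.

Lemma accurate_of_witness (R : realType) (err : nat -> \bar R) eps K k :
  (k < K)%N -> (err k.+1 <= eps%:E)%E -> accurate err eps K.
Proof.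
move=> kK h; rewrite /accurate big_add1 big_mkord.
apply: le_trans h; exact: (bigmin_le _ (Ordinal kK)).
Qed.

Unset Implicit Arguments.

Theorem proposition1 (R : realType) (n d : nat)
  (P : 'M[R]_n) (rew : 'I_n -> 'I_n -> R) (gamma B kappa : R)
  (pi_ : 'rV[R]_n) (Phi : 'M[R]_(n, d))
  (lambda eta delta beta Rhat : R) (theta1 thetastar : 'cV[R]_d)
  (disp : measure_display) (Omega : measurableType disp)
  (Pr : probability Omega R) (s : nat -> Omega -> 'I_n)
  (P_stochastic : stochastic P)
  (gamma_itv : 0 < gamma < 1)
  (rew_bounded : forall x y, `|rew x y| <= B)
  (pi_limit : forall x y, (P ^+ t) x y @[t --> \oo] --> pi_ ord0 y)
  (pi_gt0 : forall y, 0 < pi_ ord0 y)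
  (kappa_gt0 : 0 < kappa)
  (d_lt_n : (d < n)%N)
  (feature_le1 : forall x, norm2 (feature Phi x) <= 1)
  (Phi_rank : \rank Phi = d)
  (lambda_itv : 0 <= lambda <= 1)
  (thetastar_zero : mean_update P rew gamma Phi pi_ lambda thetastar = 0)
  (s_markov : markov_trajectory P Pr s)
  (eta_gt0 : 0 < eta) (delta_gt0 : 0 < delta) (beta_itv : 0 <= beta < 1)
  (Rhat_ge : 2 * B / (Num.sqrt (lambda_min (feature_gram Phi pi_))
                       * (1 - gamma)
                       * Num.sqrt (1 - gamma * (1 - lambda)
                                       / (1 - gamma * lambda))) <= Rhat)
  (theta1_le : norm2 theta1 <= Rhat) :
  let traj (w : Omega) (k : nat) := s k w in
  let theta k w :=
    adatd_theta rew gamma Phi lambda eta delta beta Rhat theta1 (traj w) k in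
  let v k w :=
    adatd_v rew gamma Phi lambda eta delta beta Rhat theta1 (traj w) k in
  let err k := ('E_Pr[fun w => (norm2 (thetastar - theta k w) ^+ 2)%R])%E in
  let mixing rho := forall t x,
    \sum_(y < n) `|(P ^+ t) x y - pi_ ord0 y| <= kappa * rho ^+ t in
  (exists (C : R) (p : nat), 0 < C /\
     forall rho, 0 < rho < 1 -> mixing rho ->
     complexity_le err C p (fun eps =>
       ln eps^-1 ^+ 4 / (eps ^+ 2 * ln rho^-1 ^+ 4)))
  /\
  (forall c nu : R, 0 < c -> 0 < nu <= 1 ->
     {ae Pr, forall w, forall k, (1 <= k)%N -> v k w <= c * k%:R `^ nu} ->
     exists (C : R) (p : nat), 0 < C /\
     forall rho, 0 < rho < 1 -> mixing rho ->
     complexity_le err C p (fun eps =>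
       ln eps^-1 `^ (2 / (1 - nu / 2))
       / (eps `^ (1 / (1 - nu / 2)) * ln rho^-1 `^ (2 / (1 - nu / 2))))).

Proof.
move=> traj theta v err mixing.
have x0 : 'I_n := Ordinal (leq_ltn_trans (leq0n d) d_lt_n).
have B_ge0 : 0 <= B by rewrite (le_trans _ (rew_bounded x0 x0)).
have pi_sum1 := stationary_sum1 P_stochastic pi_limit x0.
have pi_stat := stationaryE P_stochastic pi_limit.
have Rhat_ge0 : 0 <= Rhat by rewrite (le_trans _ theta1_le) ?norm2_ge0.
have ts_le : norm2 thetastar <= Rhat.
  exact: (fixed_point_in_ball P_stochastic gamma_itv rew_bounded pi_gt0 pi_stat pi_sum1
    Phi_rank lambda_itv B_ge0 thetastar_zero Rhat_ge0 Rhat_ge).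
have [m m_gt0 mono] : exists2 m, 0 < m & forall x, m * norm2 (thetastar - x) ^+ 2 <=
    dot (thetastar - x) (mean_update P rew gamma Phi pi_ lambda x).
  have g1 : 0 < 1 - gamma by case/andP: gamma_itv => _; rewrite subr_gt0.
  have mono := mean_update_monotone P_stochastic gamma_itv pi_gt0 pi_stat lambda_itv.
  (* In dimension 0 both sides vanish and any constant serves; otherwise the modulus is (1 - gamma)
     omega. *)
  case: (posnP d) => [d0|d_gt0].
    exists 1 => // x; have -> : thetastar - x = 0.
      by apply/matrixP => i; have := ltn_ord i; rewrite {2}d0.
    by rewrite norm20 dot0l expr0n mulr0.
  have [w_gt0 wP] := lambda_min_feature_gram pi_gt0 Phi_rank d_gt0.
  exists ((1 - gamma) * lambda_min (feature_gram Phi pi_)) => [|x]; first exact: mulr_gt0.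
  apply: le_trans (mono _ _ _ x thetastar thetastar_zero).
  by rewrite -mulrA ler_wpM2l ?wP // ltW.
have lip := mean_update_lip rew P_stochastic gamma_itv pi_gt0 pi_sum1 feature_le1 lambda_itv.
have Lip_ge0 : 0 <= 2 / (1 - gamma).
  by case/andP: gamma_itv => _ g1; rewrite divr_ge0 // subr_ge0 ltW.
have init_sum1 := init_law_sum1 s_markov x0.
(* Common form of both bounds, with alpha = 1 - nu / 2. *)
have complexity c nu rho b : 0 < c -> 0 < nu <= 1 ->
    {ae Pr, forall w, forall k, (1 <= k)%N -> v k w <= c * k%:R `^ nu} ->
    0 < rho < 1 -> mixing rho ->
    (forall eps, 0 < eps < 1 -> b eps =
       (ln eps^-1 ^+ 2 / (eps * ln rho^-1 ^+ 2)) `^ (1 - nu / 2)^-1) ->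
    complexity_le err 1 6 b.
  move=> c_gt0 /andP[nu_gt0 nu_le1] aev rho_itv mix bE.
  have [C C_gt0 HC] := weighted_error_rate P_stochastic gamma_itv rew_bounded pi_gt0 pi_sum1
    feature_le1 lambda_itv eta_gt0 delta_gt0 beta_itv theta1_le ts_le B_ge0 kappa_gt0
    rho_itv mix m_gt0 Lip_ge0 thetastar_zero mono lip (fun=> x0) (init_law_ge0 Pr s) init_sum1.
  have sq0 : 0 < Num.sqrt (c + delta) by rewrite sqrtr_gt0 addr_gt0.
  apply: (@complexity_le_of_rate _ _ _ (Num.sqrt (c + delta) * C) (1 - nu / 2) (ln rho^-1)).
  - exact: mulr_gt0.
  - by apply/andP; split; lra.
  - by case/andP: rho_itv => r0 r1; rewrite lnV // oppr_gt0 ln_lt0 // r0.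
  - move=> K K_gt0; have [k kK hk] := HC K K_gt0.
    apply: (accurate_of_witness kK).
    apply: le_trans (expected_error_le thetastar s_markov delta_gt0 (fun=> x0) c_gt0 nu_gt0 kK aev) _.
    have K0 : 0 < K%:R :> R by rewrite ltr0n.
    rewrite lee_fin.
    have -> : Num.sqrt (c + delta) * C * (1 + ln (1 + K%:R)) ^+ 3 / K%:R `^ (1 - nu / 2) =
      Num.sqrt (c + delta) * K%:R `^ (nu / 2) * (C * (1 + ln (1 + K%:R)) ^+ 3 / K%:R).
      rewrite powRB; last by rewrite (gt_eqF K0) implybT.
      by rewrite powRr1 ?(ltW K0) //; field; rewrite !gt_eqF // powR_gt0.
    by rewrite ler_wpM2l // mulr_ge0 ?powR_ge0 // ltW.
  - exact: bE.
split.
  pose Gm := (B + 2 * Rhat) / (1 - gamma).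
  exists 1, 6; split=> // rho rho_itv mix.
  (* The gradients are bounded by Gm, so v^k <= Gm^2 k and nu = 1; adding 1 keeps the constant
     positive. Here 1 / alpha = 2. *)
  apply: (complexity (Gm ^+ 2 + 1) 1 rho) => //.
  - by rewrite ltr_wpDl ?sqr_ge0.
  - by rewrite ltr01 lexx.
  - apply: aeW => w k k1; rewrite powRr1 // mulrDl mul1r mulrC.
    apply: (@le_trans _ _ (k%:R * Gm ^+ 2)); last by rewrite lerDl.
    exact: accum_le.
  - move=> eps /andP[e0 e1].
    have L0 : 0 < ln eps^-1 by rewrite lnV // oppr_gt0 ln_lt0 // e0.
    have l0 : 0 < ln rho^-1.
      by case/andP: rho_itv => r0 r1; rewrite lnV // oppr_gt0 ln_lt0 // r0.
    have -> : (1 - 1 / 2)^-1 = 2%:R :> R by field.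
    rewrite powR_mulrn; last by rewrite divr_ge0 ?sqr_ge0 // mulr_ge0 ?sqr_ge0 // ltW.
    by field; rewrite !gt_eqF.
move=> c nu c_gt0 nu_itv aev; exists 1, 6; split=> // rho rho_itv mix.
apply: (complexity c nu rho) => // eps /andP[e0 e1].
have L0 : 0 < ln eps^-1 by rewrite lnV // oppr_gt0 ln_lt0 // e0.
have l0 : 0 < ln rho^-1.
  by case/andP: rho_itv => r0 r1; rewrite lnV // oppr_gt0 ln_lt0 // r0.
set a := 1 - nu / 2.
have p0 : 0 <= eps * ln rho^-1 ^+ 2 by rewrite mulr_ge0 ?sqr_ge0 // ltW.
rewrite (powRM _ (sqr_ge0 _)) ?invr_ge0 // -(powR_inv1 p0) powRAC powR_inv1 ?powR_ge0 //.
rewrite (powRM _ (ltW e0) (sqr_ge0 _)) -(powR_mulrn 2 (ltW L0)) -(powR_mulrn 2 (ltW l0)).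
by rewrite -!powRrM div1r.
Qed.
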